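(* Let $p$ be a prime and let $\phi\in\overline{\mathbb{F}}_p(t)(z)$ be non-isotrivial of degree at least two. Let $a\in\mathbb{P}^1(\overline{\mathbb{F}}_p(t))$ be a wandering point for $\phi$, and for each $n$ write $\phi^n(a)=a_n/b_n$ with $a_n,b_n\in\overline{\mathbb{F}}_p[t]$ coprime. If neither $0$ nor $\infty$ is a post-critical point for $\phi$, then \[\frac12\leq\liminf_{n\to\infty}\frac{\deg(a_n)}{\deg(b_n)}\leq\limsup_{n\to\infty}\frac{\deg(a_n)}{\deg(b_n)}\leq 2.\]
   Context: A point $a$ is wandering for $\phi$ if its forward orbit $\{\phi^n(a)\}_{n\geq1}$ is infinite. A rational map $\phi$ over $K=\overline{\mathbb{F}}_p(t)$ is isotrivial if some degree-one change of coordinates $\mu$ over $\overline{K}$ makes $\mu\circ\phi\circ\mu^{-1}$ have coefficients in $\overline{\mathbb{F}}_p$; otherwise non-isotrivial. A point $c\in\mathbb{P}^1(\overline{K})$ is critical for $\phi$ if the ramification index (local multiplicity) $e_\phi(c)>1$. A point $\gamma$ is post-critical for $\phi$ if $\gamma=\phi^n(c)$ for some critical point $c$ of $\phi$ and some $n\geq1$. *)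

(* Defs.v *)
From HB Require Import structures.
From mathcomp Require Import all_boot all_order all_algebra.
From mathcomp Require Import all_classical all_reals all_analysis.

Set Implicit Arguments.
Unset Strict Implicit.
Unset Printing Implicit Defensive.

Import Order.TTheory GRing.Theory Num.Theory.
Local Open Scope ring_scope.
Local Open Scope quotient_scope.

(* F(z).  An element is written num / den in lowest terms; this is unique up to
   a common nonzero scalar, on which nothing below depends. *)
Notation "{ 'ratfun' F }" := {fraction {poly F}}
  (format "{ 'ratfun'  F }") : type_scope.

Section RationalFunctions.
Variable F : fieldType.
Implicit Types f g : {ratfun F}.

Definition rnum f : {poly F} :=
  let r : {ratio {poly F}} := repr f in r.1 %/ gcdp r.1 r.2.

Definition rden f : {poly F} :=
  let r : {ratio {poly F}} := repr f in r.2 %/ gcdp r.1 r.2.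

Definition pdeg (q : {poly F}) : nat := (size q).-1.

Definition rdeg f : nat := maxn (pdeg (rnum f)) (pdeg (rden f)).

Definition rX : {ratfun F} := tofrac 'X.

(* Substitution f(g(z)), computed in the field F(z).  It is the composite of
   maps of P^1 unless g is a constant that is a pole of f; it is only used for
   nonconstant g. *)
Definition rcomp f g : {ratfun F} :=
  let ev (q : {poly F}) := (map_poly (@tofrac {poly F} \o polyC) q).[g] in
  ev (rnum f) / ev (rden f).

(* P^1(F): Some x is the affine point x, None is the point at infinity. *)
Definition P1 : Type := option F.

(* At infinity the value is the quotient of the coefficients of degree rdeg f. *)
Definition reval f (P : P1) : P1 :=
  let: (u, v) := match P with
    | Some x => ((rnum f).[x], (rden f).[x])
    | None => ((rnum f)`_(rdeg f), (rden f)`_(rdeg f))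
    end in
  if v == 0 then None else Some (u / v).

(* Dehomogenization of the binary form of degree rdeg f whose zeros, with
   multiplicity, are the fibre of f above Q; its order of vanishing at infinity
   is therefore rdeg f minus its degree in z. *)
Definition rfibre f (Q : P1) : {poly F} :=
  if Q is Some y then rnum f - y *: rden f else rden f.

Definition ramification_index f (P : P1) : nat :=
  let q := rfibre f (reval f P) in
  match P with
  | Some x => mup x q
  | None => (rdeg f - pdeg q)%N
  end.

Definition critical f (P : P1) : Prop := (1 < ramification_index f P)%N.

Definition post_critical f (Q : P1) : Prop :=
  exists (P : P1) (n : nat),
    [/\ critical f P, (1 <= n)%N & Q = iter n (reval f) P].

Definition wandering f (P : P1) : Prop :=
  infinite_set
    [set iter n (reval f) P | n in [set n : nat | (1 <= n)%N]]%classic.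

End RationalFunctions.

Definition rmap (F E : fieldType) (i : {rmorphism F -> E}) (f : {ratfun F}) :
  {ratfun E} := tofrac (map_poly i (rnum f)) / tofrac (map_poly i (rden f)).

Definition algebraic_extension (F E : fieldType) (i : {rmorphism F -> E}) :
  Prop := forall x : E, algebraicOver i x.

(* The constants of k(t), inside an extension L of k(t). *)
Definition constants (k L : fieldType) (j : {rmorphism {ratfun k} -> L}) :
  {rmorphism k -> L} := j \o (@tofrac {poly k}) \o polyC.

Definition isotrivial (k L : fieldType) (j : {rmorphism {ratfun k} -> L})
    (phi : {ratfun {ratfun k}}) : Prop :=
  exists (mu nu : {ratfun L}) (psi : {ratfun k}),
    [/\ rdeg mu = 1%N, rcomp mu nu = rX L, rcomp nu mu = rX L
      & rcomp mu (rcomp (rmap j phi) nu) = rmap (constants j) psi].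

(* Coprime homogeneous coordinates in k[t] of a point of P^1(k(t)). *)
Definition pt_num (k : fieldType) (P : P1 {ratfun k}) : {poly k} :=
  if P is Some x then rnum x else 1.

Definition pt_den (k : fieldType) (P : P1 {ratfun k}) : {poly k} :=
  if P is Some x then rden x else 0.

(* deg a_n / deg b_n.  In \bar R, x / 0 is +oo for x > 0, and 0 / 0 is 0.  The
   zero polynomial gets degree 0; as a wandering orbit meets 0 and infinity at
   most once each, this does not affect the limits. *)
Definition degree_ratio (R : realType) (k : fieldType)
    (phi : {ratfun {ratfun k}}) (a : P1 {ratfun k}) (n : nat) : \bar R :=
  let P := iter n (reval phi) a in
  ((pdeg (pt_num P))%:R%:E / (pdeg (pt_den P))%:R%:E)%E.

(* Main.v *)
(* Suppose that deg a_N is much smaller than deg b_N for infinitely many N; the opposite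
   case is the same with oo in place of 0. Fix m. As 0 is not post-critical, its fibre
   under phi^m consists of d^m distinct points, and in the place t = oo the point
   x = phi^(N-m)(a) approaches this fibre with an exponent larger than (1/2 + e) d^m. In
   characteristic p, Osgood's method then shows that the approximations x satisfy one
   Riccati equation x' = q(x) with deg q <= 2. Cross ratios of its solutions have derivative
   0, so they are p-th powers y^p, and y approaches in the same way the p-th roots of cross
   ratios of more than half of the fibre. The argument can thus be repeated, and as degrees
   over k(t) remain bounded these cross ratios of the fibre are constant: more than half of
   the fibre of phi^m lies in mu_m^-1(P^1(k)) for some
   coordinate mu_m. Counting, phi maps more than 2 d such points of level m + 1 to such
   points of level m, so mu_m phi mu_(m+1)^-1 is defined over k. For all large m the
   coordinates mu_m then send the critical points of phi and their iterated preimages to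
   P^1(k); three of these points determine mu_m up to PGL_2(k), which makes phi isotrivial,
   and the maps with fewer such points are isotrivial by inspection. Heights tend to
   infinity along the orbit by Northcott's theorem. *)

Require Import Defs.
From HB Require Import structures.
From mathcomp Require Import all_boot all_order all_algebra.
From mathcomp Require Import all_classical all_reals all_analysis.
From mathcomp Require Import zify ring lra separable finfield.

Set Implicit Arguments.
Unset Strict Implicit.
Unset Printing Implicit Defensive.

Import Order.TTheory GRing.Theory Num.Theory.
Local Open Scope ring_scope.
Local Notation "x %:F" := (@tofrac _ x) (at level 1, format "x %:F").

(** * Rational functions in one variable *)

(** In characteristic [p] there is no Roth theorem: exponents up to the degree of the target can
    occur, so the size of one approximation gives no contradiction by itself, and non-isotriviality
    has to enter. The exponent 1/2 is a count of coefficients. Polynomials of degrees [s] and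
    [s + 2] have [2 s + 4] coefficients, divisibility by [H] imposes [deg H] conditions on them, and
    the resulting expression in [x] and [x'] vanishes once the exponent exceeds [s + 2]; slightly
    more than half of [deg H] thus suffices. The loss is an additive constant while the gain [e d^m]
    grows with [m], hence the passage to iterates. That the fibre consists of distinct points makes
    the target separable, which the elimination of [x'] requires. The descent passes to a [p]-th
    root in a coordinate that changes at every step; cross ratios survive this, up to [p]-th powers.
    The same half reappears at the end: subsets of density above 1/2 at two consecutive levels leave
    more than [2 d] matching points, and two maps of degree [d] that agree at more than [2 d] points
    coincide. *)

Lemma derivation_horner (R : comNzRingType) (D : R -> R) : D 0 = 0 ->
    {morph D : x y / x + y} -> (forall x y, D (x * y) = D x * y + x * D y) ->
  forall (P : {poly R}) x, D P.[x] = (map_poly D P).[x] + P^`().[x] * D x.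
Proof.
move=> D0 DD DM P x; elim/poly_ind: P => [|P c IH].
  by rewrite horner0 D0 map_poly0 deriv0 !horner0 mul0r addr0.
have cE (q : {poly R}) i : (map_poly D q)`_i = D q`_i by rewrite coef_map_id0.
have -> : map_poly D (P * 'X + c%:P) = map_poly D P * 'X + (D c)%:P.
  apply/polyP => i; rewrite cE !coefD !coefMX !coefC cE DD.
  by case: eqP; rewrite ?D0.
rewrite !hornerE DD DM IH derivD derivM derivX derivC addr0 !hornerE.
by ring.
Qed.

Section RatFun.
Variable k : fieldType.
Implicit Types (x y : {ratfun k}) (u v : {poly k}) (n m : int).

Lemma rden_neq0 x : rden x != 0.
Proof.
rewrite /rden; set r : {ratio _} := repr x.
have r2 : r.2 != 0 by case: (r).
have : r.2 %/ gcdp r.1 r.2 * gcdp r.1 r.2 != 0.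
  by rewrite divpK ?dvdp_gcdr.
by rewrite mulf_eq0 negb_or => /andP[].
Qed.

Lemma coprimep_rnum_rden x : coprimep (rnum x) (rden x).
Proof.
rewrite /rnum /rden; set r : {ratio _} := repr x.
have r2 : r.2 != 0 by case: (r).
by apply: coprimep_div_gcd; rewrite r2 orbT.
Qed.

Lemma tofrac_neq0 u : u != 0 -> u%:F != 0 :> {ratfun k}.
Proof. by rewrite tofrac_eq0. Qed.

Lemma ratfunE x : x = (rnum x)%:F / (rden x)%:F.
Proof.
have r2 : (repr x : {ratio _}).2 != 0 by case: (repr x).
have g0 : gcdp (repr x).1 (repr x).2 != 0 by rewrite gcdp_eq0 (negPf r2) andbF.
have xE : x * ((repr x).2)%:F = ((repr x).1)%:F.
  have h (r : {ratio {poly k}}) : r.2 != 0 ->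
      \pi_{fraction {poly k}}%qT r * (r.2)%:F = (r.1)%:F.
    have mulE (a b : {fraction {poly k}}) : a * b = FracField.mul a b by [].
    move=> r20; rewrite mulE; apply/eqP.
    rewrite !piE FracField.equivfE !numden_Ratio ?mulf_neq0 ?oner_neq0 //.
    by rewrite !mulr1 mulrC.
  by rewrite -{1}[x]reprK; apply: h.
apply: (mulIf (tofrac_neq0 r2)); rewrite xE.
have /esym e1 := divpK (dvdp_gcdl (repr x).1 (repr x).2).
have /esym e2 := divpK (dvdp_gcdr (repr x).1 (repr x).2).
rewrite -/(rnum x) -/(rden x) in e1 e2.
move: (gcdp _ _) g0 e1 e2 => g g0 -> ->; rewrite !tofracM.
rewrite mulrA divfK //; exact/tofrac_neq0/rden_neq0.
Qed.

Lemma frac_eq u v u' v' : v != 0 -> v' != 0 ->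
  u%:F / v%:F = u'%:F / v'%:F :> {ratfun k} -> u * v' = u' * v.
Proof.
move=> v0 v'0 /eqP; rewrite eqr_div ?tofrac_neq0 // -!tofracM tofrac_eq.
by move/eqP.
Qed.

Lemma rnum_rden_uniq x u v : coprimep u v -> v != 0 -> x = u%:F / v%:F ->
  exists2 c, c != 0 & rnum x = c *: u /\ rden x = c *: v.
Proof.
move=> cuv v0 xE; have d0 := rden_neq0 x.
have e : rnum x * v = u * rden x by apply: frac_eq; rewrite -?ratfunE.
have d1 : rden x %| v.
  have : rden x %| rnum x * v by rewrite e dvdp_mull.
  by rewrite Gauss_dvdpr // coprimep_sym coprimep_rnum_rden.
have d2 : v %| rden x.
  have : v %| u * rden x by rewrite -e dvdp_mull.
  by rewrite Gauss_dvdpr // coprimep_sym.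
have /eqpP[[c1 c2] /= /andP[c10 c20] ce] : rden x %= v by rewrite /eqp d1 d2.
have dE : rden x = (c2 / c1) *: v.
  by rewrite mulrC -scalerA -ce scalerA mulVf // scale1r.
exists (c2 / c1); first by rewrite mulf_neq0 ?invr_eq0.
split=> //; apply: (mulIf v0); rewrite e dE -!mul_polyC; ring.
Qed.

Lemma rdeg_le u v : v != 0 ->
  (rdeg (u%:F / v%:F : {ratfun k}) <= maxn (pdeg u) (pdeg v))%N.
Proof.
move=> v0; move eqx: (_ / _) => x.
have e : rnum x * v = u * rden x.
  by apply: frac_eq; rewrite -?ratfunE ?rden_neq0.
have d1 : rden x %| v.
  have : rden x %| rnum x * v by rewrite e dvdp_mull.
  by rewrite Gauss_dvdpr // coprimep_sym coprimep_rnum_rden.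
have d2 : rnum x %| u.
  have : rnum x %| u * rden x by rewrite -e dvdp_mulr.
  by rewrite Gauss_dvdpl // coprimep_rnum_rden.
have l1 := dvdp_leq v0 d1; rewrite /rdeg /pdeg.
have [u0|u0] := eqVneq u 0; last first.
  have := dvdp_leq u0 d2; move: l1.
  by move: (size (rden x)) (size (rnum x)) (size u) (size v); lia.
have -> : rnum x = 0; last first.
  by move: l1; rewrite size_poly0; move: (size (rden x)) (size u) (size v); lia.
by apply: (mulIf v0); rewrite e u0 !mul0r.
Qed.

(* [deg x <= n], where [deg] is minus the valuation of [k(t)] at [t = oo]. *)
Definition dle x n := (x == 0) || ((size (rnum x))%:Z - (size (rden x))%:Z <= n).

Lemma size_gt0Z u : u != 0 -> (0 < size u)%N. Proof. by rewrite size_poly_gt0. Qed.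

Lemma dleE u v n : v != 0 ->
  dle (u%:F / v%:F) n = (u == 0) || ((size u)%:Z - (size v)%:Z <= n).
Proof.
move=> v0; move eqx: (_ / _) => x.
have e : rnum x * v = u * rden x.
  by apply: frac_eq; rewrite -?ratfunE ?rden_neq0.
have ux : (x == 0) = (u == 0).
  by rewrite -eqx mulf_eq0 invr_eq0 !tofrac_eq0 (negPf v0) orbF.
rewrite /dle ux; have [//|u0] /= := eqVneq u 0.
have d0 := rden_neq0 x.
have n0 : rnum x != 0.
  by apply: contra_neq d0 => n0; move: e; rewrite n0 mul0r => /esym/eqP; rewrite mulf_eq0 (negPf u0) => /eqP.
have := congr1 (fun p : {poly k} => size p) e; rewrite !size_mul //.
have := size_gt0Z u0; have := size_gt0Z v0; have := size_gt0Z d0; have := size_gt0Z n0.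
by move: (size u) (size v) (size (rden x)) (size (rnum x)) => a b c d *; congr (_ <= n); lia.
Qed.

Lemma dle0 n : dle 0 n. Proof. by rewrite /dle eqxx. Qed.

Lemma dleW x n m : n <= m -> dle x n -> dle x m.
Proof. by rewrite /dle => nm /orP[->//|h]; rewrite (le_trans h nm) orbT. Qed.

Lemma dleN x n : dle x n -> dle (- x) n.
Proof.
rewrite {2}[x]ratfunE -mulNr -tofracN dleE ?rden_neq0 // size_polyN oppr_eq0.
by rewrite [x in dle x _]ratfunE dleE ?rden_neq0.
Qed.

Lemma dleD x y n : dle x n -> dle y n -> dle (x + y) n.
Proof.
rewrite [x]ratfunE [y]ratfunE; have := rden_neq0 x; have := rden_neq0 y.
move: (rnum x) (rden x) (rnum y) (rden y) => a b c d d0 b0.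
have [->|a0] := eqVneq a 0; first by rewrite tofrac0 mul0r add0r.
have [->|c0] := eqVneq c 0; first by rewrite tofrac0 mul0r addr0.
rewrite !dleE // (negPf a0) (negPf c0) /= => h1 h2.
rewrite addf_div ?tofrac_neq0 // -!tofracM -tofracD dleE ?mulf_neq0 //.
have := size_polyD (a * d) (c * b); rewrite !size_mul //.
have := size_gt0Z a0; have := size_gt0Z b0; have := size_gt0Z c0; have := size_gt0Z d0.
move: (size (a * d + c * b)) (size a) (size b) (size c) (size d) h1 h2 => *; apply/orP; right; lia.
Qed.

Lemma dleB x y n : dle x n -> dle y n -> dle (x - y) n.
Proof. by move=> h1 h2; apply: dleD => //; apply: dleN. Qed.

Lemma dleM x y n m : dle x n -> dle y m -> dle (x * y) (n + m).
Proof.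
rewrite [x]ratfunE [y]ratfunE; have := rden_neq0 x; have := rden_neq0 y.
move: (rnum x) (rden x) (rnum y) (rden y) => a b c d d0 b0.
have [->|a0] := eqVneq a 0; first by rewrite tofrac0 !mul0r !dle0.
have [->|c0] := eqVneq c 0; first by rewrite tofrac0 mul0r mulr0 !dle0.
rewrite !dleE // (negPf a0) (negPf c0) /= => h1 h2.
rewrite mulf_div -!tofracM dleE ?mulf_neq0 //.
rewrite !size_mul //.
have := size_gt0Z a0; have := size_gt0Z b0; have := size_gt0Z c0; have := size_gt0Z d0.
move: (size a) (size b) (size c) (size d) h1 h2 => *; apply/orP; right; lia.
Qed.

Lemma dle_frac u n : dle u%:F n = (u == 0) || ((size u).-1%:Z <= n).
Proof.
rewrite -[u%:F]divr1 -tofrac1 dleE ?oner_neq0 // size_poly1.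
have [//|/size_gt0Z ?] := eqVneq u 0; congr (_ <= n); lia.
Qed.

Lemma dle_pdeg u : dle u%:F (pdeg u)%:Z.
Proof. by rewrite dle_frac lexx orbT. Qed.

Lemma dle1 : dle 1 0.
Proof. by rewrite -tofrac1 dle_frac size_poly1 orbT. Qed.

(** A nonzero polynomial cannot be small at [t = oo]. Each vanishing argument below clears
    denominators and ends with this remark. *)
Lemma dle_frac_lt0 u n : n < 0 -> dle u%:F n -> u = 0.
Proof. by rewrite dle_frac => n0 /orP[/eqP//|h]; lia. Qed.

Lemma dle_exp x n i : dle x n -> dle (x ^+ i) (n *+ i).
Proof.
move=> h; elim: i => [|i ih]; first by rewrite expr0 mulr0n dle1.
by rewrite exprS mulrS dleM.
Qed.

Lemma dle_ex x : exists n : nat, dle x n%:Z.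
Proof. by exists (size (rnum x)); rewrite /dle; apply/orP; right; lia. Qed.

Lemma dle_horner (P : {poly {ratfun k}}) n :
  exists C : nat, forall x, dle x n -> dle P.[x] C%:Z.
Proof.
elim/poly_ind: P => [|P c [C IH]].
  by exists 0%N => x _; rewrite horner0 dle0.
have [C' hc] := dle_ex c.
exists (C + `|n| + C')%N => x hx; rewrite !hornerE.
apply: dleD; last by apply: dleW hc; lia.
by apply: dleW (dleM (IH x hx) hx); lia.
Qed.

Lemma dle_sum (I : finType) (F : I -> {ratfun k}) n :
  (forall i, dle (F i) n) -> dle (\sum_i F i) n.
Proof. by move=> h; elim/big_ind: _ => //; [exact: dle0 | move=> *; apply: dleD]. Qed.

(* The derivation d/dt of [k(t)]. *)
Definition fder x : {ratfun k} :=
  ((rnum x)^`() * rden x - rnum x * (rden x)^`())%:F / (rden x)%:F ^+ 2.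

Lemma fderE u v : v != 0 ->
  fder (u%:F / v%:F) = (u^`() * v - u * v^`())%:F / v%:F ^+ 2.
Proof.
move=> v0; set x := (_ / _); have d0 := rden_neq0 x.
have e : rnum x * v = u * rden x by apply: frac_eq; rewrite -?ratfunE.
rewrite /fder; move: (rnum x) (rden x) d0 e => a b b0 e.
have e' := congr1 (@deriv k) e; rewrite !derivM in e'.
apply/eqP; rewrite -!tofracXn eqr_div ?tofrac_neq0 ?expf_neq0 //.
rewrite -!tofracM tofrac_eq; apply/eqP; apply/eqP; rewrite -subr_eq0; apply/eqP.
have {e'} : a^`() * v + a * v^`() - (u^`() * b + u * b^`()) = 0 by rewrite e' subrr.
move: (a^`()) (b^`()) (u^`()) (v^`()) => a' b' u' v' e'.
(* The difference lies in the ideal generated by the relation [a v = u b] and its derivative, so the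
   quotient rule does not depend on the representation. *)
have -> : (a' * b - a * b') * v ^+ 2 - (u' * v - u * v') * b ^+ 2 =
  b * v * (a' * v + a * v' - (u' * b + u * b')) - (b' * v + b * v') * (a * v - u * b).
  by ring.
by rewrite e' e subrr !mulr0 subr0.
Qed.

Lemma fder_tofrac u : fder u%:F = (u^`())%:F.
Proof.
rewrite -[u%:F]divr1 -tofrac1 fderE ?oner_neq0 // derivC mulr0 subr0 mulr1.
by rewrite tofrac1 expr1n divr1.
Qed.

Lemma fder0 : fder 0 = 0.
Proof. by rewrite -tofrac0 fder_tofrac deriv0. Qed.

Lemma fderD x y : fder (x + y) = fder x + fder y.
Proof.
rewrite [x]ratfunE [y]ratfunE; have := rden_neq0 x; have := rden_neq0 y.
move: (rnum x) (rden x) (rnum y) (rden y) => a b c d d0 b0.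
rewrite addf_div ?tofrac_neq0 // -!tofracM -tofracD !fderE ?mulf_neq0 //.
rewrite -!tofracXn addf_div ?tofrac_neq0 ?expf_neq0 // -!tofracM -tofracD.
apply/eqP; rewrite eqr_div ?tofrac_neq0 ?mulf_neq0 ?expf_neq0 //.
rewrite -!tofracM tofrac_eq !derivD !derivM; apply/eqP.
move: (a^`()) (b^`()) (c^`()) (d^`()) => a' b' c' d'; ring.
Qed.

Lemma fderM x y : fder (x * y) = fder x * y + x * fder y.
Proof.
rewrite [x]ratfunE [y]ratfunE; have := rden_neq0 x; have := rden_neq0 y.
move: (rnum x) (rden x) (rnum y) (rden y) => a b c d d0 b0.
rewrite mulf_div -!tofracM !fderE ?mulf_neq0 //.
rewrite -!tofracXn !mulf_div -!tofracM addf_div ?tofrac_neq0 ?mulf_neq0 ?expf_neq0 //.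
rewrite -!tofracM -tofracD.
apply/eqP; rewrite eqr_div ?tofrac_neq0 ?mulf_neq0 ?expf_neq0 //.
rewrite -!tofracM tofrac_eq !derivM; apply/eqP.
move: (a^`()) (b^`()) (c^`()) (d^`()) => a' b' c' d'; ring.
Qed.

Lemma fderN x : fder (- x) = - fder x.
Proof. by apply/eqP; rewrite -addr_eq0 -fderD addNr fder0. Qed.

Lemma fderB x y : fder (x - y) = fder x - fder y.
Proof. by rewrite fderD fderN. Qed.

Lemma fder_horner (P : {poly {ratfun k}}) x :
  fder P.[x] = (map_poly fder P).[x] + P^`().[x] * fder x.
Proof. exact: (derivation_horner fder0 fderD fderM). Qed.

(** The derivation is nonexpanding at [t = oo]: smallness of [H.[x]] passes to its derivative. *)
Lemma dle_fder x n : dle x n -> dle (fder x) n.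
Proof.
rewrite [x]ratfunE; have := rden_neq0 x.
move: (rnum x) (rden x) => a b b0.
have [->|a0] := eqVneq a 0; first by rewrite tofrac0 mul0r fder0.
rewrite fderE // -tofracXn !dleE ?expf_neq0 // (negPf a0) /= => h.
apply/orP; right; apply: le_trans h.
have sb := size_gt0Z b0; have sa := size_gt0Z a0.
have s2 : (size (b ^+ 2)).-1 = ((size b).-1 * 2)%N by rewrite size_exp.
have sd (u : {poly k}) : (size u^`() <= size u)%N.
  by apply: leq_trans (leq_pred _); apply: size_poly.
have st : (size (a^`() * b - a * b^`())%R <= (size a + size b).-1)%N.
  rewrite (leq_trans (size_polyD _ _)) // size_polyN geq_max.
  apply/andP; split; apply: leq_trans (size_polyMleq _ _) _.
    by rewrite -!subn1 leq_sub2r // leq_add2r sd.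
  by rewrite -!subn1 leq_sub2r // leq_add2l sd.
have := size_gt0Z (expf_neq0 2 b0); move: sb sa s2 st.
move: (size (a^`() * b - a * b^`())%R) (size (b ^+ 2)) (size a) (size b); lia.
Qed.

End RatFun.

(** * Binary forms and common denominators *)

Section Forms.
Variable R : comNzRingType.

(* Value at [(x, y)] of the binary form of degree [n] that dehomogenizes to [A]. *)
Definition hev (n : nat) (A : {poly R}) (x y : R) : R :=
  \sum_(i < n.+1) A`_i * x ^+ i * y ^+ (n - i).

Lemma hev_mod n (A : {poly R}) x y :
  exists q, hev n A x y = A`_n * x ^+ n + y * q.
Proof.
rewrite /hev big_ord_recr /= subnn mulr1 addrC.
exists (\sum_(i < n) A`_i * x ^+ i * y ^+ (n - i).-1); congr (_ + _).
rewrite mulr_sumr; apply: eq_bigr => i _.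
have -> : y ^+ (n - i) = y * y ^+ (n - i).-1 by rewrite -exprS prednK ?subn_gt0.
by ring.
Qed.

Lemma hevZ n (A : {poly R}) s x y : hev n A (s * x) (s * y) = s ^+ n * hev n A x y.
Proof.
rewrite /hev mulr_sumr; apply: eq_bigr => i _.
have -> : s ^+ n = s ^+ i * s ^+ (n - i) by rewrite -exprD subnKC // -ltnS.
by rewrite !exprMn; ring.
Qed.

Lemma hev_x1 n (A : {poly R}) x : (size A <= n.+1)%N -> hev n A x 1 = A.[x].
Proof.
move=> sA; rewrite (horner_coef_wide _ sA); apply: eq_bigr => i _.
by rewrite expr1n mulr1.
Qed.

Lemma hev_10 n (A : {poly R}) : hev n A 1 0 = A`_n.
Proof. by have [q ->] := hev_mod n A 1 0; rewrite expr1n mulr1 mul0r addr0. Qed.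

End Forms.

Lemma hev_rmorph (R S : comNzRingType) (f : {rmorphism R -> S}) n (A : {poly R}) x y :
  f (hev n A x y) = hev n (map_poly f A) (f x) (f y).
Proof.
by rewrite rmorph_sum; apply: eq_bigr => i _; rewrite !rmorphM !rmorphXn coef_map.
Qed.

Lemma hev_horner (F : fieldType) n (A : {poly F}) x y :
  (size A <= n.+1)%N -> y != 0 -> hev n A x y = y ^+ n * A.[x / y].
Proof.
move=> sA y0; rewrite -(hev_x1 _ sA) -hevZ mulr1; congr hev.
by rewrite mulrCA divff ?mulr1.
Qed.

(** Reduction of [U b + V c] modulo [P] maps a space of dimension [m + n] linearly to one of
    dimension [size P - 1], hence has a nonzero kernel. *)
Lemma modular_pair (F : fieldType) (P U V : {poly F}) m n :
  P != 0 -> (size P <= m + n)%N ->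
  exists b c : {poly F}, [/\ (size b <= m)%N, (size c <= n)%N,
    (b != 0) || (c != 0) & P %| U * b + V * c].
Proof.
move=> P0 sP; pose e := (size P).-1.
pose f (w : 'rV[F]_(m + n)) : 'rV[F]_e :=
  poly_rV ((U * rVpoly (lsubmx w) + V * rVpoly (rsubmx w)) %% P).
have f_lin : linear f.
  move=> a w1 w2; rewrite /f -linearP; congr poly_rV.
  rewrite -modpZl -modpD; congr modp; rewrite !linearP /= -!mul_polyC; ring.
pose fL := GRing.isLinear.Build F _ _ _ f f_lin.
pose fl : {linear 'rV[F]_(m + n) -> 'rV[F]_e} := HB.pack f fL.
have : kermx (lin1_mx fl) != 0.
  rewrite -mxrank_eq0 mxrank_ker -lt0n subn_gt0.
  apply: leq_ltn_trans (rank_leq_col _) _.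
  by rewrite /e; move: P0; rewrite -size_poly_eq0; lia.
case/rowV0Pn => w /sub_kermxP; rewrite mul_rV_lin1 /= => wf w0.
exists (rVpoly (lsubmx w)), (rVpoly (rsubmx w)); split.
- exact: size_poly.
- exact: size_poly.
- apply: contraNT w0; rewrite negb_or !negbK => /andP[/eqP h1 /eqP h2].
  rewrite -[w]hsubmxK.
  by rewrite -[lsubmx w]rVpolyK -[rsubmx w]rVpolyK h1 h2 !linear0 row_mx0.
apply/modp_eq0P; have := ltn_modp (U * rVpoly (lsubmx w) + V * rVpoly (rsubmx w)) P.
move: wf; rewrite /f P0; move: (_ %% _) => p wf sp.
have sr : (size p <= e)%N by rewrite /e; move: (size p) (size P) sp; lia.
by rewrite -(poly_rV_K sr) wf linear0.
Qed.

Section Clear.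
Variable k : fieldType.
Implicit Types (P Q : {poly {ratfun k}}).

Definition fmap (A : {poly {poly k}}) : {poly {ratfun k}} := map_poly (@tofrac {poly k}) A.

Lemma fmap_inj : injective fmap.
Proof.
apply: map_inj_poly; last exact: tofrac0.
by move=> x y /eqP; rewrite tofrac_eq => /eqP.
Qed.

Lemma size_fmap A : size (fmap A) = size A.
Proof.
apply: size_map_inj_poly; last exact: tofrac0.
by move=> x y /eqP; rewrite tofrac_eq => /eqP.
Qed.

Lemma clear_denom P : exists d A, d != 0 /\ d%:F *: P = fmap A.
Proof.
elim/poly_ind: P => [|P c [d [A [d0 e]]]].
  by exists 1, 0; rewrite oner_neq0 scaler0 /fmap rmorph0.
exists (d * rden c), (rden c *: A * 'X + (d * rnum c)%:P).
split; first by rewrite mulf_neq0 ?rden_neq0.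
rewrite /fmap rmorphD /= map_polyC /= [map_poly _ (_ * 'X)]rmorphM /= map_polyX map_polyZ /= -/(fmap A) -e.
rewrite scalerDr -!scalerAl scalerA -tofracM [rden c * d]mulrC; congr (_ + _).
rewrite -mul_polyC -polyCM {2}[c]ratfunE !tofracM; congr (_%:P).
by rewrite mulrA [_ * (rnum c)%:F]mulrAC mulfK // tofrac_eq0 rden_neq0.
Qed.

Lemma clear_denom2 P Q : exists d A B, [/\ d != 0, d%:F *: P = fmap A & d%:F *: Q = fmap B].
Proof.
have [d1 [A [d10 eA]]] := clear_denom P; have [d2 [B [d20 eB]]] := clear_denom Q.
exists (d1 * d2), (d2 *: A), (d1 *: B); split; first by rewrite mulf_neq0.
  by rewrite /fmap map_polyZ /= -/(fmap A) -eA scalerA -tofracM mulrC.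
by rewrite /fmap map_polyZ /= -/(fmap B) -eB scalerA -tofracM.
Qed.

(** The roots are finite in number. A sequence of growing height therefore leaves the zeros of any
    fixed nonzero polynomial. *)
Lemma root_height P : P != 0 ->
  exists B : nat, forall x, P.[x] = 0 -> (rdeg x <= B)%N.
Proof.
have [n] := ubnP (size P); elim: n P => // n IH P sP P0.
have [[r /eqP Pr]|nr] := pselect (exists r, P.[r] = 0); last first.
  by exists 0%N => x Px; case: nr; exists x.
have /factor_theorem[Q PE] : root P r by [].
have Q0 : Q != 0 by apply: contraNneq P0 => Q0; rewrite PE Q0 mul0r.
have sQ : (size Q < n)%N by move: sP; rewrite PE size_Mmonic ?monicXsubC // size_XsubC addn2 ltnS.
have [B hB] := IH Q sQ Q0; exists (maxn B (rdeg r)) => x.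
rewrite PE hornerM hornerXsubC => /eqP; rewrite mulf_eq0 => /orP[/eqP/hB h|].
  exact: leq_trans h (leq_maxl _ _).
by rewrite subr_eq0 => /eqP ->; exact: leq_maxr.
Qed.

(** As [X ^ s] is invertible modulo [Y], the second divisibility makes [b] congruent to a multiple
    [Y t] modulo [g]; then [r b ^ M] is congruent to [r Y ^ M t ^ M], a multiple of [g]. *)
Lemma dvdp_reduce (g X Y b r q : {poly k}) M s : coprimep X Y ->
  g %| r * Y ^+ M -> g %| b * X ^+ s + Y * q -> g %| r * b ^+ M.
Proof.
move=> cXY h1 h2.
have /Bezout_coprimepP[[a1 a2] /= /eqpP[[c1 c2] /= /andP[c10 c20] e]] :
  coprimep (X ^+ s) Y by apply: coprimep_expl.
set Z := a1 * X ^+ s + a2 * Y in e.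
pose i := c2^-1 *: (c1 *: a1).
have e1 : 1 = i * X ^+ s + c2^-1 *: (c1 *: a2) * Y.
  by rewrite -!scalerAl -!scalerDr e scalerA mulVf // scale1r.
pose t := b * (c2^-1 *: (c1 *: a2)) - i * q.
have be : b = i * (b * X ^+ s + Y * q) + Y * t.
  by rewrite -[LHS]mulr1 {1}e1 /t; ring.
have gt : g %| b - Y * t by rewrite {1}be addrK dvdp_mull.
have h3 : g %| r * (b ^+ M - (Y * t) ^+ M).
  by rewrite dvdp_mull // subrXX dvdp_mulr.
have -> : r * b ^+ M = r * (b ^+ M - (Y * t) ^+ M) + r * Y ^+ M * t ^+ M.
  by rewrite exprMn mulrBr mulrA subrK.
by rewrite dvdp_add // dvdp_mulr.
Qed.

Lemma pdegM (u v : {poly k}) : u != 0 -> v != 0 -> pdeg (u * v) = (pdeg u + pdeg v)%N.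
Proof.
move=> u0 v0; rewrite /pdeg size_mul //.
by move: (size_gt0Z u0) (size_gt0Z v0); move: (size u) (size v); lia.
Qed.

Lemma pdegX (u : {poly k}) n : pdeg (u ^+ n) = (pdeg u * n)%N.
Proof. by rewrite /pdeg size_exp. Qed.

Lemma dvdp_pdeg (u v : {poly k}) : v != 0 -> u %| v -> (pdeg u <= pdeg v)%N.
Proof. by move=> v0 /(dvdp_leq v0); rewrite /pdeg; move: (size u) (size v); lia. Qed.

Lemma dle_fracE (u : {poly k}) n : u != 0 -> dle u%:F n = ((pdeg u)%:Z <= n).
Proof. by rewrite dle_frac => /negPf ->. Qed.

End Clear.

(** * Osgood's method *)

(** Here [h] is [H(x)] and [ht + hz x'] is its derivative, both small. The Bezout relation for [H]
    and its formal derivative writes [b x' - c] as a combination of these two, with bounded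
    factors. *)
Lemma elim_identity (R : comNzRingType) (x' ht hz h b c u v e : R) :
  u * h + v * hz = 1 -> ht * b + hz * c = e * h ->
  b * x' - c = h * (u * (b * x' - c) - v * e) + (ht + hz * x') * (v * b).
Proof.
move=> h1 h2; apply/eqP; rewrite -subr_eq0; apply/eqP.
have -> : b * x' - c - (h * (u * (b * x' - c) - v * e) + (ht + hz * x') * (v * b)) =
  (1 - (u * h + v * hz)) * (b * x' - c) + v * (e * h - (ht * b + hz * c)) by ring.
by rewrite h1 h2 !subrr mul0r mulr0 addr0.
Qed.

Lemma clear_identity (R : comNzRingType) (s : nat) (y f b c d : R) :
  y ^+ s * (d * b) * (y ^+ 2 * f) - y ^+ s.+2 * (d * c) = y ^+ s.+2 * d * (b * f - c).
Proof. by rewrite -(addn2 s) exprD; ring. Qed.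

(** [h] is the height, [y] the degree of the denominator and [e] the power of it that is cleared. An
    exponent [c > e] wins once [h] exceeds the constants. *)
Lemma linear_bound_lt0 (y e d C c h : nat) : (C + d < h)%N -> (y <= h)%N -> (e < c)%N ->
  y%:Z *+ e + d%:Z + (C%:Z - (c * h)%:Z) < 0.
Proof.
move=> h1 h2 h3.
have : (y * e + h <= c * h)%N.
  apply: (@leq_trans (e.+1 * h)); last by rewrite leq_mul2r h3 orbT.
  by rewrite mulSnr leq_add2r mulnC leq_mul2l h2 orbT.
rewrite -mulr_natr natz -PoszM; lia.
Qed.

Lemma bezout_identity (R : comNzRingType) (u b v c d e : R) :
  u * b + v * c = 1 -> e * u * (d * b) + e * v * (d * c) = d * e.
Proof. by move=> h; rewrite -[RHS]mulr1 -h; ring. Qed.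

Lemma shuffle4 (R : comNzRingType) (y f b : R) s :
  y ^+ 2 * f * (y ^+ s * b) = y ^+ s * y ^+ 2 * (b * f).
Proof. by ring. Qed.

Lemma shuffle4' (R : comNzRingType) (y z u b : R) : u * b * (y * z) = y * u * (z * b).
Proof. by ring. Qed.

Lemma shuffle5 (R : comNzRingType) (y u b v f : R) :
  (u * b + v * (b * f)) * y = y * b * (u + v * f).
Proof. by ring. Qed.

Section Riccati.
Variable k : fieldType.
Implicit Types (P H : {poly {ratfun k}}) (x y : nat -> {ratfun k}).

Definition tends x := forall B : nat, exists n0 : nat, forall n, (n0 <= n)%N -> (B <= rdeg (x n))%N.

Definition bounded x := exists C : nat, forall n, dle (x n) C%:Z.

(* [x n] approaches the roots of [H] at [t = oo] with exponent [c]: up to a bounded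
   factor, [H.[x n]] has size [exp (- c h)], where [h] is the height of [x n]. *)
Definition small (c : nat) H x :=
  exists C : nat, forall n, dle H.[x n] (C%:Z - (c * rdeg (x n))%:Z).

Lemma bounded_horner P x : bounded x -> bounded (fun n => P.[x n]).
Proof.
case=> C hC; have [C' h] := dle_horner P C%:Z.
by exists C' => n; apply: h.
Qed.

Lemma bounded_fder x : bounded x -> bounded (fun n => fder (x n)).
Proof. by case=> C hC; exists C => n; apply: dle_fder. Qed.

Lemma boundedD x y : bounded x -> bounded y -> bounded (fun n => x n + y n).
Proof.
move=> [C hC] [C' hC']; exists (C + C')%N => n.
by apply: dleD; [apply: dleW (hC n) | apply: dleW (hC' n)]; lia.
Qed.

Lemma boundedN x : bounded x -> bounded (fun n => - x n).
Proof. by case=> C hC; exists C => n; apply: dleN. Qed.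

Lemma boundedM x y : bounded x -> bounded y -> bounded (fun n => x n * y n).
Proof.
move=> [C hC] [C' hC']; exists (C + C')%N => n.
by apply: dleW (dleM (hC n) (hC' n)); lia.
Qed.

Lemma bounded_cst (a : {ratfun k}) : bounded (fun=> a).
Proof. by have [C h] := dle_ex a; exists C. Qed.

Lemma rdeg_rden (a : {ratfun k}) (C : nat) : dle a C%:Z -> (rdeg a <= pdeg (rden a) + C)%N.
Proof.
rewrite /dle /rdeg /pdeg => /orP[/eqP a0|].
  have -> : rnum a = 0; last by rewrite size_poly0; lia.
  move: (ratfunE a); rewrite a0 => /esym/eqP.
  rewrite mulf_eq0 invr_eq0 !tofrac_eq0 (negPf (rden_neq0 _)) orbF => /eqP h.
  by rewrite [LHS]h.
by have := size_gt0Z (rden_neq0 a); move: (size (rden a)) (size (rnum a)); lia.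
Qed.

Lemma pdeg_rden_le (a : {ratfun k}) : (pdeg (rden a) <= rdeg a)%N.
Proof. exact: leq_maxr. Qed.

Lemma hev_frac n (A : {poly {poly k}}) (a : {ratfun k}) : (size A <= n.+1)%N ->
  (hev n A (rnum a) (rden a))%:F = (rden a)%:F ^+ n * (fmap A).[a].
Proof.
move=> sA; rewrite (hev_rmorph (@tofrac {poly k})) hev_horner ?size_fmap //.
  by rewrite -ratfunE.
by rewrite tofrac_eq0 rden_neq0.
Qed.

Definition wronsk (a : {ratfun k}) := (rnum a)^`() * rden a - rnum a * (rden a)^`().

(** The derivative costs the square of the denominator, so [x'] has weight 2. This is the difference
    between the degrees allowed for [c'] and [b] in Osgood's construction. *)
Lemma wronskE a : (wronsk a)%:F = (rden a)%:F ^+ 2 * fder a.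
Proof. by rewrite /fder -/(wronsk a) mulrC divfK // expf_neq0 // tofrac_eq0 rden_neq0. Qed.

(* Write [H^t] for [H] with differentiated coefficients, so that
   [H(x)' = H^t(x) + H'(x) x']. Choose [b], [c'] of small degree with [H] dividing
   [H^t b + H' c']; then [b(x) x' - c'(x)] is so small at [t = oo], compared with its
   height, that it vanishes. *)
Lemma osgood_pair H x c s : separable_poly H -> (size H <= s + s + 4)%N -> (s + 3 <= c)%N ->
  tends x -> bounded x -> small c H x ->
  exists b c' : {poly {ratfun k}}, ((b != 0) || (c' != 0)) /\
  exists n0, forall n, (n0 <= n)%N -> b.[x n] * fder (x n) = c'.[x n].
Proof.
move=> sepH sH sc tx bx [C smx].
have H0 := separable_poly_neq0 sepH.
have sH' : (size H <= s.+1 + s.+3)%N.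
  by move: sH; move: (size H); lia.
have [b [c' [sb sc' bc0 /dvdpP[E PE]]]] :=
  modular_pair (map_poly (@fder k) H) H^`() H0 sH'.
have /Bezout_eq1_coprimepP[[u v] /= uv] : coprimep H H^`() by move: sepH; rewrite unlock.
exists b, c'; split=> //.
pose w n := b.[x n] * fder (x n) - c'.[x n].
have bw : bounded w.
  apply: boundedD; first by apply: boundedM; [exact: bounded_horner | exact: bounded_fder].
  by apply: boundedN; exact: bounded_horner.
have wE n : w n = H.[x n] * (u.[x n] * w n - v.[x n] * E.[x n]) +
                  fder H.[x n] * (v.[x n] * b.[x n]).
  have e1 := congr1 (fun p => p.[x n]) uv.
  have e2 := congr1 (fun p => p.[x n]) PE.
  rewrite fder_horner /w.
  move: e1 e2; rewrite !(hornerD, hornerM, hornerC).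
  move: (map_poly _ _).[x n] (H^`()).[x n] H.[x n] b.[x n] c'.[x n] u.[x n] v.[x n] E.[x n].
  move: (fder (x n)); rewrite /=.
  exact: elim_identity.
have [Cw hw] : bounded (fun n => u.[x n] * w n - v.[x n] * E.[x n]).
  apply: boundedD; first by apply: boundedM bw; exact: bounded_horner.
  by apply: boundedN; apply: boundedM; exact: bounded_horner.
have [Cb hb] : bounded (fun n => v.[x n] * b.[x n]).
  by apply: boundedM; exact: bounded_horner.
pose C1 := (C + Cw + Cb)%N.
have smw n : dle (w n) (C1%:Z - (c * rdeg (x n))%:Z).
  rewrite wE; apply: dleD.
    by apply: dleW (dleM (smx n) (hw n)); rewrite /C1; lia.
  by apply: dleW (dleM (dle_fder (smx n)) (hb n)); rewrite /C1; lia.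
have [d [b0 [c0 [d0 bE cE]]]] := clear_denom2 b c'.
have [n0 hn0] := tx (C1 + pdeg d).+1.
exists n0 => n /hn0 hn; apply/eqP; rewrite -subr_eq0 -/(w n).
set X := rnum (x n); set Y := rden (x n).
have Y0 : Y != 0 by apply: rden_neq0.
have F0 : forall p : {poly k}, p != 0 -> p%:F != 0 :> {ratfun k} by move=> p; rewrite tofrac_eq0.
(* A polynomial in [t], equal to [d Y ^ (s + 2) w]. Up to a constant its degree is at most
   [(s + 2 - c) h], which tends to minus infinity since [c >= s + 3]. *)
pose N := hev s b0 X Y * wronsk (x n) - hev s.+2 c0 X Y.
have NE : N%:F = Y%:F ^+ s.+2 * d%:F * w n.
  rewrite tofracB tofracM wronskE !hev_frac.
  - rewrite -bE -cE !hornerZ /w -/Y.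
    move: (Y%:F) (fder _) (b.[_]) (c'.[_]) (d%:F) => y f b1 c1 d1.
    exact: clear_identity.
  - by rewrite -size_fmap -cE size_scale ?F0.
  - by rewrite -size_fmap -bE size_scale ?F0.
have N0 : N = 0.
  apply: (@dle_frac_lt0 k N ((pdeg Y)%:Z *+ s.+2 + (pdeg d)%:Z + (C1%:Z - (c * rdeg (x n))%:Z))).
    by apply: linear_bound_lt0 (pdeg_rden_le (x n)) _ => //; move: sc; clear; lia.
  rewrite NE; apply: dleM (smw n); apply: dleM; last exact: dle_pdeg.
  by apply: dle_exp; exact: dle_pdeg.
move: NE; rewrite N0 tofrac0 => /esym/eqP.
have /negPf Yd0 : Y%:F ^+ s.+2 * d%:F != 0 :> {ratfun k}.
  by apply: mulf_neq0; [apply: expf_neq0; exact: F0 | exact: F0].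
by rewrite mulf_eq0 Yd0.
Qed.

Lemma tends_nroot P x : P != 0 -> tends x ->
  exists n0, forall n, (n0 <= n)%N -> P.[x n] != 0.
Proof.
move=> P0 tx; have [B hB] := root_height P0; have [n0 hn0] := tx B.+1.
by exists n0 => n /hn0 hn; apply/eqP => /hB; rewrite leqNgt hn.
Qed.

(** Put [s = max (deg b, deg c - 2)] and homogenize in the numerator [X] and the denominator [Y] of
    [x], so that [W B = C] with [W] the Wronskian of [X] and [Y]. Since [b, c] and [X, Y] are
    coprime, [B] divides a fixed polynomial. But [r Y ^ s = B (u + v x')] with a bounded second
    factor, so [s deg Y] is bounded; as [x] is bounded at [t = oo], [deg Y] grows with the height,
    and [s = 0]. *)
Lemma coprime_pair_riccati (b c : {poly {ratfun k}}) x : coprimep b c -> b != 0 ->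
  tends x -> bounded x ->
  (exists n0, forall n, (n0 <= n)%N -> b.[x n] * fder (x n) = c.[x n]) ->
  (size b <= 1)%N /\ (size c <= 3)%N.
Proof.
move=> cbc b0 tx bx [n0 hx].
pose s := maxn (size b).-1 (size c - 3).
have [s0|s0] := posnP s.
  by move: s0; rewrite /s; move: (size b) (size c); lia.
exfalso.
have /Bezout_eq1_coprimepP[[u v] /= uv] := cbc.
have [d [b1 [c1 [d0 bE cE]]]] := clear_denom2 b c.
have [e [u1 [v1 [e0 uE vE]]]] := clear_denom2 u v.
have F0 : forall p : {poly k}, p != 0 -> p%:F != 0 :> {ratfun k} by move=> p; rewrite tofrac_eq0.
have sb1 : size b1 = size b by rewrite -size_fmap -bE size_scale ?F0.
have sc1 : size c1 = size c by rewrite -size_fmap -cE size_scale ?F0.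
have sbs : (size b1 <= s.+1)%N.
  by rewrite sb1 /s; move: (size b) (size c); lia.
have scs : (size c1 <= s.+3)%N.
  by rewrite sc1 /s; move: (size b) (size c); lia.
pose r := d * e; have r0 : r != 0 by rewrite mulf_neq0.
have bez a : (fmap u1).[a] * (fmap b1).[a] + (fmap v1).[a] * (fmap c1).[a] = r%:F.
  rewrite -uE -vE -bE -cE !hornerZ.
  have := congr1 (fun p => p.[a]) uv; rewrite !(hornerD, hornerM, hornerC) => h.
  rewrite /r tofracM; move: h.
  move: u.[a] b.[a] v.[a] c.[a] d%:F e%:F => u' b' v' c' d' e'.
  exact: bezout_identity.
move: r r0 bez => r r0 bez.
have [C0 hC0] := bx.
have [C3 hC3] : bounded (fun n => (fmap u1).[x n] + (fmap v1).[x n] * fder (x n)).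
  apply: boundedD; first exact: bounded_horner.
  by apply: boundedM; [exact: bounded_horner | exact: bounded_fder].
(* By the choice of [s] one of the two forms contains a pure power of [X], with coefficient [beta];
   this trades the powers of [Y] divisible by [B1] for powers of [beta]. *)
pose beta : {poly k} := if size b1 == s.+1 then b1`_s else c1`_s.+2.
have beta0 : beta != 0.
  rewrite /beta; case: (size b1 =P s.+1) => [sb|sb].
    have -> : b1`_s = lead_coef b1 by rewrite lead_coefE sb.
    by rewrite lead_coef_eq0 -size_poly_eq0 sb.
  have sc : size c1 = s.+3.
    by move: sb s0 sbs scs; rewrite sb1 sc1 /s; move: (size b) (size c); lia.
  have -> : c1`_s.+2 = lead_coef c1 by rewrite lead_coefE sc.
  by rewrite lead_coef_eq0 -size_poly_eq0 sc.
pose M := (s + 2 + size u1 + size v1)%N.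
pose C2 := pdeg (r * beta ^+ M).
have [n1 hn1] := tx (C2 + C3 + C0).+1.
pose n := maxn n0 n1; have hn := hn1 n (leq_maxr _ _).
have {hx}hx := hx n (leq_maxl _ _).
have cXY := coprimep_rnum_rden (x n).
have Y0 : rden (x n) != 0 by apply: rden_neq0.
have hdeg := rdeg_rden (hC0 n).
have wE := wronskE (x n).
have HV m (A : {poly {poly k}}) (sA : (size A <= m.+1)%N) := hev_frac (x n) sA.
have bez' := bez (x n).
have bx' : (fmap b1).[x n] * fder (x n) = (fmap c1).[x n].
  rewrite -bE -cE !hornerZ -hx; exact/esym/mulrA.
have {}hC3 := hC3 n.
move: hC3 bx' bez' HV wE hdeg Y0 cXY hn.
move: (x n) => a hC3 bx' bez' HV wE hdeg Y0 cXY hn.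
pose X := rnum a; pose Y := rden a; pose W := wronsk a; pose x' := fder a.
pose B1 := hev s b1 X Y; pose C1 := hev s.+2 c1 X Y.
have B1E : B1%:F = Y%:F ^+ s * (fmap b1).[a] by apply: HV.
have C1E : C1%:F = Y%:F ^+ s.+2 * (fmap c1).[a] by apply: HV.
have BC : W * B1 = C1.
  apply/eqP; rewrite -tofrac_eq tofracM wE B1E C1E -bx'; apply/eqP.
  by rewrite -(addn2 s) exprD; move: (Y%:F) ((fmap b1).[a]) => y b'; exact: shuffle4.
have d1 : B1 %| r * Y ^+ M.
  pose U := hev (M - s) u1 X Y; pose V := hev (M - s.+2) v1 X Y.
  have -> : r * Y ^+ M = U * B1 + V * C1.
    apply/eqP; rewrite -tofrac_eq; apply/eqP.
    rewrite tofracD !tofracM B1E C1E tofracXn.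
    have UE : U%:F = Y%:F ^+ (M - s) * (fmap u1).[a].
      by apply: HV; rewrite /M; move: (size u1) (size v1); clear; lia.
    have VE : V%:F = Y%:F ^+ (M - s.+2) * (fmap v1).[a].
      by apply: HV; rewrite /M; move: (size u1) (size v1); clear; lia.
    rewrite UE VE.
    rewrite -bez' mulrDl; congr (_ + _).
      rewrite -{1}(subnK (_ : s <= M)%N); last by rewrite /M; move: (size u1) (size v1); clear; lia.
      by rewrite exprD; exact: shuffle4'.
    rewrite -{1}(subnK (_ : s.+2 <= M)%N); last by rewrite /M; move: (size u1) (size v1); clear; lia.
    by rewrite exprD; exact: shuffle4'.
  by rewrite dvdp_add ?dvdp_mull // -BC dvdp_mull.
have d2 : B1 %| r * beta ^+ M.
  rewrite /beta; case: (size b1 =P s.+1) => _.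
    have [q qE] := hev_mod s b1 X Y.
    exact: dvdp_reduce cXY d1 (eq_ind _ (fun z => B1 %| z) (dvdpp B1) _ qE).
  have [q qE] := hev_mod s.+2 c1 X Y.
  have dC : B1 %| C1 by rewrite -BC dvdp_mull.
  exact: dvdp_reduce cXY d1 (eq_ind _ (fun z => B1 %| z) dC _ qE).
have l1 : (pdeg B1 <= C2)%N by apply: dvdp_pdeg d2; rewrite mulf_neq0 ?expf_neq0.
have : dle (r * Y ^+ s)%:F (C2%:Z + C3%:Z).
  have -> : (r * Y ^+ s)%:F = B1%:F * ((fmap u1).[a] + (fmap v1).[a] * x').
    rewrite tofracM tofracXn B1E -bez' -bx'; exact: shuffle5.
  by apply: dleM hC3; apply: dleW (dle_pdeg _); rewrite lez_nat.
rewrite dle_fracE ?mulf_neq0 ?expf_neq0 // pdegM ?expf_neq0 // pdegX.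
have : (pdeg Y * 1 <= pdeg Y * s)%N by rewrite leq_mul2l s0 orbT.
move: hn hdeg; rewrite /Y; move: (pdeg (rden a)) (pdeg r) (rdeg a) => y r1 h; clear; lia.
Qed.

(** Take [s = c - 3] in [osgood_pair], and divide out the common factor of the pair, which does not
    vanish at [x n] for large [n]. *)
Lemma riccati H x c : separable_poly H -> (3 <= c)%N -> (size H + 2 <= c + c)%N ->
  tends x -> bounded x -> small c H x ->
  exists q : {poly {ratfun k}}, (size q <= 3)%N /\
  exists n0, forall n, (n0 <= n)%N -> fder (x n) = q.[x n].
Proof.
move=> sepH c3 sH tx bx smx.
have h1 : (size H <= (c - 3) + (c - 3) + 4)%N by move: (size H) c3 sH; clear; lia.
have h2 : (c - 3 + 3 <= c)%N by rewrite subnK.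
have [b [c' [bc0 [n0 hx]]]] := osgood_pair sepH h1 h2 tx bx smx.
have b0 : b != 0.
  apply/eqP => b0; move: bc0; rewrite b0 eqxx /= => c0.
  have [n1 hn1] := tends_nroot c0 tx.
  have := hx (maxn n0 n1) (leq_maxl _ _); rewrite b0 horner0 mul0r => /esym/eqP.
  by apply/negP; apply: hn1; apply: leq_maxr.
pose g := gcdp b c'.
have g0 : g != 0 by rewrite gcdp_eq0 (negPf b0).
have /esym bE := divpK (dvdp_gcdl b c'); have /esym cE := divpK (dvdp_gcdr b c').
have cop : coprimep (b %/ g) (c' %/ g) by apply: coprimep_div_gcd; rewrite b0.
have b10 : b %/ g != 0 by apply: contraNneq b0 => h; rewrite bE -/g h mul0r.
have [n1 hn1] := tends_nroot g0 tx.
have hx1 : exists n0, forall n, (n0 <= n)%N -> (b %/ g).[x n] * fder (x n) = (c' %/ g).[x n].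
  exists (maxn n0 n1) => n; rewrite geq_max => /andP[/hx h /hn1 g1].
  apply: (mulIf g1); rewrite mulrAC -!hornerM.
  by rewrite /g -bE -cE.
have [sb sc] := coprime_pair_riccati cop b10 tx bx hx1.
have bcE := size1_polyC sb; set be := (b %/ g)`_0 in bcE.
have be0 : be != 0 by apply: contraNneq b10 => h; rewrite bcE h.
exists (be^-1 *: (c' %/ g)); split; first by rewrite size_scale ?invr_eq0.
have [n2 hn2] := hx1; exists n2 => n /hn2.
by rewrite bcE hornerC hornerZ => <-; rewrite mulKf.
Qed.

(** Liouville's inequality: clearing denominators in [H.[x n]] costs [deg H] times the height, so a
    larger exponent would force [H.[x n] = 0]. It later bounds from below the number of roots that
    survive the descent. *)
Lemma small_size H x c : H != 0 -> tends x -> bounded x -> small c H x -> (c < size H)%N.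
Proof.
move=> H0 tx bx [C smx]; rewrite ltnNge; apply/negP => sc.
have [d [H1 [d0 HE]]] := clear_denom H.
have [n0 hn0] := tends_nroot H0 tx.
have [n1 hn1] := tx (C + pdeg d).+1.
pose n := maxn n0 n1.
have {hn0}h0 := hn0 n (leq_maxl _ _); have {hn1}h1 := hn1 n (leq_maxr _ _).
pose e := (size H).-1.
have sH : size H = e.+1 by rewrite /e prednK // size_poly_gt0.
have sH1 : (size H1 <= e.+1)%N by rewrite -sH -size_fmap -HE size_scale ?tofrac_eq0.
pose N := hev e H1 (rnum (x n)) (rden (x n)).
have NE : N%:F = (rden (x n))%:F ^+ e * d%:F * H.[x n].
  by rewrite /N hev_frac // -HE hornerZ mulrA.
have : N = 0.
  apply: (@dle_frac_lt0 k N ((pdeg (rden (x n)))%:Z *+ e + (pdeg d)%:Z + (C%:Z - (c * rdeg (x n))%:Z))).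
    apply: linear_bound_lt0 h1 (pdeg_rden_le (x n)) _.
    by move: sc; rewrite sH.
  rewrite NE; apply: dleM (smx n); apply: dleM; last exact: dle_pdeg.
  by apply: dle_exp; exact: dle_pdeg.
have /negPf F0 : (rden (x n))%:F ^+ e * d%:F != 0 :> {ratfun k}.
  by apply: mulf_neq0; [apply: expf_neq0; rewrite tofrac_eq0 rden_neq0 | rewrite tofrac_eq0].
move=> N0; move: NE; rewrite N0 tofrac0 => /esym/eqP; rewrite mulf_eq0 F0 /=.
exact/negP.
Qed.

End Riccati.

Lemma ex_proot (F : closedFieldType) n (c : F) : (0 < n)%N -> exists r : F, r ^+ n = c.
Proof.
move=> n0; have /closed_rootP[r] : size ('X^n - c%:P) != 1%N.
  by rewrite size_XnsubC // eqSS -lt0n.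
by rewrite rootE !hornerE => /eqP/subr0_eq; exists r.
Qed.

(** * p-th powers in k(t) *)

Section Frobenius.
Variables (p : nat) (k : fieldType).
Hypothesis pk : p \in [pchar k].
Hypothesis perfect : forall c : k, exists r, r ^+ p = c.
Implicit Types (u v w : {poly k}).

Let p_pr : prime p := pcharf_prime pk.
Let p_gt0 : (0 < p)%N := prime_gt0 p_pr.

Lemma pchar_ratfun : p \in [pchar {ratfun k}].
Proof. exact: (rmorph_pchar (@tofrac {poly k} \o polyC) pk). Qed.

Lemma expp_inj (F : fieldType) : p \in [pchar F] -> injective (fun x : F => x ^+ p).
Proof.
move=> pF x y /= e; apply/eqP; rewrite -subr_eq0.
have := pFrobenius_autB_comm pF (mulrC x y); rewrite !pFrobenius_autE e subrr.
by move/eqP; rewrite expf_eq0 => /andP[].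
Qed.

Definition proot (c : k) : k := sval (cid (perfect c)).

Lemma prootK c : proot c ^+ p = c.
Proof. by rewrite /proot; case: cid. Qed.

Lemma coef_expp w m : (w ^+ p)`_m = if (p %| m)%N then (w`_(m %/ p)) ^+ p else 0.
Proof.
elim/poly_ind: w m => [|w c IH] m.
  by rewrite expr0n coef0 expr0n (gtn_eqF p_gt0) /= coef0 if_same.
have pP : p \in [pchar {poly k}] by apply: (rmorph_pchar (@polyC k) pk).
have -> : (w * 'X + c%:P) ^+ p = w ^+ p * 'X^p + (c ^+ p)%:P.
  rewrite -!(pFrobenius_autE pP) pFrobenius_autD_comm; last exact: mulrC.
  by rewrite !(pFrobenius_autE pP) exprMn rmorphXn.
rewrite !coefD coefMXn !coefMX !coefC IH.
have [->|m0] := posnP m; first by rewrite p_gt0 dvdn0 div0n /= !add0r.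
rewrite addr0; have [mp|pm] := ltnP m p.
  by rewrite gtnNdvd.
rewrite dvdn_subl //; case: ifP => // /dvdnP[q mE].
have q0 : (0 < q)%N by move: m0; rewrite mE; case: (q).
rewrite mE mulnK // (gtn_eqF q0) addr0.
by rewrite -{2}[p]mul1n -mulnBl mulnK // subn1.
Qed.

(** Coordinates of [k[t]] over its subring of [p]-th powers, in the basis
    [1, t, ..., t ^ (p - 1)]. *)
Definition pcomb (u : 'I_p -> {poly k}) : {poly k} := \sum_(i < p) 'X^i * u i ^+ p.

(** The exponents of [t] in the [i]-th summand are congruent to [i] modulo [p], so the summands have
    disjoint supports. *)
Lemma coef_pcomb (u : 'I_p -> {poly k}) m (i : 'I_p) : i = (m %% p)%N :> nat ->
  (pcomb u)`_m = ((u i)`_(m %/ p)) ^+ p.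
Proof.
move=> iE; rewrite coef_sum (bigD1 i) //= big1 ?addr0.
  rewrite coefXnM iE ltnNge leq_mod /= coef_expp.
  have e : (m - m %% p = m %/ p * p)%N by rewrite {1}(divn_eq m p) addnK.
  by rewrite e dvdn_mull // mulnK.
move=> j ji; rewrite coefXnM; case: ltnP => // jm; rewrite coef_expp.
case: ifP => //; rewrite -eqn_mod_dvd // => /eqP h; exfalso.
move/eqP: ji; apply; apply: val_inj => /=.
by rewrite iE -(modn_small (ltn_ord j)).
Qed.

Lemma pcomb_ex u : exists f : 'I_p -> {poly k}, u = pcomb f.
Proof.
exists (fun i => \poly_(m < size u) proot u`_(m * p + i)); apply/polyP => m.
have ip : (m %% p < p)%N by rewrite ltn_mod.
rewrite (@coef_pcomb _ m (Ordinal ip)) // coef_poly /=; case: ltnP => h.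
  by rewrite prootK -divn_eq.
rewrite expr0n (gtn_eqF p_gt0) nth_default //.
by apply: leq_trans h _; apply: leq_div.
Qed.

(** In lowest terms [a' b = a b'] makes [b] divide [b'], which has smaller degree. So [a' = b' = 0],
    and over a perfect field a polynomial with zero derivative is a [p]-th power. *)
Lemma fder0_expp (x : {ratfun k}) : fder x = 0 -> exists y, x = y ^+ p.
Proof.
have d0 := rden_neq0 x; have cop := coprimep_rnum_rden x.
move/eqP; rewrite {1}/fder mulf_eq0 invr_eq0 expf_eq0 /= !tofrac_eq0 (negPf d0) orbF.
rewrite subr_eq0 => /eqP e.
have sder v : v != 0 -> (size v^`() < size v)%N by apply: lt_size_deriv.
have dd0 : (rden x)^`() = 0.
  apply/eqP; apply: contraTT (sder _ d0) => dd0; rewrite -leqNgt.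
  apply: dvdp_leq => //; have : rden x %| rnum x * (rden x)^`() by rewrite -e dvdp_mull.
  by rewrite Gauss_dvdpr // coprimep_sym.
have dn0 : (rnum x)^`() = 0.
  by apply/eqP; move: e; rewrite dd0 mulr0 => /eqP; rewrite mulf_eq0 (negPf d0) orbF.
have pw v : v^`() = 0 -> exists w, v = w ^+ p.
  move=> v0; have [f vE] := pcomb_ex v.
  exists (f (Ordinal p_gt0)); apply/polyP => m; rewrite coef_expp.
  case: ifP => pm.
    by rewrite {1}vE (@coef_pcomb _ m (Ordinal p_gt0)) //= (eqP pm).
  case: m pm => [|m]; first by rewrite dvdn0.
  move=> pm; have := congr1 (fun q : {poly k} => q`_m) v0; rewrite coef_deriv coef0.
  rewrite -mulr_natr => /eqP; rewrite mulf_eq0 -(dvdn_pcharf pk) pm orbF => /eqP //.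
have [a aE] := pw _ dn0; have [b bE] := pw _ dd0.
by exists (a%:F / b%:F); rewrite [LHS]ratfunE aE bE !tofracXn expr_div_n.
Qed.

Lemma pcomb_ex_frac (x : {ratfun k}) :
  exists f : 'I_p -> {ratfun k}, x = \sum_(i < p) 'X%:F ^+ i * f i ^+ p.
Proof.
have d0 := rden_neq0 x.
(* The factor [rden x ^+ p.-1] turns the denominator into a [p]-th power, which the [f i] absorb. *)
have [f fE] := pcomb_ex (rnum x * rden x ^+ p.-1).
have F0 : (rden x)%:F != 0 :> {ratfun k} by rewrite tofrac_eq0.
exists (fun i => (f i)%:F / (rden x)%:F).
have -> : \sum_(i < p) 'X%:F ^+ i * ((f i)%:F / (rden x)%:F) ^+ p =
  (pcomb f)%:F / (rden x)%:F ^+ p.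
  rewrite rmorph_sum mulr_suml; apply: eq_bigr => i _ /=.
  by rewrite expr_div_n mulrA !tofracM !tofracXn.
rewrite -fE tofracM tofracXn {1}[x]ratfunE.
apply/eqP; rewrite eqr_div ?expf_neq0 //; apply/eqP.
by rewrite -{1}(prednK p_gt0) exprSr mulrA.
Qed.

(** The nonzero summands have degrees in distinct classes modulo [p], so their leading terms cannot
    cancel and each is bounded by the sum. *)
Lemma dle_pcomb (g : 'I_p -> {ratfun k}) n :
  dle (\sum_(i < p) 'X%:F ^+ i * g i ^+ p) n -> forall i, dle (g i ^+ p) n.
Proof.
(* The [g i] are packed into one polynomial to obtain a common denominator. *)
have [d [A [d0 gE]]] := clear_denom (\poly_(m < p) (if insub m is Some i then g i else 0)).
have F0 : d%:F != 0 :> {ratfun k} by rewrite tofrac_eq0.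
have {}gE i : g i = (A`_i)%:F / d%:F.
  apply: (mulfI F0); rewrite mulrCA divff // mulr1 -coef_map /= -/(fmap A) -gE.
  by rewrite coefZ coef_poly ltn_ord valK.
have -> : \sum_(i < p) 'X%:F ^+ i * g i ^+ p = (pcomb (fun i => A`_i))%:F / (d ^+ p)%:F.
  rewrite rmorph_sum mulr_suml; apply: eq_bigr => i _ /=.
  by rewrite gE expr_div_n mulrA !tofracM !tofracXn.
rewrite dleE ?expf_neq0 // => h i.
rewrite gE expr_div_n -!tofracXn dleE ?expf_neq0 //.
rewrite expf_eq0 p_gt0 /=; have [//|Ai0] := eqVneq A`_i 0.
pose m := ((size (A`_i)%R).-1 * p + i)%N.
have mi : (m %% p)%N = i by rewrite modnMDl modn_small.
have mq : (m %/ p)%N = (size (A`_i)%R).-1 by rewrite divnMDl // divn_small ?addn0.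
have c0 : (pcomb (fun i : 'I_p => A`_i))`_m != 0.
  by rewrite (@coef_pcomb _ m i) ?mi // mq expf_neq0 // -lead_coefE lead_coef_eq0.
have P0 : pcomb (fun i : 'I_p => A`_i) != 0 by apply: contraNneq c0 => ->; rewrite coef0.
move: h; rewrite (negPf P0) /= => h; apply: le_trans h.
rewrite lerD2r lez_nat.
have sm : (m < size (pcomb (fun i : 'I_p => A`_i))%R)%N.
  by rewrite ltnNge; apply/negP => h'; move/eqP: c0; apply; apply: nth_default.
apply: leq_trans sm; have := size_exp A`_i p; rewrite /m.
by have := size_gt0Z (expf_neq0 p Ai0); move: (size (A`_i ^+ p)%R); case=> //= n1 _ ->; rewrite leq_addr.
Qed.

Lemma dle_expp (x : {ratfun k}) (C a : nat) :
  dle (x ^+ p) (C%:Z - (p * a)%:Z) -> dle x (C%:Z - a%:Z).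
Proof.
rewrite [x]ratfunE expr_div_n -!tofracXn.
have := rden_neq0 x; move: (rnum x) (rden x) => u v v0.
rewrite !dleE ?expf_neq0 // expf_eq0 p_gt0 /=; have [//|u0] /= := eqVneq u 0.
have := size_exp u p; have := size_exp v p.
have := size_gt0Z (expf_neq0 p u0); have := size_gt0Z (expf_neq0 p v0).
have := size_gt0Z u0; have := size_gt0Z v0.
move: (size (u ^+ p)) (size (v ^+ p)) (size u) (size v) => U V a1 b1 h1 h2 h3 h4 h5 h6 h7.
have e1 : U = (a1.-1 * p).+1 by move: h3 h4 h6; clear; lia.
have e2 : V = (b1.-1 * p).+1 by move: h3 h4 h5; clear; lia.
move: h7; rewrite e1 e2; case: a1 h2 {h6 e1} => // a1 _; case: b1 h1 {h5 e2} => // b1 _ /=.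
move: p_gt0; clear; nia.
Qed.

Lemma rdeg_expp (x : {ratfun k}) : rdeg (x ^+ p) = (p * rdeg x)%N.
Proof.
have h1 : coprimep (rnum x ^+ p) (rden x ^+ p).
  by apply: coprimep_expl; apply: coprimep_expr; exact: coprimep_rnum_rden.
have h2 : rden x ^+ p != 0 by rewrite expf_neq0 ?rden_neq0.
have h3 : x ^+ p = (rnum x ^+ p)%:F / (rden x ^+ p)%:F.
  by rewrite {1}[x]ratfunE expr_div_n !tofracXn.
have [c c0 [e1 e2]] := rnum_rden_uniq h1 h2 h3.
rewrite /rdeg e1 e2 /pdeg !size_scale // -/(pdeg (rnum x ^+ p)) -/(pdeg (rden x ^+ p)).
by rewrite !pdegX maxnMr !(mulnC _ p).
Qed.

End Frobenius.

(** * Moebius maps and cross ratios *)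

(* The binary form [hev n A] at a pair of polynomials. *)
Definition hsub (R : comNzRingType) n (A : {poly R}) (U V : {poly R}) : {poly R} :=
  hev n (map_poly polyC A) U V.

Lemma horner_hsub (R : comNzRingType) n (A U V : {poly R}) z :
  (hsub n A U V).[z] = hev n A U.[z] V.[z].
Proof.
rewrite -/(horner_eval z _) hev_rmorph; congr (hev _ _ _ _).
by apply/polyP => i; rewrite !coef_map /= /horner_eval hornerC.
Qed.

Lemma map_hsub (R S : comNzRingType) (f : {rmorphism R -> S}) n (A U V : {poly R}) :
  map_poly f (hsub n A U V) = hsub n (map_poly f A) (map_poly f U) (map_poly f V).
Proof.
rewrite (hev_rmorph (map_poly f)); congr (hev _ _ _ _).
by apply/polyP => i; rewrite !coef_map /= map_polyC.
Qed.

Section Lines.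
Variable R : comNzRingType.

Definition lin (a b : R) : {poly R} := a *: 'X + b%:P.

Lemma horner_lin a b z : (lin a b).[z] = a * z + b.
Proof. by rewrite /lin !hornerE. Qed.

Lemma coef_lin_exp a b i :
  (size (lin a b ^+ i) <= i.+1)%N /\ (lin a b ^+ i)`_i = a ^+ i.
Proof.
elim: i => [|i [IHs IHc]]; first by rewrite !expr0 size_poly1 coef1.
have e : lin a b ^+ i.+1 = a *: (lin a b ^+ i * 'X) + b *: lin a b ^+ i.
  by rewrite exprSr; move: (lin a b ^+ i) => w; rewrite /lin mulrDr -scalerAr [w * b%:P]mulrC mul_polyC.
split; last first.
  rewrite e coefD !coefZ coefMX /= IHc (nth_default _ IHs) mulr0 addr0.
  by rewrite exprS.
rewrite e (leq_trans (size_polyD _ _)) // geq_max; apply/andP; split.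
  apply: leq_trans (size_scale_leq _ _) _; apply: leq_trans (size_polyMleq _ _) _.
  by rewrite size_polyX addn2 /= ltnS.
by apply: leq_trans (size_scale_leq _ _) _; apply: leqW.
Qed.

(** The top coefficient is the value of the form at [(a : c)], the image of infinity. *)
Lemma hsub_lin n (A : {poly R}) a b c d :
  (size (hsub n A (lin a b) (lin c d)) <= n.+1)%N /\
  (hsub n A (lin a b) (lin c d))`_n = hev n A a c.
Proof.
have h (i : 'I_n.+1) : (size (lin a b ^+ i * lin c d ^+ (n - i))%R <= n.+1)%N /\
    (lin a b ^+ i * lin c d ^+ (n - i))`_n = a ^+ i * c ^+ (n - i).
  have [s1 c1] := coef_lin_exp a b i; have [s2 c2] := coef_lin_exp c d (n - i).
  have li : (i <= n)%N by rewrite -ltnS.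
  split; first by apply: leq_trans (size_polyMleq _ _) _; lia.
  rewrite coefM (bigD1 i) //= c1 c2 big1 ?addr0 // => m mi.
  have [im|im] := ltnP i m; first by rewrite (nth_default _ (leq_trans s1 im)) mul0r.
  rewrite [X in _ * X]nth_default ?mulr0 //; apply: leq_trans s2 _.
  have : (m != i :> nat) by [].
  by move: li im; clear; lia.
have e i : (map_poly polyC A)`_i = (A`_i)%:P by rewrite coef_map_id0 ?polyC0.
split.
  rewrite /hsub /hev; apply: leq_trans (size_sum _ _ _) _; apply/bigmax_leqP => i _.
  by rewrite e -mulrA mul_polyC; apply: leq_trans (size_scale_leq _ _) _; case: (h i).
rewrite /hsub /hev coef_sum; apply: eq_bigr => i _.
by rewrite e -!mulrA mul_polyC coefZ; case: (h i) => _ ->.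
Qed.

End Lines.

Section Mobius.
Variable F : fieldType.
Implicit Types (a b c d z w : F).

Definition mob a b c d z := (a * z + b) / (c * z + d).

Lemma mob_sub a b c d z w : c * z + d != 0 -> c * w + d != 0 ->
  mob a b c d z - mob a b c d w =
  (a * d - b * c) * (z - w) / ((c * z + d) * (c * w + d)).
Proof. by move=> h1 h2; rewrite /mob; field; rewrite h1 h2. Qed.

(* Cross ratio. *)
Definition cr a b c d := ((a - b) * (c - d)) / ((a - d) * (c - b)).

Lemma cr_mob a b c d z1 z2 z3 z4 : a * d - b * c != 0 ->
  c * z1 + d != 0 -> c * z2 + d != 0 -> c * z3 + d != 0 -> c * z4 + d != 0 ->
  z1 != z4 -> z3 != z2 ->
  cr (mob a b c d z1) (mob a b c d z2) (mob a b c d z3) (mob a b c d z4) = cr z1 z2 z3 z4.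
Proof.
move=> D0 h1 h2 h3 h4 h14 h32; rewrite /cr !mob_sub //.
move: D0 h1 h2 h3 h4; rewrite -subr_eq0 in h14; rewrite -subr_eq0 in h32.
move: (a * d - b * c) (c * z1 + d) (c * z2 + d) (c * z3 + d) (c * z4 + d) => D e1 e2 e3 e4.
move: (z1 - z2) (z3 - z4) (z1 - z4) (z3 - z2) h14 h32 => u v s t s0 t0 D0 h1 h2 h3 h4.
by field; rewrite D0 h1 h2 h3 h4 s0 t0.
Qed.

Lemma separable_of_roots (P : {poly F}) (rs : seq F) : P != 0 ->
  (size P <= (size rs).+1)%N -> all (root P) rs -> uniq rs ->
  separable_poly P /\ size P = (size rs).+1.
Proof.
move=> P0 sP aP urs.
have e : size P = (size rs).+1.
  by apply/eqP; rewrite eqn_leq sP max_poly_roots.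
have urs' : uniq_roots rs by rewrite uniq_rootsE.
split=> //; rewrite (all_roots_prod_XsubC e aP urs').
rewrite (eqp_separable (eqp_scale _ _)) ?lead_coef_eq0 //.
by rewrite separable_prod_XsubC.
Qed.

End Mobius.

Lemma mob_clear (F : fieldType) (e a b x y : F) : y != 0 ->
  e * y * (a * (x / y) + b) = e * a * x + e * b * y.
Proof. by move=> y0; field. Qed.

Lemma rdeg_mob (k : fieldType) (a b c d : {ratfun k}) :
  exists C : nat, forall z, c * z + d != 0 -> (rdeg (mob a b c d z) <= rdeg z + C)%N.
Proof.
have [e [A [e0 AE]]] := clear_denom (Poly [:: a; b; c; d]).
have F0 (u : {poly k}) : u != 0 -> u%:F != 0 :> {ratfun k} by rewrite tofrac_eq0.
have cE i : e%:F * (Poly [:: a; b; c; d])`_i = (A`_i)%:F.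
  by rewrite -coefZ AE coef_map.
have [aE bE cE' dE] : [/\ e%:F * a = (A`_0)%:F, e%:F * b = (A`_1)%:F,
    e%:F * c = (A`_2)%:F & e%:F * d = (A`_3)%:F].
  by rewrite -!cE !coef_Poly.
move: (A`_0) (A`_1) (A`_2) (A`_3) aE bE cE' dE => a1 b1 c1 d1 aE bE cE' dE {A AE cE}.
exists (maxn (maxn (pdeg a1) (pdeg b1)) (maxn (pdeg c1) (pdeg d1))) => z h.
set X := rnum z; set Y := rden z.
have Y0 : Y != 0 by apply: rden_neq0.
have m1 : e%:F * Y%:F * (a * z + b) = (a1 * X + b1 * Y)%:F.
  rewrite tofracD !tofracM -aE -bE {1}[z]ratfunE -/X -/Y; apply: mob_clear; exact: F0.
have m2 : e%:F * Y%:F * (c * z + d) = (c1 * X + d1 * Y)%:F.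
  rewrite tofracD !tofracM -cE' -dE {1}[z]ratfunE -/X -/Y; apply: mob_clear; exact: F0.
have n0 : e%:F * Y%:F != 0 :> {ratfun k} by apply: mulf_neq0; exact: F0.
have v0 : c1 * X + d1 * Y != 0.
  by rewrite -tofrac_eq0 -m2; apply: mulf_neq0; [exact: n0 | exact: h].
have -> : mob a b c d z = (a1 * X + b1 * Y)%:F / (c1 * X + d1 * Y)%:F.
  by rewrite -m1 -m2 -mulf_div (divff n0) mul1r.
apply: leq_trans (rdeg_le _ v0) _.
have hX : (pdeg X <= rdeg z)%N by apply: leq_maxl.
have hY : (pdeg Y <= rdeg z)%N by apply: leq_maxr.
have pdm (u v : {poly k}) : (pdeg (u * v) <= pdeg u + pdeg v)%N.
  by have := size_polyMleq u v; rewrite /pdeg; move: (size (u * v)%R) (size u) (size v); lia.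
have pdd (u v : {poly k}) : (pdeg (u + v)%R <= maxn (pdeg u) (pdeg v))%N.
  by have := size_polyD u v; rewrite /pdeg; move: (size (u + v)%R) (size u) (size v); lia.
have := pdd (a1 * X) (b1 * Y); have := pdd (c1 * X) (d1 * Y).
have := pdm a1 X; have := pdm b1 Y; have := pdm c1 X; have := pdm d1 Y; move: hX hY.
move: (pdeg (a1 * X + b1 * Y)) (pdeg (c1 * X + d1 * Y)) (pdeg (a1 * X)) (pdeg (b1 * Y))
  (pdeg (c1 * X)) (pdeg (d1 * Y)) (pdeg a1) (pdeg b1) (pdeg c1) (pdeg d1) (pdeg X) (pdeg Y)
  (rdeg z).
by clear; lia.
Qed.

Lemma quadratic_identity (R : comNzRingType) (q0 q1 q2 a b : R) :
  0 + q0 * a ^+ 0 + q1 * a ^+ 1 + q2 * a ^+ 2 - (0 + q0 * b ^+ 0 + q1 * b ^+ 1 + q2 * b ^+ 2) =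
  (a - b) * (q2 * (a + b) + q1).
Proof. by ring. Qed.

Lemma riccati_sum1 (R : comNzRingType) (q1 q2 a b c d : R) :
  (a - b) * (q2 * (a + b) + q1) * (c - d) + (a - b) * ((c - d) * (q2 * (c + d) + q1)) =
  (a - b) * (c - d) * (q2 * (a + b + c + d) + q1 + q1).
Proof. by ring. Qed.

Lemma riccati_sum2 (R : comNzRingType) (q1 q2 a b c d : R) :
  (a - d) * (q2 * (a + d) + q1) * (c - b) + (a - d) * ((c - b) * (q2 * (c + b) + q1)) =
  (a - d) * (c - b) * (q2 * (a + b + c + d) + q1 + q1).
Proof. by ring. Qed.

(* Four solutions of a Riccati equation have a cross ratio with zero derivative. *)
Lemma derivation_cr (F : fieldType) (D : F -> F) (q : {poly F}) (a b c d : F) :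
  {morph D : x y / x - y} -> (forall x y, D (x * y) = D x * y + x * D y) ->
  (size q <= 3)%N -> D a = q.[a] -> D b = q.[b] -> D c = q.[c] -> D d = q.[d] ->
  a != d -> c != b -> D (cr a b c d) = 0.
Proof.
move=> DB DM sq ha hb hc hd; rewrite -!(subr_eq0 a) -(subr_eq0 c) => ad cb.
have v0 := mulf_neq0 ad cb.
have fB s t : D s = q.[s] -> D t = q.[t] ->
    D (s - t) = (s - t) * (q`_2 * (s + t) + q`_1).
  move=> hs ht; rewrite DB hs ht.
  rewrite !(horner_coef_wide _ sq) !big_ord_recr !big_ord0 /=.
  exact: quadratic_identity.
apply: (mulIf v0); rewrite mul0r; apply/eqP.
have e1 := DM (cr a b c d) ((a - d) * (c - b)).
have zv : cr a b c d * ((a - d) * (c - b)) = (a - b) * (c - d) by apply: divfK.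
rewrite zv (DM (a - b)) (DM (a - d)) (fB a b ha hb) (fB c d hc hd) in e1.
rewrite (fB a d ha hd) (fB c b hc hb) riccati_sum1 riccati_sum2 in e1.
rewrite (mulrA (cr a b c d)) zv in e1.
by move: e1 => /esym/(canRL (addrK _)) ->; rewrite subrr.
Qed.

Lemma horner_sub_factor (F : fieldType) (P : {poly F}) a :
  exists Q : {poly F}, forall z, P.[z] - P.[a] = Q.[z] * (z - a).
Proof.
have /factor_theorem[Q QE] : root (P - (P.[a])%:P) a.
  by rewrite rootE hornerD hornerN hornerC subrr.
exists Q => z; have := congr1 (fun q => q.[z]) QE.
by rewrite hornerM hornerXsubC hornerD hornerN hornerC.
Qed.

(** * Descent along Frobenius *)

Section Seq.
Variable k : fieldType.
Implicit Types (w z : {ratfun k}) (H q : {poly {ratfun k}}) (x : nat -> {ratfun k}).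

Lemma ndle_ex w : w != 0 -> exists m : nat, ~~ dle w (- m%:Z).
Proof.
move=> w0; exists (size (rden w)).+1; rewrite /dle (negPf w0) /= -ltNge; lia.
Qed.

Lemma dle_inv w (n : nat) : ~~ dle w (- n%:Z) -> w != 0 /\ dle w^-1 n%:Z.
Proof.
move=> h; have w0 : w != 0 by apply: contraNneq h => ->; rewrite dle0.
split=> //; move: h w0; rewrite [w]ratfunE.
have := rden_neq0 w; move: (rnum w) (rden w) => u v v0 h.
rewrite mulf_eq0 negb_or tofrac_eq0 => /andP[u0 _]; move: h.
rewrite invf_div !dleE // (negPf u0) (negPf v0) /= -ltNge.
by move: (size u) (size v) => a b; lia.
Qed.

(** If [x n] came close to [a], then [H.[a]] would be close to [H.[x n]], which is arbitrarily
    small. *)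
Lemma bounded_away H x a c : (0 < c)%N -> H.[a] != 0 -> tends x -> bounded x -> small c H x ->
  exists C n0 : nat, forall n, (n0 <= n)%N -> x n != a /\ dle (x n - a)^-1 C%:Z.
Proof.
move=> c0 Ha tx bx [C hC]; have [M hM] := ndle_ex Ha.
have [Q QE] := horner_sub_factor H a.
have [C1 hC1] := bounded_horner Q bx.
have [n0 hn0] := tx (C + M)%N.
exists (C1 + M)%N, n0 => n /hn0 hn.
have h : ~~ dle (x n - a) (- (C1 + M)%:Z).
  apply: contraNN hM => h.
  have -> : H.[a] = H.[x n] - Q.[x n] * (x n - a).
    by rewrite -QE subKr.
  apply: dleB.
    apply: dleW (hC n).
    have : (1 * rdeg (x n) <= c * rdeg (x n))%N by rewrite leq_mul2r c0 orbT.
    by move: hn; move: (rdeg (x n)) => r; clear; lia.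
  by apply: dleW (dleM (hC1 n) h); lia.
have [h1 h2] := dle_inv h.
by split=> //; rewrite -subr_eq0.
Qed.

End Seq.

Lemma gcd_family (F : fieldType) n (g : 'I_n -> {poly F}) :
  exists (u : 'I_n -> {poly F}) h, h = \sum_(i < n) u i * g i /\ forall i, h %| g i.
Proof.
elim: n g => [|n IH] g.
  by exists (fun=> 0), 0; split; [rewrite big_ord0 | case].
have [u [h [hE hd]]] := IH (fun i => g (widen_ord (leqnSn n) i)).
have [[a b] /= /eqpP[[c1 c2] /= /andP[c10 c20] e]] := Bezoutp h (g ord_max).
pose c := c2^-1 * c1.
have e' : gcdp h (g ord_max) = c *: a * h + c *: b * g ord_max.
  by rewrite -!scalerAl -scalerDr -scalerA e scalerA mulVf // scale1r.
exists (fun i => if unlift ord_max i is Some i' then c *: a * u i' else c *: b), (gcdp h (g ord_max)).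
split.
  rewrite e' big_ord_recr /= unlift_none; congr (_ + _).
  rewrite hE mulr_sumr; apply: eq_bigr => i _.
  have -> : widen_ord (leqnSn n) i = lift ord_max i.
    by apply: val_inj; rewrite /= /bump leqNgt ltn_ord.
  by rewrite liftK mulrA.
move=> i; case: (unliftP ord_max i) => [i' ->|->]; last exact: dvdp_gcdr.
apply: dvdp_trans (dvdp_gcdl _ _) _.
have <- : widen_ord (leqnSn n) i' = lift ord_max i'.
  by apply: val_inj; rewrite /= /bump leqNgt ltn_ord.
exact: hd.
Qed.

Section Step.
Variables (p : nat) (k : fieldType).
Hypothesis pk : p \in [pchar k].
Hypothesis perfect : forall c : k, exists r, r ^+ p = c.
Variables (L : closedFieldType) (j : {rmorphism {ratfun k} -> L}).
Implicit Types (H : {poly {ratfun k}}) (x y : nat -> {ratfun k}).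

Let pK : p \in [pchar {ratfun k}] := pchar_ratfun pk.
Let pL : p \in [pchar L] := rmorph_pchar j pK.

Lemma horner_frob (F : fieldType) (pF : p \in [pchar F]) (P : {poly F}) (z : F) :
  (map_poly (pFrobenius_aut pF) P).[z ^+ p] = P.[z] ^+ p.
Proof. by rewrite -!(pFrobenius_autE pF) horner_map. Qed.

(* Splitting coefficients along K = \sum_(i < p) t ^ i K ^ p. *)
Lemma frob_split G c y : separable_poly G -> bounded y ->
  (exists C : nat, forall n, dle G.[y n ^+ p] (C%:Z - (p * (c * rdeg (y n)))%:Z)) ->
  exists H', [/\ separable_poly H', map_poly (pFrobenius_aut pK) H' %| G & small c H' y].
Proof.
move=> sepG by_ [C hC].
pose f m := sval (cid (pcomb_ex_frac pk perfect G`_m)).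
have fE m : G`_m = \sum_(i < p) 'X%:F ^+ i * f m i ^+ p by rewrite /f; case: cid.
pose g (i : 'I_p) : {poly {ratfun k}} := \poly_(m < size G) f m i.
have gE i m : (m < size G)%N -> (g i)`_m = f m i by move=> h; rewrite coef_poly h.
have GE : G = \sum_(i < p) ('X%:F ^+ i)%:P * map_poly (pFrobenius_aut pK) (g i).
  apply/polyP => m; rewrite coef_sum.
  have [hm|hm] := ltnP m (size G).
    rewrite fE; apply: eq_bigr => i _.
    by rewrite coefCM coef_map /= pFrobenius_autE gE.
  rewrite nth_default // big1 // => i _.
  by rewrite coefCM coef_map /= coef_poly ltnNge hm /= rmorph0 mulr0.
have Gy a : G.[a ^+ p] = \sum_(i < p) 'X%:F ^+ i * (g i).[a] ^+ p.
  rewrite {1}GE horner_sum; apply: eq_bigr => i _.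
  by rewrite hornerM hornerC horner_frob.
(* By Bezout the gcd [H'] of the [g i] is as small as all of them, while its Frobenius twist divides
   [G], from which it inherits separability. *)
have [u [H' [H'E H'd]]] : exists (u : 'I_p -> {poly {ratfun k}}) H',
    H' = \sum_(i < p) u i * g i /\ forall i, H' %| g i.
  exact: gcd_family.
have FH' : map_poly (pFrobenius_aut pK) H' %| G.
  rewrite GE; apply: (big_ind (fun q => map_poly (pFrobenius_aut pK) H' %| q)) => [|a b|i _].
  - exact: dvdp0.
  - exact: dvdp_add.
  - by apply: dvdp_mull; rewrite dvdp_map; exact: H'd.
exists H'; split=> //.
  by rewrite -(separable_map (pFrobenius_aut pK)); apply: dvdp_separable sepG.
have sg i n : dle (g i).[y n] (C%:Z - (c * rdeg (y n))%:Z).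
  apply: (dle_expp pk).
  have := hC n; rewrite Gy => h.
  exact: (dle_pcomb pk (g := fun i => (g i).[y n]) h i).
have [C' hC'] : exists C' : nat, forall i n, dle (u i).[y n] C'%:Z.
  have h i := bounded_horner (u i) by_.
  exists (\max_(i < p) sval (cid (h i)))%N => i n.
  have := svalP (cid (h i)) n; apply: dleW; rewrite lez_nat.
  exact: (leq_bigmax i).
exists (C + C')%N => n; rewrite H'E horner_sum.
apply: dle_sum => i; rewrite hornerM.
by apply: dleW (dleM (hC' i n) (sg i n)); lia.
Qed.

End Step.

Section MobiusInverse.
Variable F : fieldType.
Implicit Types (a b c d x z w : F).

Lemma mob_inverse a b c d w : a * d - b * c != 0 -> - c * w + a != 0 ->
  c * mob d (- b) (- c) a w + d != 0 /\ mob a b c d (mob d (- b) (- c) a w) = w.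
Proof.
move=> D0 u0.
have e1 : c * mob d (- b) (- c) a w + d = (a * d - b * c) / (- c * w + a).
  by rewrite /mob; field.
have n1 : c * mob d (- b) (- c) a w + d != 0 by rewrite e1 mulf_neq0 ?invr_eq0.
split=> //; apply: (mulIf n1); rewrite {1}/mob divfK //.
by rewrite e1 /mob; field.
Qed.

Lemma mob_inj a b c d z w : a * d - b * c != 0 -> c * z + d != 0 -> c * w + d != 0 ->
  mob a b c d z = mob a b c d w -> z = w.
Proof.
move=> D0 z0 w0 /eqP; rewrite -subr_eq0 mob_sub // !mulf_eq0 invr_eq0 mulf_eq0.
by rewrite (negPf D0) (negPf z0) (negPf w0) /= orbF subr_eq0 => /eqP.
Qed.

Lemma cr_inverse x x1 x2 x3 : x != x2 -> x1 != x2 -> x3 != x1 -> x3 != x2 ->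
  (x3 - x1) * cr x x1 x3 x2 - (x3 - x2) != 0 /\
  x = mob ((x3 - x1) * x2) (- ((x3 - x2) * x1)) (x3 - x1) (- (x3 - x2)) (cr x x1 x3 x2).
Proof.
rewrite -(subr_eq0 x) -(subr_eq0 x1) -!(subr_eq0 x3) => h1 h2 h3 h4.
have e : (x3 - x1) * cr x x1 x3 x2 - (x3 - x2) = (x3 - x2) * (x2 - x1) / (x - x2).
  by rewrite /cr; field; rewrite h1 h3.
have h2' : x2 - x1 != 0 by rewrite -opprB oppr_eq0.
have n0 : (x3 - x1) * cr x x1 x3 x2 - (x3 - x2) != 0.
  by rewrite e !mulf_neq0 ?invr_eq0.
split=> //; apply: (mulIf n0); rewrite /mob divfK // e /cr.
by field; rewrite h1 h3.
Qed.

Lemma det_neq0 x1 x2 x3 : x1 != x2 -> x3 != x1 -> x3 != x2 ->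
  (x3 - x1) * x2 * (- (x3 - x2)) - - ((x3 - x2) * x1) * (x3 - x1) != 0.
Proof.
rewrite -(subr_eq0 x1) -!(subr_eq0 x3) => h1 h2 h3.
have -> : (x3 - x1) * x2 * (- (x3 - x2)) - - ((x3 - x2) * x1) * (x3 - x1) =
  (x3 - x1) * (x3 - x2) * (x1 - x2) by ring.
by rewrite !mulf_neq0.
Qed.

Lemma cr_mobE x x1 x2 x3 :
  cr x x1 x3 x2 = mob (x3 - x2) (- ((x3 - x2) * x1)) (x3 - x1) (- ((x3 - x1) * x2)) x.
Proof. by rewrite /cr /mob; congr (_ / _); ring. Qed.

Lemma cr_rmorph (E : fieldType) (f : {rmorphism F -> E}) a b c d :
  f (cr a b c d) = cr (f a) (f b) (f c) (f d).
Proof. by rewrite /cr fmorph_div !rmorphM !rmorphB. Qed.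

Lemma hsub_linE n (A : {poly F}) a b c d z : (size A <= n.+1)%N -> c * z + d != 0 ->
  (hsub n A (lin a b) (lin c d)).[z] = (c * z + d) ^+ n * A.[mob a b c d z].
Proof. by move=> sA h; rewrite horner_hsub !horner_lin hev_horner. Qed.

(** As [A] has full degree [n], its form does not vanish at infinity, so no zero of the pullback is
    sent there. *)
Lemma hsub_lin_pole n (A : {poly F}) a b c d z : A`_n != 0 -> a * d - b * c != 0 ->
  (hsub n A (lin a b) (lin c d)).[z] = 0 -> c * z + d != 0.
Proof.
move=> An D0; rewrite horner_hsub !horner_lin => h; apply/eqP => h0; move: h.
rewrite h0; have [q ->] := hev_mod n A (a * z + b) 0.
rewrite mul0r addr0 => /eqP; rewrite mulf_eq0 (negPf An) expf_eq0 /= => /andP[_ /eqP h].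
move/eqP: D0; apply; have [c0|c0] := eqVneq c 0.
  by move: h0; rewrite c0 mul0r add0r mulr0 subr0 => ->; rewrite mulr0.
apply: (mulfI c0); rewrite mulr0.
have -> : c * (a * d - b * c) = c * a * (c * z + d) - c * c * (a * z + b) by ring.
by rewrite h h0 !mulr0 subr0.
Qed.

End MobiusInverse.

Lemma map_lin (R S : comNzRingType) (f : {rmorphism R -> S}) a b :
  map_poly f (lin a b) = lin (f a) (f b).
Proof. by rewrite /lin rmorphD /= map_polyZ map_polyX map_polyC. Qed.

Lemma closed_roots (L : closedFieldType) (P : {poly L}) : separable_poly P ->
  exists rs : seq L, [/\ uniq rs, size P = (size rs).+1 & forall z, root P z = (z \in rs)].
Proof.
move=> sepP; have P0 := separable_poly_neq0 sepP.
have [rs PE] := closed_field_poly_normal P.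
have l0 : lead_coef P != 0 by rewrite lead_coef_eq0.
exists rs; split.
- by rewrite -separable_prod_XsubC -(eqp_separable (eqp_scale _ l0)) -PE.
- by rewrite PE size_scale // size_prod_XsubC.
by move=> z; rewrite PE rootZ // root_prod_XsubC.
Qed.

(** [a / c] is the image of infinity. When it is not a root of [H], no root of the pullback escapes
    to infinity, and the preimages of the roots of [H] in [L] are as many as the degree. *)
Lemma separable_mob (k : fieldType) (L : closedFieldType) (j : {rmorphism k -> L})
    (H : {poly k}) a b c d : c != 0 -> a * d - b * c != 0 ->
  separable_poly H -> H.[a / c] != 0 ->
  separable_poly (hsub (size H).-1 H (lin a b) (lin c d)).
Proof.
move=> c0 D0 sepH Ha; set e := (size H).-1.
have H0 := separable_poly_neq0 sepH.
have sH : size H = e.+1 by rewrite /e prednK // size_poly_gt0.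
rewrite -(separable_map j) map_hsub !map_lin.
set Hj := map_poly j H; have sHj : size Hj = e.+1 by rewrite size_map_poly.
have [|rs [urs srs rrs]] := @closed_roots L Hj; first by rewrite separable_map.
have D0' : j a * j d - j b * j c != 0 by rewrite -!rmorphM -rmorphB fmorph_eq0.
have u0 w : w \in rs -> - j c * w + j a != 0.
  rewrite -rrs => rw; apply/eqP => h.
  have wE : w = j (a / c).
    rewrite fmorph_div; apply: (mulfI (_ : j c != 0)); first by rewrite fmorph_eq0.
    rewrite mulrCA divff ?fmorph_eq0 // mulr1.
    by move/eqP: h; rewrite addrC mulNr subr_eq0 => /eqP.
  by move: rw; rewrite wE rootE horner_map fmorph_eq0 (negPf Ha).
have rsE : size rs = e by move: srs; rewrite sHj => -[].
pose M := mob (j d) (- j b) (- j c) (j a).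
have [sG cG] := hsub_lin e Hj (j a) (j b) (j c) (j d).
have [] // := @separable_of_roots L (hsub e Hj (lin (j a) (j b)) (lin (j c) (j d))) (map M rs).
- apply: contraTneq isT => G0; move: cG; rewrite G0 coef0.
  rewrite hev_horner ?sHj ?fmorph_eq0 // => /esym/eqP.
  rewrite mulf_eq0 expf_eq0 fmorph_eq0 (negPf c0) andbF /=.
  by rewrite -fmorph_div horner_map fmorph_eq0 (negPf Ha).
- by rewrite size_map rsE.
- apply/allP => _ /mapP[w wrs ->]; have [h1 h2] := mob_inverse D0' (u0 w wrs).
  rewrite rootE hsub_linE ?sHj //; rewrite h2.
  by move: wrs; rewrite -rrs rootE => /eqP ->; rewrite mulr0.
rewrite map_inj_in_uniq // => w1 w2 h1 h2 e12.
have [_ e1] := mob_inverse D0' (u0 w1 h1); have [_ e2] := mob_inverse D0' (u0 w2 h2).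
by rewrite -e1 -e2; congr (mob _ _ _ _ _); exact: e12.
Qed.

Section Step.
Variables (p : nat) (k : fieldType).
Hypothesis pk : p \in [pchar k].
Hypothesis perfect : forall c : k, exists r, r ^+ p = c.
Variables (L : closedFieldType) (j : {rmorphism {ratfun k} -> L}).
Implicit Types (H : {poly {ratfun k}}) (x y : nat -> {ratfun k}).

Let pK : p \in [pchar {ratfun k}] := pchar_ratfun pk.
Let pL : p \in [pchar L] := rmorph_pchar j pK.
Let p_gt0 : (0 < p)%N := prime_gt0 (pcharf_prime pk).

Definition approx c H x := [/\ separable_poly H, tends x, bounded x & small c H x].

(* The cross ratio of [x n] with three further solutions of its Riccati equation has
   derivative 0, hence is a [p]-th power [y n ^ p]; this brings the problem for [x] and
   [H] to one for [y] and some [H']. *)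
Lemma frobenius_step c H x : (3 <= c)%N -> (size H + 2 <= c + c)%N -> approx c H x ->
  exists H' y (rho : L -> L), [/\ approx c H' y,
    forall z, root (map_poly j H') z -> root (map_poly j H) (rho z),
    forall z w, root (map_poly j H') z -> root (map_poly j H') w -> rho z = rho w -> z = w &
    forall z1 z2 z3 z4, root (map_poly j H') z1 -> root (map_poly j H') z2 ->
      root (map_poly j H') z3 -> root (map_poly j H') z4 -> z1 != z4 -> z3 != z2 ->
      cr (rho z1) (rho z2) (rho z3) (rho z4) = cr z1 z2 z3 z4 ^+ p].
Proof.
move=> c3 sHc [sepH tx bx smx].
have H0 := separable_poly_neq0 sepH.
have [q [sq [n0 hq]]] := riccati sepH c3 sHc tx bx smx.
have [nH hnH] := tends_nroot H0 tx.
pose n1 := maxn n0 nH.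
(* Strictly increasing heights keep the three reference terms distinct from one another and from the
   tail of the sequence. *)
have ex_next B : exists n, (n1 <= n)%N /\ (B < rdeg (x n))%N.
  have [n hn] := tx B.+1; exists (maxn n1 n); split; first exact: leq_maxl.
  by apply: hn; exact: leq_maxr.
have [m1 [m1n _]] := ex_next 0%N.
have [m2 [m2n m21]] := ex_next (rdeg (x m1)).
have [m3 [m3n m32]] := ex_next (rdeg (x m2)).
have [N0 hN0] := tx (rdeg (x m3)).+1.
have hx n : (n1 <= n)%N -> fder (x n) = q.[x n].
  by move=> h; apply: hq; apply: leq_trans h; exact: leq_maxl.
(* The cross ratio will send [x m2] to infinity. Not being a root of [H], this point stays away from
   the sequence, so that [z] is bounded. *)
have H2 : H.[x m2] != 0 by apply: hnH; apply: leq_trans m2n; exact: leq_maxr.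
have c0 : (0 < c)%N by apply: leq_trans c3.
have [C2 [N2 hN2]] := bounded_away c0 H2 tx bx smx.
pose N := maxn n1 (maxn N0 N2).
pose x' n := x (n + N)%N.
have nN1 n : (n1 <= n + N)%N by apply: leq_trans (leq_addl _ _); exact: leq_maxl.
have nN0 n : (N0 <= n + N)%N.
  by apply: leq_trans (leq_addl _ _); apply: leq_trans (leq_maxr _ _); exact: leq_maxl.
have nN2 n : (N2 <= n + N)%N.
  by apply: leq_trans (leq_addl _ _); apply: leq_trans (leq_maxr _ _); exact: leq_maxr.
move: (hx _ m1n) (hx _ m2n) (hx _ m3n) H2 hN2 m21 m32 hN0.
move: (x m1) (x m2) (x m3) => x1 x2 x3 hx1 hx2 hx3 H2 hN2 m21 m32 hN0.
have rneq (u v : {ratfun k}) : (rdeg u < rdeg v)%N -> v != u.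
  by move=> h; apply/eqP => e; move: h; rewrite e ltnn.
have x12 : x1 != x2 by rewrite eq_sym; apply: rneq.
have x32 : x3 != x2 by apply: rneq.
have x31 : x3 != x1 by apply: rneq; apply: ltn_trans m32.
have xn2 n : x' n != x2.
  by apply: rneq; apply: ltn_trans m32 _; apply: hN0.
pose z n := cr (x' n) x1 x3 x2.
have dz n : fder (z n) = 0.
  exact: (derivation_cr (@fderB k) (@fderM k) sq (hx _ (nN1 n)) hx1 hx3 hx2 (xn2 n) x31).
pose y n := sval (cid (fder0_expp pk perfect (dz n))).
have zy n : z n = y n ^+ p by rewrite /y; case: cid.
pose a := (x3 - x1) * x2; pose b := - ((x3 - x2) * x1).
pose g := x3 - x1; pose d := - (x3 - x2).
have xz n : g * z n + d != 0 /\ x' n = mob a b g d (z n).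
  exact: (cr_inverse (xn2 n) x12 x31 x32).
have g0 : g != 0 by rewrite subr_eq0.
have D0 : a * d - b * g != 0.
  rewrite /a /b /d /g; apply: (det_neq0 x12 x31 x32).
have ag : a / g = x2 := etrans (mulrC _ _) (mulKf g0 x2).
move: a b g d ag g0 D0 xz => a b g d ag g0 D0 xz.
pose e := (size H).-1.
have sH : (size H <= e.+1)%N by rewrite /e; move: (size H); case.
pose G := hsub e H (lin a b) (lin g d).
have sepG : separable_poly G by apply: (separable_mob j g0 D0 sepH); rewrite ag; exact: H2.
have bx' : bounded x' by have [C hC] := bx; exists C => n; exact: hC.
have bz : bounded z.
  have b1 : bounded (fun n => (x' n - x1) * (x3 - x2)).
    apply: boundedM (bounded_cst _); apply: boundedD bx' _.
    by apply: boundedN; exact: bounded_cst.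
  have b2 : bounded (fun n => (x' n - x2)^-1 * (x3 - x1)^-1).
    apply: boundedM (bounded_cst _).
    by exists C2 => n; have [] := hN2 _ (nN2 n).
  have [C hC] := boundedM b1 b2; exists C => n.
  by rewrite /z /cr invfM; exact: hC.
have by_ : bounded y.
  have [C hC] := bz; exists C => n.
  have := @dle_expp p k pk (y n) C 0; rewrite muln0 subr0; apply.
  by rewrite -zy; exact: hC.
have [C5 hC5] := rdeg_mob a b g d.
have [C7 hC7] := rdeg_mob (x3 - x2) (- ((x3 - x2) * x1)) (x3 - x1) (- ((x3 - x1) * x2)).
have ry n : (rdeg (x' n) <= p * rdeg (y n) + C5)%N.
  rewrite -rdeg_expp -zy; have [h1 ->] := xz n; exact: hC5.
have ry' n : (p * rdeg (y n) <= rdeg (x' n) + C7)%N.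
  rewrite -rdeg_expp -zy /z cr_mobE; apply: hC7.
  rewrite -mulrBr; apply: mulf_neq0; rewrite subr_eq0; [exact: x31 | exact: xn2].
have ty : tends y.
  move=> B; have [n hn] := tx (p * B + C5)%N.
  exists n => m nm; have := hn (m + N)%N (leq_trans nm (leq_addr _ _)).
  move=> h; have := leq_trans h (ry m); rewrite leq_add2r leq_pmul2l //.
have [C8 hC8] : bounded (fun n => (lin g d ^+ e).[z n]) by exact: bounded_horner.
have [C hC] := smx.
(* The height of [z = y ^ p] is [p] times that of [y], up to the bounded change due to the Moebius
   map. The exponent [c] is therefore preserved once [p]-th roots are taken. *)
have smG : exists C : nat, forall n, dle G.[y n ^+ p] (C%:Z - (p * (c * rdeg (y n)))%:Z).
  exists (C8 + C + c * C7)%N => n; rewrite -zy.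
  have [h1 h2] := xz n.
  rewrite /G (hsub_linE a b sH h1) -h2 -horner_lin -horner_exp.
  apply: dleW (dleM (hC8 n) (hC (n + N)%N)).
  have := leq_mul (leqnn c) (ry' n); rewrite mulnDr mulnCA /x'.
  by move: (c * rdeg (x (n + N)))%N (p * (c * rdeg (y n)))%N (c * C7)%N; clear; lia.
have [H' [sepH' H'G smH']] := frob_split pk perfect j sepG by_ smG.
(* A root of [H'] gives a root of [H] by Frobenius followed by the return to the coordinate [x]. The
   Moebius part leaves cross ratios unchanged, and Frobenius raises them to the power [p]. *)
pose rho w := mob (j a) (j b) (j g) (j d) (w ^+ p).
have D0' : j a * j d - j b * j g != 0 by rewrite -!rmorphM -rmorphB fmorph_eq0.
have sHj : (size (map_poly j H) <= e.+1)%N by rewrite size_map_poly.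
have lHj : (map_poly j H)`_e != 0.
  by rewrite coef_map fmorph_eq0 /e -lead_coefE lead_coef_eq0.
have Gj w : root (map_poly j H') w -> (hsub e (map_poly j H) (lin (j a) (j b)) (lin (j g) (j d))).[w ^+ p] = 0.
  move=> rw; rewrite -!map_lin -map_hsub -/G.
  have : map_poly j (map_poly (pFrobenius_aut pK) H') %| map_poly j G by rewrite dvdp_map.
  have -> : map_poly j (map_poly (pFrobenius_aut pK) H') =
            map_poly (pFrobenius_aut pL) (map_poly j H').
    by apply/polyP => i; rewrite !coef_map /= !pFrobenius_autE rmorphXn.
  move=> /dvdpP[Q ->]; rewrite hornerM horner_frob.
  by move: rw => /eqP ->; rewrite expr0n (gtn_eqF p_gt0) mulr0.
have pole w : root (map_poly j H') w -> j g * w ^+ p + j d != 0.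
  by move=> rw; apply: hsub_lin_pole lHj D0' (Gj w rw).
exists H', y, rho; split=> //.
- move=> w rw; rewrite rootE; have := Gj w rw; rewrite (hsub_linE (j a) (j b) sHj (pole w rw)).
  by move=> /eqP; rewrite mulf_eq0 expf_eq0 (negPf (pole w rw)) andbF.
- move=> w1 w2 r1 r2 /(mob_inj D0' (pole w1 r1) (pole w2 r2)).
  exact: expp_inj.
move=> z1 z2 z3 z4 r1 r2 r3 r4 h14 h32.
rewrite /rho cr_mob ?pole //.
- by rewrite -!(pFrobenius_autE pL) -cr_rmorph.
- by apply: contra_neq h14; apply: expp_inj.
- by apply: contra_neq h32; apply: expp_inj.
Qed.

End Step.

(** * Constant cross ratios *)

Section BoundedDegree.
Variables (K L : fieldType) (j : {rmorphism K -> L}).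

(* Subalgebras of [L] containing [K] and spanned over [K] by a family indexed by [T]. *)
Definition finalg (T : finType) (S : L -> Prop) :=
  [/\ forall a, S (j a), forall s t, S s -> S t -> S (s + t),
    forall s t, S s -> S t -> S (s * t) &
    exists b : T -> L, forall s, S s -> exists c : T -> K, s = \sum_i j (c i) * b i].

Lemma finalg_base : finalg unit (fun s => exists a, s = j a).
Proof.
split=> [a|_ _ [a ->] [b ->]|_ _ [a ->] [b ->]|].
- by exists a.
- by exists (a + b); rewrite rmorphD.
- by exists (a * b); rewrite rmorphM.
by exists (fun=> 1) => _ [a ->]; exists (fun=> a); rewrite (big_pred1 tt) ?mulr1 // => -[].
Qed.

(** Division by [H] reduces the powers of [z] to the first [deg H] ones, so the dimension is
    multiplied by at most [deg H], whether or not [H] is irreducible. *)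
Lemma finalg_adjoin T S (H : {poly K}) (z : L) : finalg T S -> H != 0 ->
  root (map_poly j H) z ->
  exists S', [/\ finalg (T * 'I_(size H).-1)%type S', forall s, S s -> S' s & S' z].
Proof.
move=> [Sj SD SM [b hb]] H0 rz; set e := (size H).-1.
have S0 : S 0 by rewrite -(rmorph0 j); exact: Sj.
have S1 : S 1 by rewrite -(rmorph1 j); exact: Sj.
have Ssum (I : Type) (r : seq I) (P : pred I) (F : I -> L) :
    (forall i, S (F i)) -> S (\sum_(i <- r | P i) F i).
  by move=> h; apply: big_ind.
exists (fun s => exists f : {poly L}, (forall i, S f`_i) /\ s = f.[z]); split; last 2 first.
- move=> s Ss; exists s%:P; rewrite hornerC; split=> // i.
  by rewrite coefC; case: eqP.
- exists 'X; rewrite hornerX; split=> // i; rewrite coefX.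
  by case: eqP.
have jz m : exists c : 'I_e -> K, z ^+ m = \sum_(i < e) j (c i) * z ^+ i.
  exists (fun i => ('X^m %% H)`_i).
  have sm : (size (map_poly j ('X^m %% H)) <= e)%N.
    by rewrite size_map_poly /e; have := ltn_modp 'X^m H; rewrite H0; case: (size H).
  have -> : z ^+ m = (map_poly j ('X^m %% H)).[z].
    have := congr1 (fun q => (map_poly j q).[z]) (divp_eq 'X^m H).
    rewrite map_polyXn hornerXn => ->; rewrite rmorphD rmorphM /= hornerD hornerM.
    by move/eqP: rz => ->; rewrite mulr0 add0r.
  rewrite (horner_coef_wide _ sm); apply: eq_bigr => i _.
  by rewrite coef_map.
split.
- move=> a; exists (j a)%:P; rewrite hornerC; split=> // i.
  by rewrite coefC; case: eqP.
- move=> _ _ [f [hf ->]] [g [hg ->]]; exists (f + g); rewrite hornerD; split=> // i.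
  by rewrite coefD; apply: SD.
- move=> _ _ [f [hf ->]] [g [hg ->]]; exists (f * g); rewrite hornerM; split=> // i.
  by rewrite coefM; apply: Ssum => m; apply: SM.
exists (fun ti : T * 'I_e => b ti.1 * z ^+ ti.2) => _ [f [hf ->]].
pose c m := sval (cid (jz m)).
have cE m : z ^+ m = \sum_(i < e) j (c m i) * z ^+ i by rewrite /c; case: cid.
pose s i := \sum_(m < size f) f`_m * j (c m i).
have Ss i : S (s i) by apply: Ssum => m; apply: SM.
pose d i := sval (cid (hb _ (Ss i))).
have dE i : s i = \sum_t j (d i t) * b t by rewrite /d; case: cid.
exists (fun ti => d ti.2 ti.1).
transitivity (\sum_(i < e) s i * z ^+ i).
  rewrite horner_coef; under eq_bigr => m _ do rewrite cE mulr_sumr.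
  rewrite exchange_big; apply: eq_bigr => i _; rewrite mulr_suml.
  by apply: eq_bigr => m _; rewrite mulrA.
rewrite -(pair_bigA _ (fun t i => j (d i t) * (b t * z ^+ i))) exchange_big /=.
apply: eq_bigr => i _; rewrite dE mulr_suml.
by apply: eq_bigr => t _; rewrite mulrA.
Qed.

(** The [N + 1] products [u ^ i v ^ (N - i)] are dependent in a space of dimension [N]; division by
    [v ^ N] gives an equation for [u / v]. Thus [v] need not be inverted inside [S]. *)
Lemma finalg_quotient T S (u v : L) : finalg T S -> S u -> S v -> v != 0 ->
  exists Q : {poly K}, [/\ Q != 0, (size Q <= #|T|.+1)%N & root (map_poly j Q) (u / v)].
Proof.
move=> [Sj SD SM [b hb]] Su Sv v0; set N := #|T|.
have SX s n : S s -> S (s ^+ n).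
  move=> Ss; elim: n => [|n IH]; first by rewrite expr0 -(rmorph1 j); exact: Sj.
  by rewrite exprS; apply: SM.
pose w (i : 'I_N.+1) := u ^+ i * v ^+ (N - i).
have Sw i : S (w i) by apply: SM; apply: SX.
pose c i := sval (cid (hb _ (Sw i))).
have cE i : w i = \sum_t j (c i t) * b t by rewrite /c; case: cid.
pose C := \matrix_(i < N.+1, t < N) c i (enum_val t).
have : kermx C != 0.
  by rewrite -mxrank_eq0 mxrank_ker -lt0n subn_gt0 ltnS rank_leq_col.
case/rowV0Pn => r /sub_kermxP rC r0.
exists (rVpoly r); split; last 2 first.
- exact: size_poly.
- rewrite rootE; apply/eqP; apply: (mulfI (expf_neq0 N v0)); rewrite mulr0.
  rewrite (horner_coef_wide (n := N.+1)); last by rewrite size_map_poly size_poly.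
  transitivity (\sum_(i < N.+1) j (r 0 i) * w i).
    rewrite mulr_sumr; apply: eq_bigr => i _.
    rewrite coef_map coef_rVpoly_ord /w expr_div_n.
    have -> : v ^+ N = v ^+ (N - i) * v ^+ i by rewrite -exprD subnK // -ltnS.
    have := expf_neq0 i v0; move: (v ^+ (N - i)) (v ^+ i) (u ^+ i) => V W U W0.
    by rewrite mulrCA; congr (_ * _); field.
  transitivity (\sum_t (\sum_(i < N.+1) j (r 0 i * c i t)) * b t).
    under eq_bigr => i _ do rewrite cE mulr_sumr.
    rewrite exchange_big; apply: eq_bigr => t _; rewrite mulr_suml.
    by apply: eq_bigr => i _; rewrite rmorphM mulrA.
  apply: big1 => t _; rewrite -rmorph_sum.
  have := congr1 (fun A : 'rV_N => A 0 (enum_rank t)) rC; rewrite !mxE => h.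
  rewrite (_ : \sum_i _ = 0) ?rmorph0 ?mul0r // -[RHS]h.
  by apply: eq_bigr => i _; rewrite mxE enum_rankK.
by apply: contraNneq r0 => h; rewrite -[r]rVpolyK h linear0.
Qed.

(** Numerator and denominator lie in the algebra generated by four roots, which has dimension at
    most [(deg H) ^ 4]. *)
Lemma cr_bounded_degree (H : {poly K}) (z1 z2 z3 z4 : L) : H != 0 ->
  root (map_poly j H) z1 -> root (map_poly j H) z2 ->
  root (map_poly j H) z3 -> root (map_poly j H) z4 -> z1 != z4 -> z3 != z2 ->
  exists Q : {poly K}, [/\ Q != 0, (size Q <= ((size H).-1 ^ 4).+1)%N &
    root (map_poly j Q) (cr z1 z2 z3 z4)].
Proof.
move=> H0 r1 r2 r3 r4 h14 h32.
have [S1 [F1 _ s1]] := finalg_adjoin finalg_base H0 r1.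
have [S2 [F2 i2 s2]] := finalg_adjoin F1 H0 r2.
have [S3 [F3 i3 s3]] := finalg_adjoin F2 H0 r3.
have [S4 [F4 i4 s4]] := finalg_adjoin F3 H0 r4.
have [Sj SD SM _] := F4.
have SB a b : S4 a -> S4 b -> S4 (a - b).
  by move=> Sa Sb; apply: SD => //; rewrite -mulN1r -(rmorphN1 j); apply: SM.
have t1 : S4 z1 by apply/i4/i3/i2.
have t2 : S4 z2 by apply/i4/i3.
have t3 : S4 z3 by apply/i4.
have Su : S4 ((z1 - z2) * (z3 - z4)) by apply: SM; apply: SB.
have Sv : S4 ((z1 - z4) * (z3 - z2)) by apply: SM; apply: SB.
have v0 : (z1 - z4) * (z3 - z2) != 0 by rewrite mulf_neq0 ?subr_eq0.
have [Q [Q0 sQ rQ]] := finalg_quotient F4 Su Sv v0.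
exists Q; split=> //; move: sQ; rewrite !card_prod card_unit !card_ord.
by rewrite mul1n !expnS expn0 muln1 !mulnA.
Qed.

End BoundedDegree.

Lemma closed_root_in_image (k : closedFieldType) (L : fieldType) (f : {rmorphism k -> L})
  (Q : {poly k}) w : Q != 0 -> root (map_poly f Q) w -> exists a, w = f a.
Proof.
move=> Q0; have [rs ->] := closed_field_poly_normal Q.
rewrite map_polyZ rootZ ?fmorph_eq0 ?lead_coef_eq0 // rmorph_prod /=.
under eq_bigr => a _ do rewrite rmorphB /= map_polyX map_polyC /=.
by rewrite -(big_map f predT (fun a => 'X - a%:P)) root_prod_XsubC => /mapP[a _ ->]; exists a.
Qed.

Section PthRoots.
Variables (p : nat) (K : fieldType) (L : closedFieldType) (j : {rmorphism K -> L}).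
Hypotheses (pK : p \in [pchar K]) (pL : p \in [pchar L]).

Let p_gt0 : (0 < p)%N := prime_gt0 (pcharf_prime pK).

(* The minimal polynomials over [K] of the iterated [p]-th roots of [z] have
   nondecreasing degree; once it is constant, each is a Frobenius twist of the next. *)
Lemma bounded_degree_divisible (z : L) (B : nat) :
  (forall R : nat, exists r w, [/\ (R <= r)%N, w ^+ (p ^ r) = z &
     exists Q : {poly K}, [/\ Q != 0, (size Q <= B)%N & root (map_poly j Q) w]]) ->
  exists r w (P : {poly K}), [/\ w ^+ (p ^ r) = z, P != 0, root (map_poly j P) w &
    forall i s, exists y, P`_i = y ^+ (p ^ s)].
Proof.
move=> hz.
have exroot r : exists w : L, w ^+ (p ^ r) = z by apply: ex_proot; rewrite expn_gt0 p_gt0.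
pose w r := sval (cid (exroot r)).
have wE r : w r ^+ (p ^ r) = z by rewrite /w; case: cid.
have Xinj r : injective (fun x : L => x ^+ (p ^ r)).
  elim: r => [|r IH] x y /=; first by rewrite expn0 !expr1.
  by rewrite expnS !exprM => /IH /(expp_inj pL).
(* Roots of order [p ^ r] are unique in characteristic [p], so the chosen ones are compatible. *)
have wS r : w r.+1 ^+ p = w r.
  by apply: (@Xinj r); rewrite -exprM -expnS !wE.
pose kills r Q := Q != 0 /\ root (map_poly j Q) (w r).
have twist r (Q : {poly K}) : root (map_poly j Q) (w r.+1) ->
    root (map_poly j (map_poly (pFrobenius_aut pK) Q)) (w r).
  move=> rQ; have -> : map_poly j (map_poly (pFrobenius_aut pK) Q) =
      map_poly (pFrobenius_aut pL) (map_poly j Q).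
    by apply/polyP => i; rewrite !coef_map /= !pFrobenius_autE rmorphXn.
  rewrite rootE -wS horner_frob.
  by move: rQ => /eqP ->; rewrite expr0n (gtn_eqF p_gt0).
have mono s r Q : kills (r + s)%N Q -> exists Q', kills r Q' /\ size Q' = size Q.
  elim: s r Q => [|s IH] r Q; first by rewrite addn0; exists Q.
  rewrite addnS => -[Q0 /twist rQ].
  have [|Q' [h1 h2]] := IH r (map_poly (pFrobenius_aut pK) Q).
    by split; rewrite ?map_poly_eq0.
  by exists Q'; split=> //; rewrite h2 size_map_poly.
have hB r : exists n, (n <= B)%N && `[< exists Q, kills r Q /\ size Q = n >].
  have [r' [v [rr' vE [Q [Q0 sQ rQ]]]]] := hz r.
  have vw : v = w r' by apply: (@Xinj r'); rewrite wE.
  have [|Q' [h1 h2]] := @mono (r' - r)%N r Q; first by rewrite subnKC //; split=> //; rewrite -vw.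
  exists (size Q'); rewrite h2 sQ /=; apply/asboolP; exists Q'; split=> //.
pose e r := ex_minn (hB r).
have eP r : [/\ (e r <= B)%N, exists Q, kills r Q /\ size Q = e r &
    forall Q, kills r Q -> (size Q <= B)%N -> (e r <= size Q)%N].
  rewrite /e; case: ex_minnP => m /andP[h1 /asboolP h2] h3; split=> // Q kQ sQ.
  by apply: h3; rewrite sQ /=; apply/asboolP; exists Q.
(* The minimal degrees are bounded by [B]; from a level where they are maximal on, they no longer
   change. *)
have [r0 hr0] : exists r0, forall r, (e r <= e r0)%N.
  have exm : exists n, `[< exists r, e r = n >] by exists (e 0%N); apply/asboolP; exists 0%N.
  have ubm n : `[< exists r, e r = n >] -> (n <= B)%N.
    by move=> /asboolP[r <-]; have [] := eP r.
  have := ex_maxnP exm ubm => -[m /asboolP[r0 r0m] hm].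
  by exists r0 => r; rewrite r0m; apply: hm; apply/asboolP; exists r.
have [eB [Q0 [[Q00 rQ0] sQ0]] emin] := eP r0.
have l0 : lead_coef Q0 != 0 by rewrite lead_coef_eq0.
pose P := (lead_coef Q0)^-1 *: Q0.
have Pm : P \is monic by rewrite monicE lead_coefZ mulVf.
have sP : size P = e r0 by rewrite size_scale ?invr_eq0.
have rP : root (map_poly j P) (w r0).
  by rewrite map_polyZ rootZ // fmorph_eq0 invr_eq0.
have uniqP (P' : {poly K}) : P' \is monic -> size P' = e r0 ->
    root (map_poly j P') (w r0) -> P' = P.
  move=> P'm sP' rP'; apply/eqP; rewrite -subr_eq0; apply: contraTT isT => d0.
  have sd : (size (P' - P)%R < e r0)%N.
    have e0 : (0 < e r0)%N by rewrite -sP size_poly_gt0 monic_neq0.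
    rewrite -(prednK e0) ltnS; apply/leq_sizeP => i; rewrite leq_eqVlt => /orP[/eqP <-|h].
      rewrite coefB -{1}sP' -{1}sP -!lead_coefE (eqP P'm : lead_coef P' = 1).
      by rewrite (eqP Pm : lead_coef P = 1) subrr.
    by rewrite coefB !nth_default ?subrr // ?sP ?sP'; move: h e0; lia.
  have kd : kills r0 (P' - P).
    by split=> //; rewrite rmorphB rootE hornerD hornerN (eqP rP) (eqP rP') subrr.
  have := emin _ kd (leq_trans (ltnW sd) eB).
  by rewrite leqNgt sd.
(* A minimal polynomial at level [r0 + s], twisted [s] times by Frobenius, kills [w r0] and has the
   minimal degree; once monic, it equals [P]. *)
have Ppow s : exists P' : {poly K}, P = map_poly (fun x => x ^+ (p ^ s)) P'.
  have mono' t r (Q : {poly K}) : root (map_poly j Q) (w (r + t)%N) ->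
      root (map_poly j (map_poly (fun x => x ^+ (p ^ t)) Q)) (w r).
    elim: t r Q => [|t IH] r Q.
      by rewrite addn0 expn0 (eq_map_poly (g := id)) ?map_poly_id // => x; rewrite expr1.
    have pt0 u : (0 : K) ^+ (p ^ u) = 0 by rewrite expr0n expn_eq0 (gtn_eqF p_gt0).
    rewrite addnS => /twist /IH; congr (root (map_poly j _) _).
    apply/polyP => i; rewrite !coef_map_id0 ?rmorph0 //= pFrobenius_autE.
    by rewrite -exprM -expnS.
  have [eB' [Q1 [[Q10 rQ1] sQ1]] emin'] := eP (r0 + s)%N.
  have l1 : lead_coef Q1 != 0 by rewrite lead_coef_eq0.
  have pw0 : (0 : K) ^+ (p ^ s) = 0 by rewrite expr0n expn_eq0 (gtn_eqF p_gt0).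
  have [Q' [[Q'0 rQ'] sQ']] := mono s r0 Q1 (conj Q10 rQ1).
  have e1 : e (r0 + s)%N = e r0.
    apply/eqP; rewrite eqn_leq hr0 /= -sQ1 -sQ'; apply: emin; first by split.
    by rewrite sQ' sQ1.
  exists ((lead_coef Q1)^-1 *: Q1); apply/esym; apply: uniqP.
  - rewrite monicE lead_coef_map_id0 //; first by rewrite lead_coefZ mulVf ?expr1n.
    by rewrite lead_coefZ mulVf // expr1n oner_eq0.
  - by rewrite size_map_poly_id0 ?size_scale ?invr_eq0 ?sQ1 // lead_coefZ mulVf // expr1n oner_eq0.
  by apply: mono'; rewrite map_polyZ rootZ // fmorph_eq0 invr_eq0.
exists r0, (w r0), P; split=> //; first exact: monic_neq0.
move=> i s; have [P' ->] := Ppow s; exists P'`_i.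
by rewrite coef_map_id0 // expr0n expn_eq0 (gtn_eqF p_gt0).
Qed.

End PthRoots.

Section Constants.
Variables (p : nat) (k : closedFieldType).
Hypothesis pk : p \in [pchar k].
Variables (L : closedFieldType) (j : {rmorphism {ratfun k} -> L}).

Let pK : p \in [pchar {ratfun k}] := pchar_ratfun pk.
Let pL : p \in [pchar L] := rmorph_pchar j pK.
Let p_pr : prime p := pcharf_prime pk.
Let p_gt0 : (0 < p)%N := prime_gt0 p_pr.

(** The height of [x] is a multiple of every [p ^ s]. The choice [s = rdeg x] already forces it to
    be 0, because [p ^ n > n]. *)
Lemma divisible_constant (x : {ratfun k}) :
  (forall s, exists y, x = y ^+ (p ^ s)) -> exists a : k, x = (a%:P)%:F.
Proof.
move=> hx.
have rX s (y : {ratfun k}) : rdeg (y ^+ (p ^ s)) = (p ^ s * rdeg y)%N.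
  elim: s y => [|s IH] y; first by rewrite expn0 expr1 mul1n.
  by rewrite expnS exprM IH rdeg_expp mulnCA mulnA.
have r0 : rdeg x = 0%N.
  have [y yE] := hx (rdeg x); move: (rX (rdeg x) y); rewrite -yE => e.
  have [y0|ry] := posnP (rdeg y); first by rewrite e y0 muln0.
  have := ltn_expl (rdeg x) (prime_gt1 p_pr).
  by rewrite {1}e ltnNge leq_pmulr.
move: r0; rewrite /rdeg /pdeg => /eqP; rewrite -leqn0 geq_max !leqn0 => /andP[/eqP s1 /eqP s2].
have c1 : rnum x = ((rnum x)`_0)%:P by apply: size1_polyC; move: s1; case: (size _) => // -[].
have c2 : rden x = ((rden x)`_0)%:P by apply: size1_polyC; move: s2; case: (size _) => // -[].
have d0 := rden_neq0 x.
have e0 : (rden x)`_0 != 0 by apply: contraNneq d0 => h; rewrite c2 h.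
exists ((rnum x)`_0 / (rden x)`_0).
apply: (mulIf (_ : (rden x)%:F != 0)); first by rewrite tofrac_eq0.
rewrite {1}[x]ratfunE divfK ?tofrac_eq0 // -tofracM c1 c2 -!polyCM !coefC eqxx.
by rewrite divfK.
Qed.

(** Some [p ^ r]-th root of [z] is killed by a polynomial whose coefficients are infinitely
    [p]-divisible, hence in [k]. As [k] is algebraically closed, that root is constant, and so is
    [z]. *)
Lemma bounded_degree_constant (z : L) (B : nat) :
  (forall R : nat, exists r w, [/\ (R <= r)%N, w ^+ (p ^ r) = z &
     exists Q : {poly {ratfun k}}, [/\ Q != 0, (size Q <= B)%N & root (map_poly j Q) w]]) ->
  exists a : k, z = constants j a.
Proof.
move=> hz; have [r [w [P [wE P0 rP hP]]]] := bounded_degree_divisible pK pL hz.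
have Pc i : exists a : k, P`_i = (a%:P)%:F by exact: divisible_constant (hP i).
pose R := \poly_(i < size P) sval (cid (Pc i)).
have RE : map_poly (constants j) R = map_poly j P.
  apply/polyP => i; rewrite !coef_map coef_poly; case: ltnP => h.
    by rewrite /constants /=; case: cid => a /= ->.
  by rewrite nth_default // !rmorph0.
have R0 : R != 0.
  by rewrite -(map_poly_eq0 (constants j)) RE map_poly_eq0; exact: P0.
have rR : root (map_poly (constants j) R) w by rewrite RE.
have [a aE] := closed_root_in_image R0 rR.
by exists (a ^+ (p ^ r)); rewrite rmorphXn -aE wE.
Qed.

(** Iteration of [frobenius_step]. Injectivity on roots keeps the degree from growing, so the
    inequality between [c] and the degree persists with the same [c]. *)
Lemma frobenius_tower c (P : {poly {ratfun k}}) x : (3 <= c)%N -> (size P + 2 <= c + c)%N ->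
  approx c P x -> forall r, exists H y (rho : L -> L),
  [/\ approx c H y, (size H <= size P)%N,
    forall z, root (map_poly j H) z -> root (map_poly j P) (rho z),
    forall z w, root (map_poly j H) z -> root (map_poly j H) w -> rho z = rho w -> z = w &
    forall z1 z2 z3 z4, root (map_poly j H) z1 -> root (map_poly j H) z2 ->
      root (map_poly j H) z3 -> root (map_poly j H) z4 -> z1 != z4 -> z3 != z2 ->
      cr (rho z1) (rho z2) (rho z3) (rho z4) = cr z1 z2 z3 z4 ^+ (p ^ r)].
Proof.
move=> c3 sP aP; elim=> [|r [H [y [rho [aH sH h1 h2 h3]]]]].
  by exists P, x, id; split=> // *; rewrite expn0 expr1.
have perfect (a : k) : exists b, b ^+ p = a by apply: ex_proot.
have sHc : (size H + 2 <= c + c)%N by apply: leq_trans sP; rewrite leq_add2r.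
have [H' [y' [rho' [aH' h1' h2' h3']]]] := frobenius_step pk perfect j c3 sHc aH.
exists H', y', (rho \o rho'); split=> //.
- apply: leq_trans sH.
  have [sep' _ _ _] := aH'; have [sep _ _ _] := aH.
  have [|rs [urs + rrs]] := @closed_roots L (map_poly j H); first by rewrite separable_map.
  have [|rs' [urs' + rrs']] := @closed_roots L (map_poly j H'); first by rewrite separable_map.
  rewrite !size_map_poly => -> ->; rewrite ltnS -(size_map rho'); apply: uniq_leq_size.
    rewrite map_inj_in_uniq // => z w; rewrite -!rrs'; exact: h2'.
  by move=> _ /mapP[z zr ->]; rewrite -rrs; apply: h1'; rewrite rrs'.
- by move=> z /h1' /h1.
- by move=> z w rz rw /= /h2 e; apply: h2' => //; apply: e; apply: h1'.
move=> z1 z2 z3 z4 r1 r2 r3 r4 h14 h32 /=.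
rewrite h3 ?h1' //; first by rewrite h3' // -exprM expnS.
- by apply: contra_neq h14; apply: h2'.
- by apply: contra_neq h32; apply: h2'.
Qed.

Lemma infinite_pigeonhole (T : finType) (f : nat -> T) :
  exists A, forall R : nat, exists r, (R <= r)%N /\ f r = A.
Proof.
apply: contrapT => /forallNP h.
have hb A : exists R : nat, forall r, (R <= r)%N -> f r <> A.
  apply: contrapT => /forallNP h'; apply: (h A) => R.
  apply: contrapT => h''; apply: (h' R) => r Rr fr; apply: h''; by exists r.
pose b A := sval (cid (hb A)).
have bE A : forall r, (b A <= r)%N -> f r <> A by rewrite /b; case: cid.
exact: (bE (f (\max_A b A)) (\max_A b A) (leq_bigmax (f (\max_A b A)))).
Qed.

(* The cross ratios of the surviving roots are [p ^ r]-th powers of elements of bounded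
   degree for every [r], and therefore constant. *)
Lemma constant_roots c (P : {poly {ratfun k}}) x :
  (3 <= c)%N -> (size P + 2 <= c + c)%N -> approx c P x ->
  exists F : seq L, [/\ uniq F, (c <= size F)%N, all (root (map_poly j P)) F &
    forall z1 z2 z3 z4, z1 \in F -> z2 \in F -> z3 \in F -> z4 \in F ->
      z1 != z4 -> z3 != z2 -> exists a : k, cr z1 z2 z3 z4 = constants j a].
Proof.
move=> c3 sP aP; have tower := frobenius_tower c3 sP aP.
have [sepP _ _ _] := aP.
have [|rs [urs srs rrs]] := @closed_roots L (map_poly j P); first by rewrite separable_map.
(* What survives at level [r] is recorded as a subset of the fixed index set of the roots of [P], so
   that the pigeonhole principle can select one subset that serves for infinitely many [r]. *)
have level r : exists A : {set 'I_(size rs)}, (c <= #|A|)%N /\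
    forall z1 z2 z3 z4, z1 \in A -> z2 \in A -> z3 \in A -> z4 \in A ->
      z1 != z4 -> z3 != z2 -> exists w, w ^+ (p ^ r) = cr rs`_z1 rs`_z2 rs`_z3 rs`_z4 /\
      exists Q : {poly {ratfun k}}, [/\ Q != 0, (size Q <= ((size P).-1 ^ 4).+1)%N &
        root (map_poly j Q) w].
  have [H [y [rho [[sepH tH bH smH] sH h1 h2 h3]]]] := tower r.
  have H0 := separable_poly_neq0 sepH.
  have [|rs' [urs' srs' rrs']] := @closed_roots L (map_poly j H); first by rewrite separable_map.
  exists (finset (fun i : 'I_(size rs) => rs`_i \in map rho rs')); split.
    have cs : (c <= size rs')%N.
      by have := small_size H0 tH bH smH; rewrite -(size_map_poly j) srs' ltnS.
    apply: leq_trans cs _; rewrite -(size_map rho).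
    have um : uniq (map rho rs').
      by rewrite map_inj_in_uniq // => z w; rewrite -!rrs'; exact: h2.
    rewrite cardE -(size_map (fun i : 'I_(size rs) => rs`_i)).
    apply: uniq_leq_size um _ => z zm.
    have zr : z \in rs by case/mapP: zm => u ur ->; rewrite -rrs; apply: h1; rewrite rrs'.
    have iz : (index z rs < size rs)%N by rewrite index_mem.
    apply/mapP; exists (Ordinal iz); last by rewrite /= nth_index.
    by rewrite mem_enum inE /= nth_index.
  move=> i1 i2 i3 i4; rewrite !inE.
  move=> /mapP[z1 r1 e1] /mapP[z2 r2 e2] /mapP[z3 r3 e3] /mapP[z4 r4 e4] h14 h32.
  rewrite -!rrs' in r1 r2 r3 r4.
  have n14 : z1 != z4.
    by apply: contra_neq h14 => h; apply/ord_inj/eqP; rewrite -(nth_uniq 0 (ltn_ord i1) (ltn_ord i4) urs) e1 e4 h.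
  have n32 : z3 != z2.
    by apply: contra_neq h32 => h; apply/ord_inj/eqP; rewrite -(nth_uniq 0 (ltn_ord i3) (ltn_ord i2) urs) e3 e2 h.
  exists (cr z1 z2 z3 z4); split; first by rewrite e1 e2 e3 e4 h3.
  have [Q [Q0 sQ rQ]] := cr_bounded_degree H0 r1 r2 r3 r4 n14 n32.
  exists Q; split=> //; apply: leq_trans sQ _; rewrite ltnS leq_exp2r //.
  by move: sH; move: (size H) (size P); clear; lia.
pose A r := sval (cid (level r)).
have AE r : (c <= #|A r|)%N /\
    forall z1 z2 z3 z4, z1 \in A r -> z2 \in A r -> z3 \in A r -> z4 \in A r ->
      z1 != z4 -> z3 != z2 -> exists w, w ^+ (p ^ r) = cr rs`_z1 rs`_z2 rs`_z3 rs`_z4 /\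
      exists Q : {poly {ratfun k}}, [/\ Q != 0, (size Q <= ((size P).-1 ^ 4).+1)%N &
        root (map_poly j Q) w] by rewrite /A; case: cid.
have [A0 hA0] := infinite_pigeonhole A.
exists [seq rs`_(i : 'I_(size rs)) | i <- enum A0]; split.
- rewrite map_inj_in_uniq ?enum_uniq // => i i' _ _ /eqP.
  by rewrite nth_uniq // => /eqP; exact: val_inj.
- have [r [_ rA]] := hA0 0%N; have [h _] := AE r.
  by rewrite size_map -cardE -rA.
- by apply/allP => _ /mapP[i _ ->]; rewrite rrs mem_nth.
move=> _ _ _ _ /mapP[i1 r1 ->] /mapP[i2 r2 ->] /mapP[i3 r3 ->] /mapP[i4 r4 ->] h14 h32.
apply: (@bounded_degree_constant _ ((size P).-1 ^ 4).+1) => R.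
have [r [Rr rA]] := hA0 R; have [_ h] := AE r; rewrite rA in h.
rewrite !mem_enum in r1 r2 r3 r4.
have [||w [wE [Q hQ]]] := h i1 i2 i3 i4 r1 r2 r3 r4.
- by apply: contra_neq h14 => ->.
- by apply: contra_neq h32 => ->.
by exists r, w; split=> //; exists Q.
Qed.

End Constants.

(** * Forms and maps in homogeneous coordinates *)

Section Plane.
Variable F : fieldType.
Implicit Types (u v w : F * F) (s t : F).

Record mat := Mat { m11 : F; m12 : F; m21 : F; m22 : F }.
Implicit Types M N : mat.

Definition act M v : F * F := (m11 M * v.1 + m12 M * v.2, m21 M * v.1 + m22 M * v.2).
Definition mdet M := m11 M * m22 M - m12 M * m21 M.
Definition madj M := Mat (m22 M) (- m12 M) (- m21 M) (m11 M).
Definition mmul M N := Mat (m11 M * m11 N + m12 M * m21 N) (m11 M * m12 N + m12 M * m22 N)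
  (m21 M * m11 N + m22 M * m21 N) (m21 M * m12 N + m22 M * m22 N).
Definition vscale s v : F * F := (s * v.1, s * v.2).

Definition wedge v w := v.1 * w.2 - v.2 * w.1.

Lemma vec_eq v w : v.1 = w.1 -> v.2 = w.2 -> v = w.
Proof. by case: v w => [v1 v2] [w1 w2] /= -> ->. Qed.

Lemma act_mmul M N v : act (mmul M N) v = act M (act N v).
Proof. by apply: vec_eq => /=; ring. Qed.

Lemma mdet_mmul M N : mdet (mmul M N) = mdet M * mdet N.
Proof. by rewrite /mdet /=; ring. Qed.

Lemma mdet_madj M : mdet (madj M) = mdet M.
Proof. by rewrite /mdet /=; ring. Qed.

Lemma act_adjK M v : act M (act (madj M) v) = vscale (mdet M) v.
Proof. by apply: vec_eq; rewrite /mdet /=; ring. Qed.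

Lemma adj_actK M v : act (madj M) (act M v) = vscale (mdet M) v.
Proof. by apply: vec_eq; rewrite /mdet /=; ring. Qed.

Lemma act_scale M s v : act M (vscale s v) = vscale s (act M v).
Proof. by apply: vec_eq => /=; ring. Qed.

Lemma vscaleA s t v : vscale s (vscale t v) = vscale (s * t) v.
Proof. by apply: vec_eq => /=; ring. Qed.

Lemma vscale1 v : vscale 1 v = v.
Proof. by apply: vec_eq => /=; rewrite mul1r. Qed.

Lemma vscale_eq0 s v : s != 0 -> vscale s v = (0, 0) -> v = (0, 0).
Proof.
move=> s0 [/eqP h1 /eqP h2]; move: h1 h2; rewrite !mulf_eq0 (negPf s0) /= => /eqP h1 /eqP h2.
exact: vec_eq.
Qed.

Lemma act_eq0 M v : mdet M != 0 -> act M v = (0, 0) -> v = (0, 0).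
Proof.
move=> D0 h; apply: (vscale_eq0 D0); rewrite -adj_actK h.
by apply: vec_eq => /=; rewrite !mulr0 addr0.
Qed.

Lemma wedge_scalel s v w : wedge (vscale s v) w = s * wedge v w.
Proof. by rewrite /wedge /=; ring. Qed.

Lemma wedge_scaler s v w : wedge v (vscale s w) = s * wedge v w.
Proof. by rewrite /wedge /=; ring. Qed.

Lemma wedge_eq0 v w : v <> (0, 0) -> wedge v w = 0 -> exists s, w = vscale s v.
Proof.
move=> v0 /eqP; rewrite subr_eq0 => /eqP h.
have [x0|x0] := eqVneq v.1 0; last first.
  exists (w.1 / v.1); apply: vec_eq => /=; first by rewrite divfK.
  by apply: (mulfI x0); rewrite h; field.
have y0 : v.2 != 0 by apply/eqP => y0; apply: v0; apply: vec_eq.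
exists (w.2 / v.2); apply: vec_eq => /=; last by rewrite divfK.
by apply: (mulfI y0); rewrite -h; field.
Qed.

(* The homogeneous lift of [A / B]. *)
Definition fm d (A B : {poly F}) v : F * F := (hev d A v.1 v.2, hev d B v.1 v.2).

Lemma fm_scale d A B s v : fm d A B (vscale s v) = vscale (s ^+ d) (fm d A B v).
Proof. by apply: vec_eq; rewrite /= hevZ. Qed.

Lemma hev_lin n (A : {poly F}) a b c e x y : (size A <= n.+1)%N ->
  hev n (hsub n A (lin a b) (lin c e)) x y = hev n A (a * x + b * y) (c * x + e * y).
Proof.
move=> sA; have [sG cG] := hsub_lin n A a b c e.
have [->|y0] := eqVneq y 0.
  have [q ->] := hev_mod n (hsub n A (lin a b) (lin c e)) x 0.
  by rewrite cG mul0r addr0 !mulr0 !addr0 ![_ * x]mulrC hevZ mulrC.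
rewrite hev_horner // horner_hsub !horner_lin -hevZ.
by congr hev; field.
Qed.

Lemma fm_lin d (A B : {poly F}) M : (size A <= d.+1)%N -> (size B <= d.+1)%N ->
  exists A' B' : {poly F}, [/\ (size A' <= d.+1)%N, (size B' <= d.+1)%N &
    forall v, fm d A' B' v = fm d A B (act M v)].
Proof.
move=> sA sB; exists (hsub d A (lin (m11 M) (m12 M)) (lin (m21 M) (m22 M))).
exists (hsub d B (lin (m11 M) (m12 M)) (lin (m21 M) (m22 M))); split.
- by have [] := hsub_lin d A (m11 M) (m12 M) (m21 M) (m22 M).
- by have [] := hsub_lin d B (m11 M) (m12 M) (m21 M) (m22 M).
by move=> v; apply: vec_eq; rewrite /= hev_lin.
Qed.

Lemma hevD n (A B : {poly F}) x y : hev n (A + B) x y = hev n A x y + hev n B x y.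
Proof. by rewrite /hev -big_split; apply: eq_bigr => i _; rewrite coefD /=; ring. Qed.

Lemma hevZl n (a : F) (A : {poly F}) x y : hev n (a *: A) x y = a * hev n A x y.
Proof. by rewrite /hev mulr_sumr; apply: eq_bigr => i _; rewrite coefZ; ring. Qed.

Lemma fm_act d (A B : {poly F}) M v :
  act M (fm d A B v) = fm d (m11 M *: A + m12 M *: B) (m21 M *: A + m22 M *: B) v.
Proof. by apply: vec_eq; rewrite /= hevD !hevZl. Qed.

(** [hevx] and [hevy] are the partial derivatives of the form in its two variables. *)
Definition hevx n (A : {poly F}) x y := \sum_(i < n.+1) A`_i * (x ^+ i.-1 *+ i) * y ^+ (n - i).
Definition hevy n (A : {poly F}) x y := \sum_(i < n.+1) A`_i * x ^+ i * (y ^+ (n - i).-1 *+ (n - i)).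

(** The chain rule along the line [v + t w]: partial derivatives become the derivative of a
    polynomial in [t], which behaves well under substitution. *)
Lemma deriv_hsub n (A : {poly F}) v w :
  (hsub n A (lin w.1 v.1) (lin w.2 v.2))^`().[0] =
  w.1 * hevx n A v.1 v.2 + w.2 * hevy n A v.1 v.2.
Proof.
rewrite /hsub /hev raddf_sum horner_sum /hevx /hevy !mulr_sumr -big_split /=.
apply: eq_bigr => i _; rewrite coef_map /= -mulrA mul_polyC derivZ derivM !deriv_exp.
have dl a b : (lin a b)^`() = a%:P.
  by rewrite /lin derivD derivZ derivX derivC addr0 alg_polyC.
rewrite !dl hornerZ hornerD !hornerM !hornerMn !hornerM !horner_exp !horner_lin !hornerC.
rewrite !mulr0 !add0r.
move: (v.1 ^+ i.-1) (v.1 ^+ i) (v.2 ^+ (n - i)) (v.2 ^+ (n - i).-1) A`_i => X X' Y Y' a.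
by move: (nat_of_ord i) (n - i)%N => m1 m2; ring.
Qed.

(* Zero for all [w] exactly when [v] is a critical point of [A / B]. *)
Definition wdiff d (A B : {poly F}) v w :=
  (w.1 * hevx d A v.1 v.2 + w.2 * hevy d A v.1 v.2) * hev d B v.1 v.2 -
  (w.1 * hevx d B v.1 v.2 + w.2 * hevy d B v.1 v.2) * hev d A v.1 v.2.

End Plane.

(** If the difference [R] vanishes everywhere, [R + 1] has no root, hence is constant over a closed
    field. *)
Lemma poly_fun_inj (L : closedFieldType) (P Q : {poly L}) : (forall x, P.[x] = Q.[x]) -> P = Q.
Proof.
move=> h; apply/eqP; rewrite -subr_eq0; set R := P - Q.
have R0 x : R.[x] = 0 by rewrite /R hornerD hornerN h subrr.
have [s1|s1] := eqVneq (size (R + 1)) 1%N; last first.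
  have /closed_rootP[x] := s1.
  by rewrite rootE hornerD R0 hornerC add0r oner_eq0.
have RE : R = ((R + 1)`_0 - 1)%:P.
  have e : R + 1 = ((R + 1)`_0)%:P by apply: size1_polyC; rewrite s1.
  by rewrite polyCB -e addrK.
by have := R0 0; rewrite RE hornerC => ->.
Qed.

(** * Wronskians and critical points *)

Section Wronskian.
Variable F : fieldType.
Implicit Types (A B : {poly F}) (v w : F * F) (M N : mat F).

Definition pwronsk A B := A^`() * B - A * B^`().

Lemma euler n A x y : x * hevx n A x y + y * hevy n A x y = hev n A x y *+ n.
Proof.
rewrite /hevx /hevy /hev !mulr_sumr -big_split -sumrMnl /=; apply: eq_bigr => i _.
have li : (i <= n)%N by rewrite -ltnS.
have ex (z : F) m : z * (z ^+ m.-1 *+ m) = z ^+ m *+ m.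
  by case: m => [|m]; rewrite ?mulr0n ?mulr0 // mulrnAr -exprS.
have -> : x * (A`_i * (x ^+ i.-1 *+ i) * y ^+ (n - i)) = A`_i * x ^+ i * y ^+ (n - i) *+ i.
  by rewrite mulrA mulrCA ex mulrnAr mulrnAl.
have -> : y * (A`_i * x ^+ i * (y ^+ (n - i).-1 *+ (n - i))) =
    A`_i * x ^+ i * y ^+ (n - i) *+ (n - i).
  by rewrite mulrCA ex mulrnAr.
by rewrite -mulrnDr subnKC.
Qed.

Lemma hevx_1 n A c : (size A <= n.+1)%N -> hevx n A c 1 = A^`().[c].
Proof.
move=> sA; rewrite (horner_coef_wide (n := n)); last first.
  by apply: leq_trans (size_poly _ _) _; move: sA; case: (size A).
rewrite /hevx big_ord_recl mulr0n mulr0 mul0r add0r; apply: eq_bigr => i _.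
by rewrite coef_deriv expr1n mulr1 mulrnAr mulrnAl.
Qed.

(** Euler's relation eliminates the partial derivatives in [y]. The terms with the factor [d]
    cancel, so the characteristic may divide [d]. *)
Lemma wdiff_affine d A B c w : (size A <= d.+1)%N -> (size B <= d.+1)%N ->
  wdiff d A B (c, 1) w = (w.1 - c * w.2) * (pwronsk A B).[c].
Proof.
move=> sA sB; rewrite /wdiff /pwronsk /=.
have hy (P : {poly F}) : (size P <= d.+1)%N -> hevy d P c 1 = P.[c] *+ d - c * P^`().[c].
  by move=> sP; rewrite -(hev_x1 _ sP) -euler hevx_1 // mul1r addrC addKr.
rewrite !hy // !hevx_1 // !hev_x1 // hornerD hornerN !hornerM.
move: A.[c] B.[c] A^`().[c] B^`().[c] => a b a' b'; ring.
Qed.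

End Wronskian.

Section Transfer.
Variable L : closedFieldType.
Implicit Types (A B : {poly L}) (v w : L * L) (M N : mat L).

(** Covariance under linear maps at the source and at the target: restricted to a line, the two
    lifts agree as polynomials in the parameter and can be differentiated. *)
Lemma wdiff_transfer d1 d2 A1 B1 A2 B2 M N :
  (forall v, fm d2 A2 B2 (act M v) = act N (fm d1 A1 B1 v)) ->
  forall v w, wdiff d2 A2 B2 (act M v) (act M w) = mdet N * wdiff d1 A1 B1 v w.
Proof.
move=> h v w.
pose E n (A : {poly L}) (v w : L * L) := hsub n A (lin w.1 v.1) (lin w.2 v.2).
have EE n A v' w' t : (E n A v' w').[t] = hev n A (w'.1 * t + v'.1) (w'.2 * t + v'.2).
  by rewrite horner_hsub !horner_lin.
have hE t : act M (w.1 * t + v.1, w.2 * t + v.2) =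
    ((act M w).1 * t + (act M v).1, (act M w).2 * t + (act M v).2).
  by apply: vec_eq => /=; ring.
have e1 : E d2 A2 (act M v) (act M w) = m11 N *: E d1 A1 v w + m12 N *: E d1 B1 v w.
  apply: poly_fun_inj => t; rewrite hornerD !hornerZ !EE.
  by have := h (w.1 * t + v.1, w.2 * t + v.2); rewrite hE => -[].
have e2 : E d2 B2 (act M v) (act M w) = m21 N *: E d1 A1 v w + m22 N *: E d1 B1 v w.
  apply: poly_fun_inj => t; rewrite hornerD !hornerZ !EE.
  by have := h (w.1 * t + v.1, w.2 * t + v.2); rewrite hE => -[].
have [h1 h2] := h v.
rewrite /wdiff -!deriv_hsub -/(E d2 A2 _ _) -/(E d2 B2 _ _) -/(E d1 A1 _ _) -/(E d1 B1 _ _).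
rewrite e1 e2; move: (E d1 A1 v w) (E d1 B1 v w) => EA EB.
rewrite !derivD !derivZ !hornerD !hornerZ; move: h1 h2; rewrite /= => -> ->; rewrite /mdet.
move: EA^`().[0] EB^`().[0] (hev d1 A1 _ _) (hev d1 B1 _ _) => a' b' a b.
by ring.
Qed.

Lemma wdiff_scale d A B s v w :
  wdiff d A B (vscale s v) (vscale s w) = s ^+ d * s ^+ d * wdiff d A B v w.
Proof.
have sE (t : L) u : act (Mat t 0 0 t) u = vscale t u by apply: vec_eq => /=; ring.
rewrite -!sE (@wdiff_transfer d d A B A B _ (Mat (s ^+ d) 0 0 (s ^+ d))).
  by rewrite /mdet /= mulr0 subr0.
by move=> u; rewrite !sE fm_scale.
Qed.

Lemma wdiff_affine_eq0 d A B v : (size A <= d.+1)%N -> (size B <= d.+1)%N -> v.2 != 0 ->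
  (pwronsk A B).[v.1 / v.2] = 0 <-> (forall w, wdiff d A B v w = 0).
Proof.
move=> sA sB y0.
have vE : v = vscale v.2 (v.1 / v.2, 1) by apply: vec_eq => /=; rewrite ?mulr1 // mulrCA divff ?mulr1.
have wE w : wdiff d A B v w = v.2 ^+ d * v.2 ^+ d *
    ((w.1 / v.2 - v.1 / v.2 * (w.2 / v.2)) * (pwronsk A B).[v.1 / v.2]).
  rewrite -(wdiff_affine (v.1 / v.2) (w.1 / v.2, w.2 / v.2) sA sB) -wdiff_scale -vE.
  by congr wdiff; apply: vec_eq => /=; rewrite mulrCA divff ?mulr1.
split=> [h w|h]; first by rewrite wE h !mulr0.
have := h (v.2, 0); rewrite wE /= mul0r mulr0 subr0 divff // mul1r => /eqP.
by rewrite !mulf_eq0 !expf_eq0 (negPf y0) !andbF /= => /eqP.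
Qed.

(** Separability of a map is independent of coordinates. The comparison misses only the points that
    [M] sends to infinity, the zeros of the nonzero linear factor [lin (m21 M) (m22 M)]. *)
Lemma pwronsk_transfer d A1 B1 A2 B2 M N :
  (size A1 <= d.+1)%N -> (size B1 <= d.+1)%N -> (size A2 <= d.+1)%N -> (size B2 <= d.+1)%N ->
  (forall v, fm d A2 B2 (act M v) = act N (fm d A1 B1 v)) ->
  mdet M != 0 -> mdet N != 0 -> pwronsk A1 B1 != 0 -> pwronsk A2 B2 != 0.
Proof.
move=> s1 s2 s3 s4 h M0 N0; apply: contraNneq => W2.
have W1 : pwronsk A1 B1 * lin (m21 M) (m22 M) = 0.
  apply: poly_fun_inj => c; rewrite hornerM horner_lin horner0.
  have [->|u0] := eqVneq (m21 M * c + m22 M) 0; first by rewrite mulr0.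
  have u2 : (act M (c, 1)).2 != 0 by rewrite /= mulr1.
  have [h1 _] := wdiff_affine_eq0 s3 s4 u2.
  have := wdiff_transfer h (c, 1) (1, 0); rewrite h1 ?W2 ?horner0 // wdiff_affine //=.
  by rewrite mulr0 subr0 mul1r => /esym/eqP; rewrite mulf_eq0 (negPf N0) => /eqP ->; rewrite mul0r.
move/eqP: W1; rewrite mulf_eq0 => /orP[//|/eqP l0].
have e2 : m22 M = 0 by have := horner_lin (m21 M) (m22 M) 0; rewrite l0 horner0 mulr0 add0r.
have e1 : m21 M = 0.
  by have := horner_lin (m21 M) (m22 M) 1; rewrite l0 horner0 e2 mulr1 addr0.
by move: M0; rewrite /mdet e1 e2 !mulr0 subrr eqxx.
Qed.

(* If the Wronskian is constant, the only zero of its homogenization, of degree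
   [2 d - 2], is at infinity; this is seen in the coordinate [1 / z]. *)
Lemma critical_exists d A B : (2 <= d)%N -> (size A <= d.+1)%N -> (size B <= d.+1)%N ->
  exists v, v <> (0, 0) /\ forall w, wdiff d A B v w = 0.
Proof.
move=> d2 sA sB.
have [s1|s1] := eqVneq (size (pwronsk A B)) 1%N; last first.
  have /closed_rootP[c /eqP rc] := s1; exists (c, 1); split.
    by case=> _ /eqP; rewrite oner_eq0.
  by apply/wdiff_affine_eq0 => //=; rewrite ?oner_neq0 // divr1.
have WE : pwronsk A B = ((pwronsk A B)`_0)%:P by apply: size1_polyC; rewrite s1.
set w0 := (pwronsk A B)`_0 in WE.
pose M : mat L := Mat 0 1 1 0.
have [A' [B' [sA' sB' h]]] := fm_lin M sA sB.
have h' v : fm d A B (act M v) = act (Mat 1 0 0 1) (fm d A' B' v).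
  by rewrite -h; apply: vec_eq => /=; ring.
have W'E : pwronsk A' B' * 'X ^+ 1 = - w0 *: 'X^(d + d - 2) * 'X ^+ 1.
  apply: poly_fun_inj => c; rewrite !hornerM hornerZ !hornerXn.
  have [->|c0] := eqVneq c 0; first by rewrite expr1 !mulr0.
  congr (_ * _).
  have := wdiff_transfer h' (c, 1) (1, 0).
  rewrite (wdiff_affine _ _ sA' sB') /mdet /= !mulr0 !mulr1 !subr0 !mul1r => <-.
  have -> : act M (c, 1) = vscale c (c^-1, 1) by apply: vec_eq; rewrite /= ?mulr1; field.
  have -> : act M (1, 0) = vscale c (0, c^-1) by apply: vec_eq; rewrite /=; field.
  rewrite wdiff_scale wdiff_affine // WE hornerC /= sub0r -exprD.
  have -> : c ^+ (d + d) = c ^+ (d + d - 2) * c ^+ 2 by rewrite -exprD subnK //; lia.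
  by field.
have {}W'E : pwronsk A' B' = - w0 *: 'X^(d + d - 2).
  by apply: (mulIf _ W'E); rewrite expf_neq0 // polyX_eq0.
exists (1, 0); split; first by case=> /eqP; rewrite oner_eq0.
move=> w.
have -> : (1, 0) = act M (0, 1) by apply: vec_eq => /=; ring.
have -> : w = act M (w.2, w.1) by apply: vec_eq => /=; ring.
rewrite (wdiff_transfer h') wdiff_affine // W'E hornerZ hornerXn expr0n.
by rewrite subn_eq0 leqNgt (_ : 2 < d + d)%N ?mulr0 //; lia.
Qed.

End Transfer.

Lemma hev0 (R : comNzRingType) n (x y : R) : hev n 0 x y = 0.
Proof. by rewrite /hev big1 // => i _; rewrite coef0 !mul0r. Qed.

Lemma form_root (L : closedFieldType) d (A : {poly L}) : (0 < d)%N -> (size A <= d.+1)%N ->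
  exists v, v <> (0, 0) /\ hev d A v.1 v.2 = 0.
Proof.
move=> d0 sA; have [Ad|Ad] := eqVneq A`_d 0.
  by exists (1, 0); rewrite hev_10; split=> // -[/eqP]; rewrite oner_eq0.
have sE : size A = d.+1.
  apply/eqP; rewrite eqn_leq sA ltnNge; apply: contraNN Ad => h.
  by rewrite nth_default.
have /closed_rootP[c rc] : size A != 1%N by rewrite sE eqSS -lt0n.
exists (c, 1); rewrite hev_x1 //; split; last exact/eqP.
by case=> _ /eqP; rewrite oner_eq0.
Qed.

(** * Coordinates over which a map becomes constant *)

Section Chain.
Variables (k L : closedFieldType) (iota : {rmorphism k -> L}).
Implicit Types (A B : {poly L}) (v w : L * L) (M N : mat L) (mu : nat -> mat L).

(* [v] is a point of [P^1(k)]. *)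
Definition cst v := exists a b : k, ((a != 0) || (b != 0)) /\ wedge v (iota a, iota b) = 0.

(* Read in the coordinates [M'] at the source and [M] at the target, [A / B] is defined
   over [k]. *)
Definition link d A B M M' := exists (C D : {poly k}) s,
  [/\ (size C <= d.+1)%N, (size D <= d.+1)%N, s != 0 &
   forall v, fm d (map_poly iota C) (map_poly iota D) (act M' v) = vscale s (act M (fm d A B v))].

Definition chain d A B mu := exists m0, forall m, (m0 <= m)%N ->
  mdet (mu m) != 0 /\ link d A B (mu m) (mu m.+1).

(* In the coordinates [mu m], the point [v] is constant for large [m]. *)
Definition ecst mu v := exists m0, forall m, (m0 <= m)%N -> cst (act (mu m) v).

(** The nonzero Wronskian says that the map is separable. *)
Definition good d A B := [/\ (size A <= d.+1)%N, (size B <= d.+1)%N,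
  forall v, fm d A B v = (0, 0) -> v = (0, 0) & pwronsk A B != 0].

(* [A / B] is conjugate to a map defined over [k]. *)
Definition iso d A B := exists M (C D : {poly k}) s,
  [/\ mdet M != 0, (size C <= d.+1)%N, (size D <= d.+1)%N, s != 0 &
   forall v, fm d A B (act M v) = vscale s (act M (fm d (map_poly iota C) (map_poly iota D) v))].

Lemma scale_cst s v : cst v -> cst (vscale s v).
Proof.
by move=> [a [b [ab h]]]; exists a, b; split; rewrite ?wedge_scalel ?h ?mulr0.
Qed.

Lemma cst_y0 v : v.2 = 0 -> cst v.
Proof.
move=> y0; exists 1, 0; split; first by rewrite oner_eq0.
by rewrite /wedge /= y0 rmorph0 rmorph1 mulr0 mul0r subrr.
Qed.

Lemma cst_affine (c : k) y : cst (iota c * y, y).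
Proof.
exists c, 1; split; first by rewrite oner_eq0 orbT.
by rewrite /wedge /= rmorph1 mulr1 mulrC subrr.
Qed.

Lemma act_surj M v : mdet M != 0 -> exists w, v = act M w.
Proof.
move=> M0; exists (vscale (mdet M)^-1 (act (madj M) v)).
by rewrite act_scale act_adjK vscaleA mulVf // vscale1.
Qed.

Lemma root_cst (f : {poly k}) v : f != 0 -> v.2 != 0 ->
  root (map_poly iota f) (v.1 / v.2) -> cst v.
Proof.
move=> f0 y0 /(closed_root_in_image f0)[c cE].
have -> : v = (iota c * v.2, v.2) by apply: vec_eq; rewrite //= -cE divfK.
exact: cst_affine.
Qed.

(* Preimages of constant points are roots of a form defined over [k]. *)
Lemma link_preimage d A B M M' v : (0 < d)%N -> good d A B -> mdet M != 0 -> mdet M' != 0 ->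
  link d A B M M' -> cst (act M (fm d A B v)) -> cst (act M' v).
Proof.
move=> d0 [sA sB nd _] M0 M'0 [C [D [s [sC sD s0 h]]]] [a [b [ab hab]]].
pose f := b *: C - a *: D.
have fE u : hev d (map_poly iota f) u.1 u.2 =
    wedge (fm d (map_poly iota C) (map_poly iota D) u) (iota a, iota b).
  rewrite /f rmorphB /= !map_polyZ /= hevD -scaleN1r !hevZl /wedge /=.
  by rewrite mulrC mulN1r [iota a * _]mulrC.
have sf : (size (map_poly iota f) <= d.+1)%N.
  rewrite size_map_poly (leq_trans (size_polyD _ _)) // size_polyN geq_max.
  by rewrite !(leq_trans (size_scale_leq _ _)).
(* If [f = 0], the map takes the single value [(a : b)] in these coordinates; a zero of one suitable
   component is then a zero of both, against the absence of common zeros. *)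
have f0 : f != 0.
  apply/eqP => f0.
  have par u : wedge (act M (fm d A B u)) (iota a, iota b) = 0.
    have := fE (act M' u); rewrite f0 rmorph0 h wedge_scalel hev0 => /esym/eqP.
    by rewrite mulf_eq0 (negPf s0) /= => /eqP.
  have [z [z0 zE]] : exists z, z <> (0, 0) /\ act M (fm d A B z) = (0, 0).
    have hM : exists P Q : {poly L}, [/\ (size P <= d.+1)%N, (size Q <= d.+1)%N &
        forall u, act M (fm d A B u) = fm d P Q u].
      exists (m11 M *: A + m12 M *: B), (m21 M *: A + m22 M *: B).
      split; last by move=> u; exact: fm_act.
        by rewrite (leq_trans (size_polyD _ _)) // geq_max !(leq_trans (size_scale_leq _ _)).
      by rewrite (leq_trans (size_polyD _ _)) // geq_max !(leq_trans (size_scale_leq _ _)).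
    have [P [Q [sP sQ PQ]]] := hM.
    have [a0|a0] := eqVneq a 0.
      have b0 : iota b != 0 by move: ab; rewrite a0 eqxx fmorph_eq0.
      have [z [z0 zQ]] := form_root d0 sQ; exists z; split=> //.
      have := par z; rewrite PQ /wedge /= a0 rmorph0 mulr0 subr0 => /eqP.
      by rewrite mulf_eq0 (negPf b0) orbF => /eqP hP; apply: vec_eq.
    have ia0 : iota a != 0 by rewrite fmorph_eq0.
    have [z [z0 zP]] := form_root d0 sP; exists z; split=> //.
    have := par z; rewrite PQ /wedge /= zP mul0r sub0r => /eqP.
    by rewrite oppr_eq0 mulf_eq0 (negPf ia0) orbF => /eqP hQ; apply: vec_eq.
  by apply: z0; apply: nd; apply: act_eq0 zE.
have [y0|y0] := eqVneq (act M' v).2 0; first exact: cst_y0.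
apply: (root_cst f0 y0); rewrite rootE.
have := fE (act M' v); rewrite h wedge_scalel hab mulr0 hev_horner // => /eqP.
by rewrite mulf_eq0 expf_eq0 (negPf y0) andbF.
Qed.

Lemma fm_link d A B M M' v s C D :
  fm d (map_poly iota C) (map_poly iota D) (act M' v) = vscale s (act M (fm d A B v)) ->
  fm d (map_poly iota C) (map_poly iota D) (act M' v) =
  act (mmul (Mat s 0 0 s) M) (fm d A B v).
Proof. by move=> ->; rewrite act_mmul; apply: vec_eq => /=; ring. Qed.

Lemma map_pwronsk (C D : {poly k}) :
  map_poly iota (pwronsk C D) = pwronsk (map_poly iota C) (map_poly iota D).
Proof. by rewrite /pwronsk rmorphB !rmorphM /= !deriv_map. Qed.

(* Critical points are roots of a Wronskian defined over [k]. *)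
Lemma link_critical d A B M M' v : good d A B -> mdet M != 0 -> mdet M' != 0 ->
  link d A B M M' -> (forall w, wdiff d A B v w = 0) -> cst (act M' v).
Proof.
move=> [sA sB nd W0] M0 M'0 [C [D [s [sC sD s0 h]]]] hv.
have hN u := fm_link (h u).
have N0 : mdet (mmul (Mat s 0 0 s) M) != 0.
  by rewrite mdet_mmul mulf_neq0 // /mdet /= mulr0 subr0 mulf_neq0.
have [y0|y0] := eqVneq (act M' v).2 0; first exact: cst_y0.
have sC' : (size (map_poly iota C) <= d.+1)%N by rewrite size_map_poly.
have sD' : (size (map_poly iota D) <= d.+1)%N by rewrite size_map_poly.
have [_ hW] := wdiff_affine_eq0 sC' sD' y0.
apply: (@root_cst (pwronsk C D) _ _ y0); last first.
  rewrite map_pwronsk rootE; apply/eqP; apply: hW => w.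
  have [w' ->] := act_surj w M'0.
  by rewrite (wdiff_transfer hN) hv mulr0.
by rewrite -(map_poly_eq0 iota) map_pwronsk; apply: pwronsk_transfer hN M'0 N0 W0.
Qed.

Lemma chain_preimage d A B mu v : (0 < d)%N -> good d A B -> chain d A B mu ->
  ecst mu (fm d A B v) -> ecst mu v.
Proof.
move=> d0 g [m0 hm] [m1 h1]; exists (maxn m0 m1).+1 => -[//|m].
rewrite ltnS geq_max => /andP[h2 h3].
have [M0 lk] := hm m h2; have [M'0 _] := hm m.+1 (leqW h2).
exact: (link_preimage d0 g M0 M'0 lk (h1 m h3)).
Qed.

Lemma chain_critical d A B mu v : good d A B -> chain d A B mu ->
  (forall w, wdiff d A B v w = 0) -> ecst mu v.
Proof.
move=> g [m0 hm] hv; exists m0.+1 => -[//|m]; rewrite ltnS => h2.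
have [M0 lk] := hm m h2; have [M'0 _] := hm m.+1 (leqW h2).
exact: (link_critical g M0 M'0 lk hv).
Qed.

(** A fixed change of coordinates over [L] is absorbed on the right of every [mu m]. The adjugate
    stands for the inverse, at the price of the scalar [mdet N]. *)
Lemma chain_conj d A B mu N : mdet N != 0 -> good d A B -> chain d A B mu ->
  exists A' B', [/\ good d A' B', chain d A' B' (fun m => mmul (mu m) N),
    forall v, fm d A' B' v = act (madj N) (fm d A B (act N v)) & iso d A' B' -> iso d A B].
Proof.
move=> N0 [sA sB nd W0] [m0 hm].
have [A1 [B1 [sA1 sB1 h1]]] := fm_lin N sA sB.
exists (m11 (madj N) *: A1 + m12 (madj N) *: B1), (m21 (madj N) *: A1 + m22 (madj N) *: B1).
set A' := (X in good d X _); set B' := (X in good d _ X).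
have sA' : (size A' <= d.+1)%N.
  by rewrite (leq_trans (size_polyD _ _)) // geq_max !(leq_trans (size_scale_leq _ _)).
have sB' : (size B' <= d.+1)%N.
  by rewrite (leq_trans (size_polyD _ _)) // geq_max !(leq_trans (size_scale_leq _ _)).
have hv v : fm d A' B' v = act (madj N) (fm d A B (act N v)).
  by rewrite -fm_act h1.
have adj0 : mdet (madj N) != 0 by rewrite mdet_madj.
have hN v : act N (fm d A' B' v) = vscale (mdet N) (fm d A B (act N v)).
  by rewrite hv act_adjK.
split=> //.
- split=> //.
    move=> v h; apply: (act_eq0 N0); apply: nd; apply: (act_eq0 adj0).
    by rewrite -hv.
  have hM v : fm d A' B' (act (madj N) v) =
      act (mmul (madj N) (Mat (mdet N ^+ d) 0 0 (mdet N ^+ d))) (fm d A B v).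
    rewrite hv act_adjK fm_scale act_mmul; congr act.
    by apply: vec_eq => /=; ring.
  apply: pwronsk_transfer hM _ _ W0 => //.
  rewrite mdet_mmul mulf_neq0 // /mdet /= mulr0 subr0.
  by rewrite mulf_neq0 // expf_neq0.
- exists m0 => m hm0; have [M0 [C [D [s [sC sD s0 h]]]]] := hm m hm0.
  split; first by rewrite mdet_mmul mulf_neq0.
  exists C, D, (s / mdet N); split=> //; first by rewrite mulf_neq0 ?invr_eq0.
  by move=> v; rewrite !act_mmul h hN act_scale vscaleA divfK.
move=> [M [C [D [s [M0 sC sD s0 h]]]]].
exists (mmul N M), C, D, (s / mdet N); split=> //.
- by rewrite mdet_mmul mulf_neq0.
- by rewrite mulf_neq0 ?invr_eq0.
move=> v; rewrite !act_mmul.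
have := hN (act M v); rewrite h act_scale => e.
have -> : fm d A B (act N (act M v)) =
    vscale (mdet N)^-1 (vscale (mdet N) (fm d A B (act N (act M v)))).
  by rewrite vscaleA mulVf // vscale1.
by rewrite -e vscaleA mulrC.
Qed.

End Chain.

Section ThreePoints.
Variables (k L : closedFieldType) (iota : {rmorphism k -> L}).
Implicit Types (A B : {poly L}) (v w : L * L) (mu : nat -> mat L).

Definition map_mat (N : mat k) : mat L :=
  Mat (iota (m11 N)) (iota (m12 N)) (iota (m21 N)) (iota (m22 N)).

Lemma mdet_map_mat N : mdet (map_mat N) = iota (mdet N).
Proof. by rewrite /mdet /= rmorphB !rmorphM. Qed.

Lemma cst_col (x y : L) : (x, y) <> (0, 0) -> cst iota (x, y) ->
  exists s a b, [/\ s != 0, (a != 0) || (b != 0), x = s * iota a & y = s * iota b].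
Proof.
move=> v0 [a [b [ab h]]].
have ab0 : (iota a, iota b) <> (0, 0).
  by case=> /eqP + /eqP; rewrite !fmorph_eq0 => /eqP a0 /eqP b0; rewrite a0 b0 eqxx in ab.
have h' : wedge (iota a, iota b) (x, y) = 0.
  by rewrite -[RHS]oppr0 -h /wedge /=; ring.
have [s [e1 e2]] := wedge_eq0 ab0 h'.
exists s, a, b; split=> //; apply/eqP => s0; apply: v0.
by rewrite e1 e2 s0 !mul0r.
Qed.

(** A projectivity is determined by the images of infinity, 0 and 1. If these are constant it lies
    in [PGL_2(k)], and [q] is the projective scalar. *)
Lemma const_matrix (P : mat L) : mdet P != 0 -> cst iota (act P (1, 0)) ->
  cst iota (act P (0, 1)) -> cst iota (act P (1, 1)) ->
  exists q N, [/\ q != 0, mdet N != 0 & forall v, act P v = vscale q (act (map_mat N) v)].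
Proof.
case: P => p11 p12 p21 p22; rewrite /mdet /act /= !mulr1 !mulr0 !addr0 !add0r => D0.
have c10 : (p11, p21) <> (0, 0).
  by case=> h1 h2; move: D0; rewrite h1 h2 mul0r mulr0 subrr eqxx.
have c20 : (p12, p22) <> (0, 0).
  by case=> h1 h2; move: D0; rewrite h1 h2 mul0r mulr0 subrr eqxx.
move=> /(cst_col c10)[p [a1 [a2 [p0 a0 e11 e21]]]].
move=> /(cst_col c20)[q [b1 [b2 [q0 b0 e12 e22]]]] [c1 [c2 [c0 h]]].
pose wac := a1 * c2 - a2 * c1; pose wbc := b1 * c2 - b2 * c1; pose wab := a1 * b2 - a2 * b1.
(* The third point fixes the ratio [p / q] of the two column scalars as an element of [k]. *)
have hw : p * iota wac + q * iota wbc = 0.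
  rewrite -h /wedge /wac /wbc /= e11 e12 e21 e22 !rmorphB !rmorphM /=; ring.
have wab0 : wab != 0.
  apply: contraNneq D0 => wab0; rewrite e11 e12 e21 e22.
  have -> : p * iota a1 * (q * iota b2) - q * iota b1 * (p * iota a2) = p * q * iota wab.
    by rewrite /wab rmorphB !rmorphM /=; ring.
  by rewrite wab0 rmorph0 mulr0.
have wac0 : wac != 0.
  apply: contraNneq wab0 => wac0.
  move/eqP: hw; rewrite wac0 rmorph0 mulr0 add0r mulf_eq0 (negPf q0) fmorph_eq0 /= => /eqP wbc0.
  have e1 : c1 * wab = b1 * wac - a1 * wbc by rewrite /wab /wac /wbc; ring.
  have e2 : c2 * wab = b2 * wac - a2 * wbc by rewrite /wab /wac /wbc; ring.
  rewrite wac0 wbc0 !mulr0 subrr in e1 e2.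
  case/orP: c0 => c0.
    by move/eqP: e1; rewrite mulf_eq0 (negPf c0).
  by move/eqP: e2; rewrite mulf_eq0 (negPf c0).
pose r := - (wbc / wac).
have pE : p = q * iota r.
  have i0 : iota wac != 0 by rewrite fmorph_eq0.
  apply: (mulIf i0); rewrite /r rmorphN fmorph_div mulrN mulNr -mulrA divfK //.
  by apply/eqP; rewrite -addr_eq0 hw.
have r0 : r != 0 by apply: contraNneq p0 => r0; rewrite pE r0 rmorph0 mulr0.
exists q, (Mat (r * a1) b1 (r * a2) b2); split=> //.
  by rewrite /mdet /= -mulrA [b1 * _]mulrCA -mulrBr [b1 * _]mulrC mulf_neq0.
move=> v; apply: vec_eq; rewrite /= ?e11 ?e12 ?e21 ?e22 pE !rmorphM; ring.
Qed.

Lemma fm_map_lin d (C D : {poly k}) (N : mat k) : (size C <= d.+1)%N -> (size D <= d.+1)%N ->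
  exists C' D' : {poly k}, [/\ (size C' <= d.+1)%N, (size D' <= d.+1)%N &
    forall v, fm d (map_poly iota C') (map_poly iota D') v =
              fm d (map_poly iota C) (map_poly iota D) (act (map_mat N) v)].
Proof.
move=> sC sD; exists (hsub d C (lin (m11 N) (m12 N)) (lin (m21 N) (m22 N))).
exists (hsub d D (lin (m11 N) (m12 N)) (lin (m21 N) (m22 N))); split.
- by have [] := hsub_lin d C (m11 N) (m12 N) (m21 N) (m22 N).
- by have [] := hsub_lin d D (m11 N) (m12 N) (m21 N) (m22 N).
by move=> v; apply: vec_eq; rewrite /= map_hsub !map_lin hev_lin // size_map_poly.
Qed.

Lemma fm_map_act d (C D : {poly k}) (N : mat k) : (size C <= d.+1)%N -> (size D <= d.+1)%N ->
  exists C' D' : {poly k}, [/\ (size C' <= d.+1)%N, (size D' <= d.+1)%N &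
    forall v, fm d (map_poly iota C') (map_poly iota D') v =
              act (map_mat N) (fm d (map_poly iota C) (map_poly iota D) v)].
Proof.
move=> sC sD; exists (m11 N *: C + m12 N *: D), (m21 N *: C + m22 N *: D); split.
- by rewrite (leq_trans (size_polyD _ _)) // geq_max !(leq_trans (size_scale_leq _ _)).
- by rewrite (leq_trans (size_polyD _ _)) // geq_max !(leq_trans (size_scale_leq _ _)).
by move=> v; rewrite fm_act /= !rmorphD /= !map_polyZ.
Qed.

(** In the frame [G] of the three points all late coordinates [mu m] lie in [PGL_2(k)], so a single
    link already conjugates the map to one defined over [k]. *)
Lemma three_points d A B mu v1 v2 v3 : good d A B -> chain iota d A B mu ->
  wedge v1 v2 != 0 -> wedge v1 v3 != 0 -> wedge v2 v3 != 0 ->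
  ecst iota mu v1 -> ecst iota mu v2 -> ecst iota mu v3 -> iso iota d A B.
Proof.
move=> g [m0 hm] w12 w13 w23 [m1 h1] [m2 h2] [m3 h3].
(* Cramer's rule: these scalars give [v3 = al v1 + be v2]. *)
pose al := wedge v3 v2 / wedge v1 v2; pose be := wedge v1 v3 / wedge v1 v2.
have al0 : al != 0.
  rewrite mulf_neq0 ?invr_eq0 //.
  have -> : wedge v3 v2 = - wedge v2 v3 by rewrite /wedge; ring.
  by rewrite oppr_eq0.
have be0 : be != 0 by rewrite mulf_neq0 ?invr_eq0.
pose G := Mat (al * v1.1) (be * v2.1) (al * v1.2) (be * v2.2).
have G1 : act G (1, 0) = vscale al v1 by apply: vec_eq => /=; ring.
have G2 : act G (0, 1) = vscale be v2 by apply: vec_eq => /=; ring.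
have G3 : act G (1, 1) = v3.
  by apply: vec_eq; rewrite /= /al /be /wedge; field; exact: w12.
have G0 : mdet G != 0.
  have -> : mdet G = al * be * wedge v1 v2 by rewrite /mdet /wedge /=; ring.
  exact: (mulf_neq0 (mulf_neq0 al0 be0) w12).
pose m := maxn (maxn m0 m1) (maxn m2 m3).
have [l0 l1 l2 l3] : [/\ (m0 <= m)%N, (m1 <= m)%N, (m2 <= m)%N & (m3 <= m)%N].
  by rewrite /m; split; lia.
have PN i : (m <= i)%N -> exists q N, [/\ q != 0, mdet N != 0 &
    forall v, act (mu i) (act G v) = vscale q (act (map_mat N) v)].
  move=> mi; have [M0 _] := hm i (leq_trans l0 mi).
  have [||||q [N [q0 N0 h]]] := @const_matrix (mmul (mu i) G).
  - by rewrite mdet_mmul mulf_neq0.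
  - by rewrite act_mmul G1 act_scale; apply/scale_cst/h1/(leq_trans l1).
  - by rewrite act_mmul G2 act_scale; apply/scale_cst/h2/(leq_trans l2).
  - by rewrite act_mmul G3; apply/h3/(leq_trans l3).
  by exists q, N; split=> // v; rewrite -act_mmul.
have [M0 [C [D [s [sC sD s0 hs]]]]] := hm m l0.
have [q [N [q0 N0 hN]]] := PN m (leqnn m).
have [q' [N' [q'0 N'0 hN']]] := PN m.+1 (leqnSn m).
have [C1 [D1 [sC1 sD1 e1]]] := fm_map_lin N' sC sD.
have [C2 [D2 [sC2 sD2 e2]]] := fm_map_act (madj N) sC1 sD1.
exists G, C2, D2, (q' ^+ d / (s * q * iota (mdet N))); split=> //.
  by rewrite mulf_neq0 ?expf_neq0 // invr_eq0 !mulf_neq0 ?fmorph_eq0.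
move=> v; have N1 : mdet (map_mat N) != 0 by rewrite mdet_map_mat fmorph_eq0.
have adjE : map_mat (madj N) = madj (map_mat N) by rewrite /map_mat /madj /= !rmorphN.
have [u uE] := act_surj (fm d A B (act G v)) G0.
rewrite e2 e1 adjE uE -act_scale; congr act.
have key : vscale (q' ^+ d) (fm d (map_poly iota C) (map_poly iota D) (act (map_mat N') v)) =
    vscale (s * q) (act (map_mat N) u).
  by rewrite -fm_scale -hN' hs uE hN vscaleA.
have c0 : s * q * iota (mdet N) != 0 by rewrite !mulf_neq0 ?fmorph_eq0.
have key2 : vscale (q' ^+ d) (act (madj (map_mat N)) (fm d (map_poly iota C) (map_poly iota D) (act (map_mat N') v))) =
    vscale (s * q * iota (mdet N)) u.
  by rewrite -act_scale key act_scale adj_actK vscaleA mdet_map_mat.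
rewrite mulrC -vscaleA key2 vscaleA mulVf // vscale1 //.
Qed.

End ThreePoints.

(** * Polynomial maps in affine coordinates *)

Section PolynomialChain.
Variables (k L : closedFieldType) (iota : {rmorphism k -> L}).

Definition inK (x : L) := exists a : k, x = iota a.

Lemma inK_root n (x : L) : (0 < n)%N -> inK (x ^+ n) -> inK x.
Proof.
move=> n0 [a xa]; have P0 : 'X^n - a%:P != 0 :> {poly k}.
  by rewrite -size_poly_gt0 size_XnsubC.
apply: (closed_root_in_image (f := iota) P0).
by rewrite rmorphB /= map_polyXn map_polyC rootE !hornerE xa subrr.
Qed.

Lemma inK_div x y : inK x -> inK y -> inK (x / y).
Proof. by move=> [a ->] [b ->]; exists (a / b); rewrite fmorph_div. Qed.

(* The nonconstant coefficients of [A] are polynomials of degree less than [d] in each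
   [b m.+1], and [b m.+1] is a polynomial of degree [d] in [b m.+2]: two consecutive such
   expressions can only agree if the coefficient is in [k] or [b m.+2] is. *)
Lemma translation_chain d (A : {poly L}) (b : nat -> L) (C : nat -> {poly k}) e :
  (0 < e)%N -> A.[0] = 0 ->
  (forall m, size (C m) = d.+1) ->
  (forall m z, (map_poly iota (C m)).[z + b m.+1] = A.[z] + b m) -> inK A`_e.
Proof.
move=> e0 A0 sC h.
have coefA m : A`_e = (map_poly iota (C m)^`N(e)).[b m.+1].
  have PE : A + (b m)%:P = \poly_(i < d.+1) (map_poly iota (C m)^`N(i)).[b m.+1].
    apply: poly_fun_inj => z; rewrite hornerD hornerC -h addrC.
    rewrite (nderiv_taylor _ (mulrC _ _)) size_map_poly sC.
    rewrite horner_poly; apply: eq_bigr => i _.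
    by rewrite nderivn_map.
  have := congr1 (fun q : {poly L} => q`_e) PE.
  rewrite coefD coefC (gtn_eqF e0) addr0 coef_poly => ->; case: ltnP => // de.
  rewrite nderivn_poly0 ?rmorph0 ?horner0 // sC; exact: de.
have bE m : b m = (map_poly iota (C m)).[b m.+1].
  by have := h m 0; rewrite A0 !add0r.
pose g m := (C m)^`N(e).
have [eqg|neg] := eqVneq (g 0%N \Po C 1%N) (g 1%N); last first.
  have d0 : g 0%N \Po C 1%N - g 1%N != 0 by rewrite subr_eq0.
  have [|a aE] := @closed_root_in_image _ _ iota _ (b 2%N) d0.
    rewrite rmorphB /= map_comp_poly rootE hornerD hornerN horner_comp -bE.
    by rewrite -!coefA subrr.
  by exists (g 1%N).[a]; rewrite (coefA 1%N) aE horner_map.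
(* When the two expressions agree and [d > 0], the degree of [g 0] times [d] is that of [g 1], less
   than [d]; so [g 0] is constant. *)
have sg : (size (g 1%N) <= d)%N.
  rewrite /g /nderivn; apply: leq_trans (size_poly _ _) _; rewrite sC.
  by move: e0; clear; lia.
have c0 : (size (g 0%N) <= 1)%N.
  have := size_comp_poly (g 0%N) (C 1%N); rewrite eqg sC /=.
  have [d0|d0] := posnP d.
    by move=> _; rewrite /g /nderivn; apply: leq_trans (size_poly _ _) _; rewrite sC d0 leq_subr.
  move=> s1; move: sg s1 d0; move: (size (g 1%N)) (size (g 0%N)) => s1 s0.
  case: s0 => // -[//|s0] h1 h2 h3; exfalso; move: h1 h2 h3 => /=; clear; nia.
by exists (g 0%N)`_0; rewrite (coefA 0%N) -/(g 0%N) (size1_polyC c0) map_polyC hornerC coefC.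
Qed.

(** Derivatives and leading coefficients show that [a m c / a m.+1] and [a m l / a m.+1 ^ d] lie in
    [k], where [l] is the leading coefficient of [A]. Together they make the [a m] constant up to
    the common factor [u], with [u ^ (d - 1) = 1 / l]. Once [u] is scaled away only translations
    remain, to which [translation_chain] applies. *)
Lemma poly_chain d (A : {poly L}) c (a b : nat -> L) (C : nat -> {poly k}) :
  (2 <= d)%N -> size A = d.+1 -> A^`() = c%:P -> c != 0 ->
  (forall m, a m != 0) ->
  (forall m z, (map_poly iota (C m)).[a m.+1 * z + b m.+1] = a m * A.[z] + b m) ->
  exists u t E, [/\ u != 0, (size (E : {poly k}) <= d.+1)%N &
    forall z, A.[u * z + t] = u * (map_poly iota E).[z] + t].
Proof.
move=> d2 sA A' c0 a0 h.
have d0 : (0 < d.-1)%N by move: d2; clear; lia.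
pose l := lead_coef A.
have A0 : A != 0 by rewrite -size_poly_gt0 sA.
have l0 : l != 0 by rewrite lead_coef_eq0.
have P m : map_poly iota (C m) \Po (a m.+1 *: 'X + (b m.+1)%:P) = a m *: A + (b m)%:P.
  apply: poly_fun_inj => z; rewrite horner_comp !hornerD !hornerZ hornerX !hornerC; exact: h.
have s2 m : size (a m.+1 *: 'X + (b m.+1)%:P) = 2.
  by rewrite size_polyDl size_scale ?size_polyX // size_polyC; case: (b m.+1 != 0).
have sR m : size (a m *: A + (b m)%:P) = d.+1.
  rewrite size_polyDl size_scale ?sA // size_polyC; apply: leq_ltn_trans (leq_b1 _) _.
  by move: d2; clear; lia.
have sC m : size (C m) = d.+1.
  by rewrite -(sR m) -P size_comp_poly2 ?s2 // size_map_poly.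
have K1 m : inK (a m * c / a m.+1).
  exists (C m)^`().[0]; rewrite -horner_map /= rmorph0 -deriv_map.
  have := congr1 (fun q : {poly L} => q^`().[- b m.+1 / a m.+1]) (P m).
  rewrite deriv_comp !derivD !derivZ derivX !derivC !addr0 A' hornerM horner_comp.
  rewrite !hornerD !hornerZ hornerX !hornerC mulr1.
  rewrite [a m.+1 * (_ / _)]mulrC divfK ?a0 // addNr => <-.
  by rewrite mulfK.
have K2 m : inK (a m * l / a m.+1 ^+ d).
  exists (lead_coef (C m)); rewrite -lead_coef_map /=.
  have := congr1 lead_coef (P m); rewrite lead_coef_comp ?s2 // size_map_poly sC /=.
  rewrite !lead_coefDl ?size_scale ?sA ?size_polyX ?size_polyC // ?(leq_ltn_trans (leq_b1 _)) //;
    last by move: d2; clear; lia.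
  rewrite !lead_coefZ lead_coefX mulr1 -/l => <-.
  by rewrite mulfK // expf_neq0.
(* The quotient of the two preceding elements no longer contains [a m]. *)
have K3 m : inK (c * a m.+1 ^+ d.-1 / l).
  have -> : c * a m.+1 ^+ d.-1 / l = (a m * c / a m.+1) / (a m * l / a m.+1 ^+ d).
    have -> : a m.+1 ^+ d = a m.+1 * a m.+1 ^+ d.-1 by rewrite -exprS prednK //; move: d2; clear; lia.
    have := a0 m; have := a0 m.+1; have := expf_neq0 d.-1 (a0 m.+1).
    move: (a m) (a m.+1) (a m.+1 ^+ d.-1) => x y Y Y0 y0 x0.
    by field; rewrite Y0 y0 x0 l0.
  exact: inK_div.
have K4 m : inK (a m.+1 / a m.+2).
  apply: (inK_root d0).
  have -> : (a m.+1 / a m.+2) ^+ d.-1 = (c * a m.+1 ^+ d.-1 / l) / (c * a m.+2 ^+ d.-1 / l).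
    rewrite exprMn exprVn; have := expf_neq0 d.-1 (a0 m.+2).
    move: (a m.+2 ^+ _) (a m.+1 ^+ _) => Y Z Y0.
    by field; rewrite Y0 l0 c0.
  exact: inK_div.
have Kc : inK c.
  have -> : c = (a 1%N * c / a 2%N) / (a 1%N / a 2%N) by field; rewrite !a0.
  exact: inK_div.
have K5 m : inK (a m.+1 ^+ d.-1 / l).
  have -> : a m.+1 ^+ d.-1 / l = (c * a m.+1 ^+ d.-1 / l) / c.
    by rewrite -[c * _ / l]mulrA [c * _]mulrC mulfK.
  exact: inK_div.
have [u uE] := ex_proot l^-1 d0.
have u0 : u != 0.
  apply/eqP => u0; move/eqP: uE; rewrite u0 expr0n (gtn_eqF d0) eq_sym invr_eq0.
  by rewrite (negPf l0).
have K6 m : inK (a m.+1 * u).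
  by apply: (inK_root d0); rewrite exprMn uE.
(* Moving a fixed point to 0 secures the condition [A.[0] = 0] of [translation_chain]. *)
have [t tE] : exists t, A.[t] = t.
  have sAX : size (A - 'X) = d.+1.
    by rewrite size_polyDl ?sA // size_polyN size_polyX.
  have /closed_rootP[t] : size (A - 'X) != 1%N by rewrite sAX; move: d2; clear; lia.
  by rewrite rootE hornerD hornerN hornerX subr_eq0 => /eqP; exists t.
pose A2 := u^-1 *: ((A \Po (u *: 'X + t%:P)) - t%:P).
have A2E z : u * A2.[z] + t = A.[u * z + t].
  rewrite /A2 hornerZ hornerD hornerN horner_comp hornerD hornerZ hornerX !hornerC.
  by rewrite mulVKf // subrK.
have A20 : A2.[0] = 0.
  by apply: (mulfI u0); apply: (addIr t); rewrite A2E !mulr0 !add0r.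
have su : size (u *: 'X + t%:P) = 2.
  by rewrite size_polyDl size_scale ?size_polyX // size_polyC; case: (t != 0).
have sA2 : (size A2 <= d.+1)%N.
  rewrite /A2 size_scale ?invr_eq0 // (leq_trans (size_polyD _ _)) // geq_max.
  rewrite size_comp_poly2 ?su // sA leqnn size_polyN size_polyC.
  by case: (t != 0).
have [al alE] := choice K6.
have al0 m : al m != 0 by rewrite -(fmorph_eq0 iota) -alE mulf_neq0.
have cf e : inK A2`_e.
  case: e => [|e]; first by rewrite -horner_coef0 A20; exists 0; rewrite rmorph0.
  pose C3 m := (al m)^-1 *: (C m.+1 \Po (al m.+1 *: 'X)).
  apply: (@translation_chain d A2 (fun m => (a m.+1 * t + b m.+1) / iota (al m)) C3) => //.
    move=> m; rewrite /C3 size_scale ?invr_eq0 // size_comp_poly2 // size_scale //.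
    by rewrite size_polyX.
  move=> m z; rewrite /C3 map_polyZ /= map_comp_poly map_polyZ /= map_polyX.
  rewrite hornerZ horner_comp hornerZ hornerX fmorphV.
  have i0 i : iota (al i) != 0 by rewrite fmorph_eq0.
  apply: (mulfI (i0 m)); rewrite mulVKf //.
  rewrite mulrDr [iota (al m.+1) * (_ / _)]mulrC divfK // [RHS]mulrDr [iota (al m) * (_ / _)]mulrC divfK //.
  rewrite -!alE -!mulrA addrA -mulrDr h -A2E; ring.
have [ec ecE] := choice cf.
exists u, t, (\poly_(i < d.+1) ec i); split=> //.
move=> z; rewrite -A2E; congr (_ * _.[_] + _).
apply/polyP => i; rewrite coef_map coef_poly /=; case: ltnP => hi; first by rewrite ecE.
by rewrite rmorph0 nth_default // (leq_trans sA2).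
Qed.

End PolynomialChain.

Lemma only_root0 (L : closedFieldType) (P : {poly L}) :
  (forall z, root P z -> z = 0) -> exists a i, P = a *: 'X^i.
Proof.
move=> h; have [->|P0] := eqVneq P 0; first by exists 0, 0%N; rewrite scale0r.
have [r rE] := closed_field_poly_normal P.
exists (lead_coef P), (size r); rewrite {1}rE; congr (_ *: _).
transitivity (\prod_(z <- r) ('X : {poly L})); last by rewrite big_const_seq count_predT iter_mulr_1.
rewrite big_seq [RHS]big_seq; apply: eq_bigr => z zr.
have -> : z = 0; last by rewrite subr0.
apply: h; rewrite rE rootZ ?lead_coef_eq0 // root_prod_XsubC //.
Qed.

Lemma no_root (L : closedFieldType) (P : {poly L}) :
  (forall z, ~~ root P z) -> exists2 a, a != 0 & P = a%:P.
Proof.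
move=> h; have [s1|s1] := eqVneq (size P) 1%N; last first.
  by have /closed_rootP[z] := s1; rewrite (negPf (h z)).
have PE : P = (P`_0)%:P by apply: size1_polyC; rewrite s1.
exists P`_0 => //; by apply/eqP => e; move: s1; rewrite PE e size_poly0.
Qed.

Lemma hevXn (R : comNzRingType) n i (x y : R) : (i <= n)%N ->
  hev n 'X^i x y = x ^+ i * y ^+ (n - i).
Proof.
move=> li; have ho : (i < n.+1)%N by [].
rewrite /hev (bigD1 (Ordinal ho)) //= coefXn eqxx mul1r big1 ?addr0 // => m mi.
rewrite coefXn (_ : (m == i :> nat) = false) ?mul0r ?mul0r //.
by apply/negP => /eqP e; case/negP: mi; apply/eqP/val_inj.
Qed.

Lemma hev_1 (R : comNzRingType) n (x y : R) : hev n 1 x y = y ^+ n.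
Proof.
have -> : (1 : {poly R}) = 'X^0 by rewrite expr0.
by rewrite hevXn // subn0 expr0 mul1r.
Qed.

Section ChainIso.
Variables (k L : closedFieldType) (iota : {rmorphism k -> L}).
Implicit Types (A B : {poly L}) (v w : L * L) (mu : nat -> mat L).

Let e1 : L * L := (1, 0).
Let e2 : L * L := (0, 1).

(** Zeros of [A] and [B] are preimages of the two eventually constant points, hence are 0 or
    infinity. So [A] and [B] are monomials and the map is a multiple of [z ^ d] or [z ^ (- d)]; a
    root of order [d - 1], respectively [d + 1], removes the scalar. *)
Lemma two_points d A B mu : (2 <= d)%N -> good d A B -> chain iota d A B mu ->
  ecst iota mu e1 -> ecst iota mu e2 ->
  (forall v, ecst iota mu v -> v.1 * v.2 = 0) -> iso iota d A B.
Proof.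
move=> d2 g ch h1 h2 hE; have d0 : (0 < d)%N by apply: leq_trans d2.
have [sA sB nd W0] := g.
have hsc v s w : ecst iota mu w -> v = vscale s w -> ecst iota mu v.
  by move=> [m0 h] ->; exists m0 => m hm; rewrite act_scale; apply/scale_cst/h.
have hA v : hev d A v.1 v.2 = 0 -> v.1 * v.2 = 0.
  move=> h; apply: hE; apply: (chain_preimage d0 g ch).
  apply: (hsc _ (hev d B v.1 v.2) _ h2); apply: vec_eq => /=; rewrite ?mulr1 ?mulr0 //.
have hB v : hev d B v.1 v.2 = 0 -> v.1 * v.2 = 0.
  move=> h; apply: hE; apply: (chain_preimage d0 g ch).
  apply: (hsc _ (hev d A v.1 v.2) _ h1); apply: vec_eq => /=; rewrite ?mulr1 ?mulr0 //.
have [al [i AE]] : exists al i, A = al *: 'X^i.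
  apply: only_root0 => z /eqP rz.
  by have := hA (z, 1); rewrite /= hev_x1 // mulr1; apply.
have [be [l BE]] : exists be l, B = be *: 'X^l.
  apply: only_root0 => z /eqP rz.
  by have := hB (z, 1); rewrite /= hev_x1 // mulr1; apply.
have al0 : al != 0.
  by apply: contraNneq W0 => a0; rewrite AE a0 scale0r /pwronsk deriv0 !mul0r subr0.
have be0 : be != 0.
  by apply: contraNneq W0 => a0; rewrite BE a0 scale0r /pwronsk deriv0 !mulr0 subr0.
have li : (i <= d)%N by move: sA; rewrite AE size_scale // size_polyXn ltnS.
have ll : (l <= d)%N by move: sB; rewrite BE size_scale // size_polyXn ltnS.
have fE x y : fm d A B (x, y) = (al * (x ^+ i * y ^+ (d - i)), be * (x ^+ l * y ^+ (d - l))).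
  by rewrite /fm AE BE /= !hevZl !hevXn.
have n1 : (i == 0%N) || (l == 0%N).
  apply/negPn/negP => /norP[i0 l0]; have := nd (0, 1).
  rewrite fE !expr0n (negPf i0) (negPf l0) !mul0r !mulr0 => /(_ erefl)[/eqP].
  by rewrite oner_eq0.
have n2 : (i == d) || (l == d).
  apply/negPn/negP => /norP[i0 l0]; have := nd (1, 0).
  rewrite fE !expr0n !subn_eq0 [(d <= i)%N]leqNgt [(d <= l)%N]leqNgt.
  rewrite !ltn_neqAle i0 l0 li ll /= !mulr0 => /(_ erefl)[/eqP].
  by rewrite oner_eq0.
have [[id l0]|[i0 ld]] : (i = d /\ l = 0%N) \/ (i = 0%N /\ l = d).
- by move: n1 n2 d0 => /orP[]/eqP-> /orP[]/eqP->; rewrite ?ltnn; auto.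
- have d1 : (0 < d.-1)%N by move: d2; clear; lia.
  have [u uE] := ex_proot (be / al) d1.
  have u0 : u != 0.
    apply/eqP => u0; move/eqP: uE; rewrite u0 expr0n (gtn_eqF d1) eq_sym.
    by rewrite mulf_eq0 invr_eq0 (negPf al0) (negPf be0).
  exists (Mat u 0 0 1), 'X^d, 1, be; split=> //.
  - by rewrite /mdet /= mulr1 mulr0 subr0.
  - by rewrite size_polyXn.
  - by rewrite size_poly1.
  case=> x y; rewrite /act /= fE map_polyXn rmorph1 hevXn //.
  rewrite hev_1 id l0 subnn subn0.
  have ud : al * u ^+ d = be * u.
    by rewrite -(prednK d0) exprSr uE mulrA mulrCA mulfV // mulr1.
  apply: vec_eq => /=; rewrite ?expr0 ?mul0r ?addr0 ?add0r ?mulr1 ?mul1r //.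
  by rewrite exprMn [RHS]mulrA -ud mulrA.
have [u uE] := ex_proot (al / be) (ltn0Sn d).
have u0 : u != 0.
  apply/eqP => u0; move/eqP: uE; rewrite u0 expr0n eq_sym /=.
  by rewrite mulf_eq0 invr_eq0 (negPf al0) (negPf be0).
exists (Mat u 0 0 1), 1, 'X^d, (be * u ^+ d); split=> //.
- by rewrite /mdet /= mulr1 mulr0 subr0.
- by rewrite size_poly1.
- by rewrite size_polyXn.
- by rewrite mulf_neq0 // expf_neq0.
case=> x y; rewrite /act /= fE map_polyXn rmorph1 hevXn //.
rewrite hev_1 i0 ld subnn subn0.
have ud : al = be * u ^+ d * u.
  by rewrite -mulrA -exprSr uE mulrCA mulfV // mulr1.
apply: vec_eq => /=; rewrite ?expr0 ?mul0r ?addr0 ?add0r ?mulr1 ?mul1r.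
  by rewrite mulrA -ud.
by rewrite exprMn mulrA.
Qed.

(** Coordinates matter only up to [PGL_2(k)], chosen independently at source and target. *)
Lemma link_map d A B M M' (N N' : mat k) : mdet N' != 0 -> mdet N != 0 -> link iota d A B M M' ->
  link iota d A B (mmul (map_mat iota N) M) (mmul (map_mat iota N') M').
Proof.
move=> N'0 N0 [C [D [s [sC sD s0 h]]]].
have [C1 [D1 [sC1 sD1 h1]]] := fm_map_lin iota (madj N') sC sD.
have [C2 [D2 [sC2 sD2 h2]]] := fm_map_act iota N sC1 sD1.
exists C2, D2, (iota (mdet N') ^+ d * s); split=> //.
  by rewrite mulf_neq0 // expf_neq0 // fmorph_eq0.
have adjE : map_mat iota (madj N') = madj (map_mat iota N').
  by rewrite /map_mat /madj /= !rmorphN.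
move=> v; rewrite h2 h1 !act_mmul adjE adj_actK mdet_map_mat fm_scale h.
by rewrite !act_scale vscaleA.
Qed.

(** The constant image of [(1 : 0)] can be moved back to infinity over [k]; the coordinate becomes
    affine. *)
Lemma triangularize M : mdet M != 0 -> cst iota (act M e1) ->
  exists N : mat k, mdet N != 0 /\ m21 (mmul (map_mat iota N) M) = 0.
Proof.
rewrite /act /e1 /= !mulr1 !mulr0 !addr0 => M0 h.
have c0 : (m11 M, m21 M) <> (0, 0).
  by case=> x0 y0; move: M0; rewrite /mdet x0 y0 mul0r mulr0 subrr eqxx.
have [s [a [b [s0 ab ea eb]]]] := cst_col c0 h.
have [a0|a0] := eqVneq a 0.
  exists (Mat 0 1 (- b) a); split.
    by rewrite /mdet /= mul0r mul1r opprK add0r; move: ab; rewrite a0 eqxx.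
  by rewrite /= ea eb rmorphN; ring.
exists (Mat 1 0 (- b) a); split; first by rewrite /mdet /= mul0r mul1r subr0.
by rewrite /= ea eb rmorphN; ring.
Qed.

(** Poles are preimages of infinity and affine critical points would be eventually constant, so
    neither exist: [B] and the derivative of [A] are nonzero constants. In triangular coordinates
    this is the situation of [poly_chain]. *)
Lemma one_point d A B mu : (2 <= d)%N -> good d A B -> chain iota d A B mu ->
  ecst iota mu e1 -> (forall v, ecst iota mu v -> v.2 = 0) -> iso iota d A B.
Proof.
move=> d2 g ch h1 hE; have d0 : (0 < d)%N by apply: leq_trans d2.
have [sA sB nd W0] := g.
have [b b0 BE] : exists2 b, b != 0 & B = b%:P.
  apply: no_root => z; apply/negP => /eqP rz.
  have := hE (z, 1); rewrite /= => h; have /eqP := oner_neq0 L; apply; apply: h.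
  apply: (chain_preimage d0 g ch); have [m0 hm] := h1; exists m0 => m lm.
  have -> : fm d A B (z, 1) = vscale A.[z] e1.
    by apply: vec_eq; rewrite /= hev_x1 // ?mulr1 ?mulr0.
  by rewrite act_scale; apply/scale_cst/hm.
have [c c0 A'E] : exists2 c, c != 0 & A^`() = c%:P.
  apply: no_root => z; apply/negP => /eqP rz.
  have := hE (z, 1); rewrite /= => h; have /eqP := oner_neq0 L; apply; apply: h.
  apply: (chain_critical g ch) => w.
  by rewrite wdiff_affine // /pwronsk BE derivC mulr0 subr0 hornerM rz mul0r mulr0.
have Ad : A`_d != 0.
  apply/eqP => Ad; have := nd (1, 0); rewrite /fm /= !hev_10 Ad BE coefC (gtn_eqF d0).
  by move=> /(_ erefl)[/eqP]; rewrite oner_eq0.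
have sAE : size A = d.+1.
  apply/eqP; rewrite eqn_leq sA ltnNge; apply: contraNN Ad => h.
  by rewrite nth_default.
have [m0 hm] := ch; have [m1 hm1] := h1; pose m2 := maxn m0 m1.
have tri i : exists N : mat k,
    mdet N != 0 /\ m21 (mmul (map_mat iota N) (mu (m2 + i)%N)) = 0.
  have [M0 _] := hm (m2 + i)%N (leq_trans (leq_maxl _ _) (leq_addr _ _)).
  exact: (triangularize M0 (hm1 _ (leq_trans (leq_maxr _ _) (leq_addr _ _)))).
have [N hN] := choice tri.
pose T i := mmul (map_mat iota (N i)) (mu (m2 + i)%N).
have T0 i : mdet (T i) != 0.
  have [M0 _] := hm (m2 + i)%N (leq_trans (leq_maxl _ _) (leq_addr _ _)).
  by rewrite mdet_mmul mulf_neq0 // mdet_map_mat fmorph_eq0; case: (hN i).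
have T21 i : m21 (T i) = 0 by case: (hN i).
have [p0 r0] : (forall i, m11 (T i) != 0) /\ (forall i, m22 (T i) != 0).
  split=> i; have := T0 i; rewrite /mdet T21 mulr0 subr0 mulf_eq0 => /norP[] //.
have Tl i : link iota d A B (T i) (T i.+1).
  rewrite /T addnS; have [_ l] := hm (m2 + i)%N (leq_trans (leq_maxl _ _) (leq_addr _ _)).
  by apply: link_map l; case: (hN i) => //; case: (hN i.+1).
clearbody T; pose a i := m11 (T i) / m22 (T i); pose t i := m12 (T i) / m22 (T i).
pose A1 := b^-1 *: A.
have a0 i : a i != 0 by rewrite mulf_neq0 // invr_eq0.
have step i : exists C : {poly k}, forall z,
    (map_poly iota C).[a i.+1 * z + t i.+1] = a i * A1.[z] + t i.
  have [C [D [s [sC sD s0 h]]]] := Tl i.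
  have hz z : m22 (T i.+1) ^+ d * (map_poly iota C).[a i.+1 * z + t i.+1] =
      s * (m11 (T i) * A.[z] + m12 (T i) * b) /\
      m22 (T i.+1) ^+ d * (map_poly iota D).[a i.+1 * z + t i.+1] = s * (m22 (T i) * b).
    have := h (z, 1); rewrite /fm /act /vscale /= !T21 !mul0r !add0r !mulr1.
    rewrite (hev_x1 _ sA) (hev_x1 _ sB) BE hornerC.
    rewrite !(hev_horner _ _ (r0 i.+1)) ?size_map_poly //.
    have -> : a i.+1 * z + t i.+1 = (m11 (T i.+1) * z + m12 (T i.+1)) / m22 (T i.+1).
      by rewrite /a /t mulrDl mulrAC.
    by case=> -> ->.
  have [del del0 DE] : exists2 del, del != 0 & map_poly iota D = del%:P.
    apply: no_root => z; apply/negP => /eqP rz.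
    have [_] := hz ((z - t i.+1) / a i.+1).
    rewrite [a i.+1 * _]mulrC divfK // subrK rz mulr0 => /esym/eqP.
    by rewrite !mulf_eq0 (negPf s0) (negPf (r0 i)) (negPf b0).
  have delE : del = iota D`_0 by rewrite -coef_map DE coefC.
  exists ((D`_0)^-1 *: C) => z; rewrite map_polyZ hornerZ fmorphV -delE.
  have [e1' e2'] := hz z; rewrite DE hornerC in e2'.
  have R0 := expf_neq0 d (r0 i.+1).
  apply: (mulfI R0); apply: (mulfI del0).
  rewrite [m22 _ ^+ d * (_ * _)]mulrCA mulVKf // e1' mulrA [del * _]mulrC e2'.
  rewrite /a /t /A1 hornerZ; have := r0 i; move: (m11 _) (m12 _) (m22 _) A.[z] => x y w q w0.
  by field; rewrite w0 b0.
have [C hC] := choice step.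
have [||||| u [x [E [u0 sE hE']]]] := @poly_chain k L iota d A1 (b^-1 * c) a t C d2.
- by rewrite size_scale // invr_eq0.
- by rewrite derivZ A'E -mul_polyC polyCM.
- by rewrite mulf_neq0 // invr_eq0.
- exact: a0.
- exact: hC.
exists (Mat u x 0 1), E, 1, b; split=> //.
- by rewrite /mdet /= mulr1 mulr0 subr0.
- by rewrite size_poly1.
have sA1 : (size A1 <= d.+1)%N by rewrite size_scale ?invr_eq0 // sAE.
have key : hsub d A1 (lin u x) (lin 0 1) = u *: map_poly iota E + x%:P.
  apply: poly_fun_inj => z; rewrite horner_hsub !horner_lin mul0r add0r hev_x1 //.
  by rewrite hE' hornerD hornerZ hornerC.
have hC1 (q y z : L) : hev d q%:P y z = q * z ^+ d.
  by rewrite -[q%:P]mulr1 mul_polyC hevZl hev_1.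
case=> y z; rewrite /act /fm /vscale /=.
have -> : A = b *: A1 by rewrite scalerA mulfV // scale1r.
rewrite hevZl -(@hev_lin _ d A1 u x 0 1) // key hevD hevZl BE rmorph1 hev_1.
by rewrite !hC1 !mul0r !add0r !mul1r.
Qed.

(* A critical point and all its iterated preimages are eventually constant. Three such
   points determine the coordinates up to PGL_2(k); otherwise [A / B] is conjugate to
   [z ^ d], to [z ^ (- d)], or to a polynomial with constant derivative. *)
Lemma chain_iso d A B mu : (2 <= d)%N -> good d A B -> chain iota d A B mu -> iso iota d A B.
Proof.
move=> d2 g ch; have [sA sB nd W0] := g.
have [v1 [v10 hv1]] := critical_exists d2 sA sB.
have h1 := chain_critical g ch hv1.
have conjE N v : mdet N != 0 -> ecst iota (fun m => mmul (mu m) N) v -> ecst iota mu (act N v).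
  by move=> N0 [m0 h]; exists m0 => m lm; rewrite -act_mmul; apply: h.
have conjE' N v : ecst iota mu (act N v) -> ecst iota (fun m => mmul (mu m) N) v.
  by move=> [m0 h]; exists m0 => m lm; rewrite act_mmul; apply: h.
have [[v2 [h2 w12]]|no2] := pselect (exists v2, ecst iota mu v2 /\ wedge v1 v2 != 0).
  have [[v3 [h3 w13 w23]]|no3] := pselect (exists v3,
    [/\ ecst iota mu v3, wedge v1 v3 != 0 & wedge v2 v3 != 0]).
    exact: (three_points g ch w12 w13 w23).
  pose N := Mat v1.1 v2.1 v1.2 v2.2.
  have N0 : mdet N != 0 by move: w12; rewrite /wedge /mdet /= [v2.1 * _]mulrC.
  have [A' [B' [g' ch' _]]] := chain_conj N0 g ch; apply.
  apply: (two_points d2 g' ch').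
  - by apply: conjE'; rewrite (_ : act N e1 = v1) //; apply: vec_eq => /=; ring.
  - by apply: conjE'; rewrite (_ : act N e2 = v2) //; apply: vec_eq => /=; ring.
  move=> v /(conjE _ _ N0) hv; apply/eqP/negPn/negP.
  rewrite mulf_eq0 => /norP[x0 y0]; apply: no3; exists (act N v); split=> //.
    have -> : wedge v1 (act N v) = wedge v1 v2 * v.2 by rewrite /wedge /=; ring.
    exact: mulf_neq0.
  have -> : wedge v2 (act N v) = - (wedge v1 v2 * v.1) by rewrite /wedge /=; ring.
  by rewrite oppr_eq0; apply: mulf_neq0.
have [v2 w12] : exists v2, wedge v1 v2 != 0.
  have [x0|x0] := eqVneq v1.1 0.
    exists (1, 0); rewrite /wedge /= mulr0 mulr1 sub0r oppr_eq0.
    by apply/eqP => y0; apply: v10; apply: vec_eq.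
  by exists (0, 1); rewrite /wedge /= mulr0 mulr1 subr0.
pose N := Mat v1.1 v2.1 v1.2 v2.2.
have N0 : mdet N != 0 by move: w12; rewrite /wedge /mdet /= [v2.1 * _]mulrC.
have [A' [B' [g' ch' _]]] := chain_conj N0 g ch; apply.
apply: (one_point d2 g' ch').
- by apply: conjE'; rewrite (_ : act N e1 = v1) //; apply: vec_eq => /=; ring.
move=> v /(conjE _ _ N0) hv; apply/eqP/negPn/negP => y0.
apply: no2; exists (act N v); split=> //.
have -> : wedge v1 (act N v) = wedge v1 v2 * v.2 by rewrite /wedge /=; ring.
exact: mulf_neq0.
Qed.

End ChainIso.

(** * Interpolation *)

Lemma left_kernel (F : fieldType) m n (X : 'M[F]_(m, n)) : (n < m)%N ->
  exists2 w : 'rV_m, w != 0 & w *m X = 0.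
Proof.
move=> nm; have K0 : kermx X != 0.
  rewrite -mxrank_eq0 mxrank_ker subn_eq0 -ltnNge.
  exact: leq_ltn_trans (rank_leq_col X) nm.
exists (nz_row (kermx X)); first by rewrite nz_row_eq0.
exact/sub_kermxP/nz_row_sub.
Qed.

(** There are [2 d + 2] unknown coefficients and only [N] linear conditions. Used over [k], it
    yields a candidate map with constant coefficients. *)
Lemma interpolating_pair (F : fieldType) d N (x y c e : 'I_N -> F) : (N < d.+1 + d.+1)%N ->
  exists C D : {poly F}, [/\ (size C <= d.+1)%N, (size D <= d.+1)%N, (C != 0) || (D != 0) &
    forall l, hev d C (x l) (y l) * e l = hev d D (x l) (y l) * c l].
Proof.
move=> hN; pose mon (i : 'I_d.+1) l := x l ^+ i * y l ^+ (d - i).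
have [w w0 wX] := left_kernel (col_mx (\matrix_(i < d.+1, l < N) (mon i l * e l))
  (- \matrix_(i < d.+1, l < N) (mon i l * c l))) hN.
exists (rVpoly (lsubmx w)), (rVpoly (rsubmx w)); split; try exact: size_poly.
  rewrite -negb_and; apply: contraNN w0 => /andP[/eqP h1 /eqP h2].
  rewrite -[w]hsubmxK -[lsubmx w]rVpolyK -[rsubmx w]rVpolyK h1 h2.
  by apply/eqP/rowP => i; rewrite !linear0 row_mx0.
move=> l; apply/eqP; rewrite -subr_eq0; apply/eqP.
have := congr1 (fun u : 'rV_N => u 0 l) wX.
rewrite -[w]hsubmxK mul_row_col mulmxN !mxE => h.
rewrite row_mxKl row_mxKr -[RHS]h; congr (_ - _); rewrite mulr_suml; apply: eq_bigr => i _.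
  by rewrite coef_rVpoly_ord !mxE -!mulrA.
by rewrite coef_rVpoly_ord !mxE -!mulrA.
Qed.

Lemma size_hsub (F : fieldType) n d (G A B : {poly F}) : (size A <= d.+1)%N -> (size B <= d.+1)%N ->
  (size (hsub n G A B) <= (n * d).+1)%N.
Proof.
move=> sA sB; rewrite /hsub /hev; apply: leq_trans (size_sum _ _ _) _.
have sX (Q : {poly F}) i : (size Q <= d.+1)%N -> (size (Q ^+ i)%R <= (i * d).+1)%N.
  move=> sQ; apply: leq_trans (size_poly_exp_leq _ _) _; rewrite ltnS mulnC leq_mul2l.
  by apply/orP; right; move: sQ; case: (size Q).
apply/bigmax_leqP => i _; rewrite coef_map_id0 ?polyC0 // -mulrA mul_polyC.
apply: leq_trans (size_scale_leq _ _) _; apply: leq_trans (size_polyMleq _ _) _.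
have := leq_add (sX _ i sA) (sX _ (n - i)%N sB); rewrite addSn addnS -mulnDl subnKC //.
  by move: (size (A ^+ i)%R) (size (B ^+ (n - i))%R) => a b; clear; lia.
by rewrite -ltnS.
Qed.

Section Interpolation.
Variables (k L : closedFieldType) (iota : {rmorphism k -> L}).
Implicit Types (A B : {poly L}) (v w : L * L) (M N : mat L).

(** The candidate interpolated over [k] agrees with the given map at [2 d + 1] points. The cross
    product [C1 * B1 - D1 * A1] has degree at most [2 d], so it vanishes. *)
Lemma link_of_points d A B M M' (S : seq L) : (0 < d)%N ->
  (size A <= d.+1)%N -> (size B <= d.+1)%N -> (forall v, fm d A B v = (0, 0) -> v = (0, 0)) ->
  mdet M != 0 -> mdet M' != 0 -> uniq S -> (d + d < size S)%N ->
  (forall x, x \in S -> cst iota (act M' (x, 1)) /\ cst iota (act M (fm d A B (x, 1)))) ->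
  link iota d A B M M'.
Proof.
move=> d0 sA sB nd M0 M'0 uS sS hS.
(* Exactly [2 d + 1] of the points: few enough for a nonzero interpolant, enough to determine the
   map. *)
pose N := (d + d).+1; pose al (l : 'I_N) := nth 0 S l.
have alS l : al l \in S by apply: mem_nth; apply: leq_trans (ltn_ord l) sS.
have aff0 (z : L) : (z, 1 : L) <> (0, 0) by case=> _ /eqP; rewrite oner_eq0.
have /choice[ab hab] : forall l, exists ab : k * k, exists s, [/\ s != 0,
    (act M' (al l, 1)).1 = s * iota ab.1 & (act M' (al l, 1)).2 = s * iota ab.2].
  move=> l; have [h _] := hS _ (alS l).
  have n0 : act M' (al l, 1) <> (0, 0) by move=> /(act_eq0 M'0)/aff0.
  have [s [a [b [s0 ab ea eb]]]] := cst_col n0 h.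
  by exists (a, b), s.
have /choice[ce hce] : forall l, exists ce : k * k,
    ((ce.1 != 0) || (ce.2 != 0)) /\ wedge (act M (fm d A B (al l, 1))) (iota ce.1, iota ce.2) = 0.
  by move=> l; have [_ [c [e [ce h]]]] := hS _ (alS l); exists (c, e).
have [|C [D [sC sD CD hCD]]] := @interpolating_pair k d N (fun l => (ab l).1)
  (fun l => (ab l).2) (fun l => (ce l).1) (fun l => (ce l).2).
  by rewrite /N addSn addnS.
have sC' : (size (map_poly iota C) <= d.+1)%N by rewrite size_map_poly.
have sD' : (size (map_poly iota D) <= d.+1)%N by rewrite size_map_poly.
have [C1 [D1 [sC1 sD1 h1]]] := fm_lin M' sC' sD'.
pose A1 := m11 M *: A + m12 M *: B; pose B1 := m21 M *: A + m22 M *: B.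
have h2 v : fm d A1 B1 v = act M (fm d A B v) by rewrite fm_act.
have sA1 : (size A1 <= d.+1)%N.
  by rewrite (leq_trans (size_polyD _ _)) // geq_max !(leq_trans (size_scale_leq _ _)).
have sB1 : (size B1 <= d.+1)%N.
  by rewrite (leq_trans (size_polyD _ _)) // geq_max !(leq_trans (size_scale_leq _ _)).
have nd1 v : fm d A1 B1 v = (0, 0) -> v = (0, 0) by rewrite h2 => /(act_eq0 M0)/nd.
have hz (P Q : {poly L}) z : (size P <= d.+1)%N -> (size Q <= d.+1)%N ->
    fm d P Q (z, 1) = (P.[z], Q.[z]) by move=> sP sQ; rewrite /fm /= !hev_x1.
have par l : wedge (fm d C1 D1 (al l, 1)) (fm d A1 B1 (al l, 1)) = 0.
  have [s [s0 e1 e2]] := hab l; have [ce0 w0] := hce l.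
  have n0 : (iota (ce l).1, iota (ce l).2) <> (0, 0).
    by case=> /eqP + /eqP; rewrite !fmorph_eq0 => /eqP a0 /eqP b0; rewrite a0 b0 eqxx in ce0.
  have w0' : wedge (iota (ce l).1, iota (ce l).2) (act M (fm d A B (al l, 1))) = 0.
    by rewrite -[RHS]oppr0 -w0 /wedge /=; ring.
  have [r rE] := wedge_eq0 n0 w0'.
  rewrite h1 h2 rE wedge_scaler.
  have -> : act M' (al l, 1) = vscale s (iota (ab l).1, iota (ab l).2) by apply: vec_eq.
  rewrite fm_scale wedge_scalel /wedge /= -!hev_rmorph -!rmorphM hCD subrr !mulr0 //.
have key : C1 * B1 - D1 * A1 = 0.
  apply/eqP/negPn/negP => R0.
  have rs : all (root (C1 * B1 - D1 * A1)) (take N S).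
    apply/(all_nthP 0) => i; rewrite size_takel // => iN.
    rewrite nth_take //; have := par (Ordinal iN).
    rewrite !hz // /wedge /al /= => e.
    by rewrite rootE hornerD hornerN !hornerM e.
  have := max_poly_roots R0 rs (take_uniq _ uS); rewrite size_takel // ltnNge => /negP; apply.
  rewrite (leq_trans (size_polyD _ _)) // size_polyN geq_max.
  rewrite !(leq_trans (size_polyMleq _ _)) //; move: sA1 sB1 sC1 sD1; rewrite /N;
    move: (size A1) (size B1) (size C1) (size D1); clear; lia.
have cop : coprimep A1 B1.
  apply/coprimepP => q qA qB; rewrite -size_poly_eq1; apply/negPn/negP => /closed_rootP[z rz].
  apply: (aff0 z); apply: nd1; rewrite hz //.
  have rt (P : {poly L}) : q %| P -> root P z.
    by move=> qP; rewrite -dvdp_XsubCl (dvdp_trans _ qP) // dvdp_XsubCl.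
  by have /eqP-> := rt _ qA; have /eqP-> := rt _ qB.
have CD1 : C1 * B1 = D1 * A1 by apply/eqP; rewrite -subr_eq0 key.
have [q C1E] : exists q, C1 = q * A1.
  apply/dvdpP; rewrite -(Gauss_dvdpl _ cop) CD1; exact: dvdp_mull.
have D1E : D1 = q * B1.
  have [A10|A10] := eqVneq A1 0; last first.
    by apply: (mulIf A10); rewrite -CD1 C1E mulrAC.
  have [b b0 BE] : exists2 b, b != 0 & B1 = b%:P.
    apply: no_root => z; apply/negP => /eqP rz; apply: (aff0 z); apply: nd1.
    by rewrite hz // A10 horner0 rz.
  have := nd1 (1, 0); rewrite /fm /= !hev_10 A10 BE coef0 coefC (gtn_eqF d0).
  by move=> /(_ erefl)[/eqP]; rewrite oner_eq0.
have CD0 : (C1 != 0) || (D1 != 0).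
  rewrite -negb_and; apply/negP => /andP[/eqP c0 /eqP e0].
  have z0 v : fm d (map_poly iota C) (map_poly iota D) v = (0, 0).
    by have [w ->] := act_surj v M'0; rewrite -h1 c0 e0 /fm !hev0.
  case/orP: CD => /eqP; apply; apply: (map_poly_inj iota); rewrite rmorph0;
    apply: poly_fun_inj => z; rewrite horner0; have := z0 (z, 1); rewrite hz // => -[] //.
have q0 : q != 0 by apply: contraTneq CD0 => q0; rewrite C1E D1E q0 !mul0r eqxx.
(* One of [A1], [B1] has full degree [d], as they have no common zero at infinity; the factor [q] is
   therefore a scalar. *)
have cq : (size q <= 1)%N.
  have [Ad|Ad] := eqVneq A1`_d 0; last first.
    have A10 : A1 != 0 by apply: contraNneq Ad => ->; rewrite coef0.
    have sE : size A1 = d.+1.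
      by apply/eqP; rewrite eqn_leq sA1 ltnNge; apply: contraNN Ad => h; rewrite nth_default.
    by move: sC1; rewrite C1E size_mul // sE addnS /= -[in X in (_ <= X)%N]add1n leq_add2r.
  have Bd : B1`_d != 0.
    apply/eqP => Bd; have := nd1 (1, 0); rewrite /fm /= !hev_10 Ad Bd.
    by move=> /(_ erefl)[/eqP]; rewrite oner_eq0.
  have B10 : B1 != 0 by apply: contraNneq Bd => ->; rewrite coef0.
  have sE : size B1 = d.+1.
    by apply/eqP; rewrite eqn_leq sB1 ltnNge; apply: contraNN Bd => h; rewrite nth_default.
  by move: sD1; rewrite D1E size_mul // sE addnS /= -[in X in (_ <= X)%N]add1n leq_add2r.
rewrite (size1_polyC cq) in q0 C1E D1E; exists C, D, q`_0; split=> //.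
  by apply: contraNneq q0 => ->.
by move=> v; rewrite -h1 -h2 C1E D1E !mul_polyC; apply: vec_eq; rewrite /= hevZl.
Qed.

(** The coordinate is the cross ratio that sends the first three points to 0, infinity and 1; its
    other values are cross ratios of points of [S]. *)
Lemma frame_matrix (S : seq L) : uniq S -> (3 <= size S)%N ->
  (forall z1 z2 z3 z4, z1 \in S -> z2 \in S -> z3 \in S -> z4 \in S ->
    z1 != z4 -> z3 != z2 -> exists a : k, cr z1 z2 z3 z4 = iota a) ->
  exists M, mdet M != 0 /\ forall z, z \in S -> cst iota (act M (z, 1)).
Proof.
case: S => [|f1 [|f2 [|f3 S]]] // uS _ h.
move: (uS); rewrite /= !inE !negb_or => /andP[/and3P[n12 n13 _] /andP[/andP[n23 _] _]].
have i1 : f1 \in [:: f1, f2, f3 & S] by rewrite !inE eqxx.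
have i2 : f2 \in [:: f1, f2, f3 & S] by rewrite !inE eqxx orbT.
have i3 : f3 \in [:: f1, f2, f3 & S] by rewrite !inE eqxx !orbT.
exists (Mat (f3 - f2) (- ((f3 - f2) * f1)) (f3 - f1) (- ((f3 - f1) * f2))); split.
  have -> : mdet (Mat (f3 - f2) (- ((f3 - f2) * f1)) (f3 - f1) (- ((f3 - f1) * f2))) =
    (f3 - f2) * (f3 - f1) * (f1 - f2) by rewrite /mdet /=; ring.
  by rewrite !mulf_neq0 // subr_eq0 // eq_sym.
move=> z zS.
have -> : act (Mat (f3 - f2) (- ((f3 - f2) * f1)) (f3 - f1) (- ((f3 - f1) * f2))) (z, 1) =
    ((z - f1) * (f3 - f2), (z - f2) * (f3 - f1)) by apply: vec_eq => /=; ring.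
have [zf|zf] := eqVneq z f2; first by apply: cst_y0; rewrite /= zf subrr mul0r.
have n31 : f3 != f1 by rewrite eq_sym.
have [a aE] := h _ _ _ _ zS i1 i3 i2 zf n31.
have -> : (z - f1) * (f3 - f2) = iota a * ((z - f2) * (f3 - f1)).
  by rewrite -aE /cr divfK // mulf_neq0 // subr_eq0.
exact: cst_affine.
Qed.

Lemma hev_XsubC n (G : {poly L}) f x y : (size G <= n.+1)%N ->
  hev n.+1 (G * ('X - f%:P)) x y = hev n G x y * (x - f * y).
Proof.
move=> sG; have sP : (size (G * ('X - f%:P))%R <= n.+2)%N.
  apply: leq_trans (size_polyMleq _ _) _; rewrite size_XsubC addn2 /= ltnS; exact: sG.
have [->|y0] := eqVneq y 0.
  have [q1 ->] := hev_mod n.+1 (G * ('X - f%:P)) x 0.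
  have [q2 ->] := hev_mod n G x 0.
  rewrite !mul0r !addr0 mulr0 subr0 mulrBr coefB coefMX coefMC /=.
  by rewrite (nth_default 0 sG) mul0r subr0 exprSr mulrA.
rewrite !hev_horner // hornerM hornerXsubC exprSr -!mulrA; congr (_ * _).
by rewrite mulrCA; congr (_ * _); field.
Qed.

Lemma hev_factor (S : seq L) n (P : {poly L}) : (size P <= n.+1)%N -> P != 0 ->
  uniq S -> all (root P) S ->
  exists G, [/\ (size S <= n)%N, (size (G : {poly L}) <= (n - size S).+1)%N &
    forall x y, hev n P x y = hev (n - size S) G x y * \prod_(f <- S) (x - f * y)].
Proof.
elim: S n P => [|f S IH] n P sP P0 /= uS rP.
  by exists P; split=> // [|x y]; rewrite subn0 // big_nil mulr1.
move: uS rP => /andP[fS uS] /andP[/factor_theorem[Q PE] rP].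
have Q0 : Q != 0 by apply: contraNneq P0 => q0; rewrite PE q0 mul0r.
have sPE : size P = (size Q).+1.
  by rewrite PE size_mul ?polyXsubC_eq0 // size_XsubC addn2.
case: n sP => [|n] sP.
  by exfalso; move: sP; rewrite sPE ltnS leqn0 size_poly_eq0 (negPf Q0).
have sQ : (size Q <= n.+1)%N by rewrite sPE in sP.
have rQ : all (root Q) S.
  apply/allP => g gS; have := allP rP g gS; rewrite PE rootM root_XsubC.
  by case/orP=> // /eqP e; move: fS; rewrite -e gS.
have [G [h1 h2 h3]] := IH n Q sQ Q0 uS rQ.
exists G; rewrite ltnS subSS; split=> // x y.
by rewrite PE hev_XsubC // h3 big_cons mulrAC mulrA.
Qed.

(* At most [d (d ^ m - size (S m))] points of [S m.+1] are not mapped into [S m]; the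
   others suffice to interpolate [A / B] over [k]. *)
Lemma chain_of_roots d A B (P : nat -> {poly L}) (S : nat -> seq L) (M : nat -> mat L) m0 :
  (0 < d)%N -> (size A <= d.+1)%N -> (size B <= d.+1)%N ->
  (forall v, fm d A B v = (0, 0) -> v = (0, 0)) ->
  (forall m, P m.+1 = hsub (d ^ m) (P m) A B) -> (forall m, P m != 0) ->
  (forall m, (size (P m) <= (d ^ m).+1)%N) ->
  (forall m, (m0 <= m)%N -> [/\ uniq (S m), all (root (P m)) (S m), mdet (M m) != 0 &
     forall x, x \in S m -> cst iota (act (M m) (x, 1))]) ->
  (forall m, (m0 <= m)%N -> (d + d + d * (d ^ m - size (S m)) < size (S m.+1))%N) ->
  chain iota d A B M.
Proof.
move=> d0 sA sB nd PS P0 sP hS hc; exists m0 => m hm.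
have [uS rS M0 cS] := hS m hm; have [uS' rS' M'0 cS'] := hS m.+1 (leqW hm).
split=> //; have [G [h1 h2 h3]] := hev_factor (sP m) (P0 m) uS rS.
(* [G] is [P m] with the roots in [S m] divided out. The roots of its pullback [H] contain all
   points of [S m.+1] not mapped into [S m], so the degree of [H] bounds their number. *)
pose H := hsub (d ^ m - size (S m)) G A B.
have PE z : (P m.+1).[z] = H.[z] * \prod_(f <- S m) (A.[z] - f * B.[z]).
  by rewrite PS !horner_hsub h3.
have H0 : H != 0.
  apply: contraNneq (P0 m.+1) => H0; apply/eqP/poly_fun_inj => z.
  by rewrite PE H0 !horner0 mul0r.
have sH : (size H <= (d * (d ^ m - size (S m))).+1)%N by rewrite mulnC size_hsub.
pose bad := [seq x <- S m.+1 | root H x].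
have sbad : (size bad <= d * (d ^ m - size (S m)))%N.
  rewrite -ltnS; apply: leq_trans sH; apply: max_poly_roots => //; last exact: filter_uniq.
  by apply/allP => x; rewrite mem_filter => /andP[].
apply: (@link_of_points d A B (M m) (M m.+1) [seq x <- S m.+1 | ~~ root H x]) => //.
- exact: filter_uniq.
- have := hc m hm; rewrite -(count_predC (root H) (S m.+1)) size_filter.
  by move: sbad; rewrite size_filter; move: (count _ _) (count _ _) => a b; clear; lia.
move=> x; rewrite mem_filter => /andP[rx xS]; split; first exact: cS'.
have /eqP := allP rS' x xS; rewrite PE => /eqP; rewrite mulf_eq0.
rewrite rootE in rx; rewrite (negPf rx) /= prodf_seq_eq0 => /hasP[f fS /=].
rewrite subr_eq0 => /eqP e.
have -> : fm d A B (x, 1) = vscale B.[x] (f, 1).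
  by apply: vec_eq; rewrite /= hev_x1 // ?mulr1 // e mulrC.
by rewrite act_scale; apply/scale_cst/cS.
Qed.

End Interpolation.

(** * Isotriviality *)

Lemma frac_scale (F : fieldType) (c x y : F) : c != 0 -> c * x / (c * y) = x / y.
Proof. by move=> c0; rewrite invfM mulrACA divff // mul1r. Qed.

Lemma mob_adj (F : fieldType) (a b c d x : F) : a * d - b * c != 0 -> c * x + d != 0 ->
  (d * ((a * x + b) / (c * x + d)) + - b) / (- c * ((a * x + b) / (c * x + d)) + a) = x.
Proof.
move=> D0 q0.
have e1 : d * ((a * x + b) / (c * x + d)) + - b = (a * d - b * c) * x / (c * x + d) by field.
have e2 : - c * ((a * x + b) / (c * x + d)) + a = (a * d - b * c) / (c * x + d) by field.
by rewrite e1 e2 [_ * x]mulrC -[x * _ / _]mulrA mulfK // mulf_neq0 // invr_eq0.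
Qed.

Section Composition.
Variable F : fieldType.
Implicit Types (A B P Q U V : {poly F}) (f g : {ratfun F}) (M : mat F).

Definition rsub A g : {ratfun F} := (map_poly (@tofrac {poly F} \o polyC) A).[g].

Lemma rsubZ c A g : rsub (c *: A) g = c%:P%:F * rsub A g.
Proof. by rewrite /rsub map_polyZ hornerZ. Qed.

Lemma rsub_frac n A P Q : (size A <= n.+1)%N -> Q != 0 ->
  rsub A (P%:F / Q%:F) * Q%:F ^+ n = (hsub n A P Q)%:F.
Proof.
move=> sA Q0; have Q0' : Q%:F != 0 by rewrite tofrac_neq0.
have sA' : (size (map_poly (@tofrac {poly F} \o polyC) A) <= n.+1)%N by rewrite size_map_poly.
rewrite /hsub hev_rmorph -map_poly_comp mulrC /rsub.
exact: esym (hev_horner _ sA' Q0').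
Qed.

Lemma rcomp_frac U V g : V != 0 -> coprimep U V ->
  rcomp (U%:F / V%:F) g = rsub U g / rsub V g.
Proof.
move=> V0 cop; have [c c0 [e1 e2]] := rnum_rden_uniq cop V0 (erefl (U%:F / V%:F)).
rewrite /rcomp -/(rsub _ _) -/(rsub _ _) e1 e2 !rsubZ.
have c0' : c%:P%:F != 0 by rewrite tofrac_neq0 // polyC_eq0.
exact: frac_scale c0'.
Qed.

Lemma coprimep_lin (a b c e : F) : a * e - b * c != 0 -> coprimep (lin a b) (lin c e).
Proof.
move=> D0; apply/coprimepP => q q1 q2; rewrite -size_poly_eq1.
have : q %| (a * e - b * c)%:P.
  have -> : (a * e - b * c)%:P = a *: lin c e - c *: lin a b.
    by rewrite /lin -!mul_polyC polyCB !polyCM; ring.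
  by rewrite dvdp_sub // -mul_polyC dvdp_mull.
move=> /dvdp_leq; rewrite polyC_eq0 => /(_ D0); rewrite size_polyC D0.
have : q != 0.
  apply: contraTneq q1 => ->; rewrite dvd0p; apply/negP => /eqP l0.
  have e1 : a = 0 by have := congr1 (fun p : {poly F} => p`_1) l0; rewrite /lin !coefE mulr1 addr0.
  have e2 : b = 0 by have := congr1 (fun p : {poly F} => p`_0) l0; rewrite /lin !coefE mulr0 add0r.
  by rewrite e1 e2 !mul0r subrr eqxx in D0.
by rewrite -size_poly_gt0; case: (size q) => [//|[]].
Qed.

Lemma lin_neq0 (a b : F) : (a != 0) || (b != 0) -> lin a b != 0.
Proof.
move=> ab; apply: contraTneq ab => l0; rewrite negb_or !negbK.
have -> : a = 0 by have := congr1 (fun p : {poly F} => p`_1) l0; rewrite /lin !coefE mulr1 addr0.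
have -> : b = 0 by have := congr1 (fun p : {poly F} => p`_0) l0; rewrite /lin !coefE mulr0 add0r.
by rewrite eqxx.
Qed.

Definition mfrac (M : mat F) : {ratfun F} :=
  (lin (m11 M) (m12 M))%:F / (lin (m21 M) (m22 M))%:F.

Lemma mden_neq0 M : mdet M != 0 -> lin (m21 M) (m22 M) != 0.
Proof.
move=> D0; apply: lin_neq0; apply: contraNT D0; rewrite negb_or !negbK /mdet.
by move=> /andP[/eqP-> /eqP->]; rewrite !mulr0 subrr.
Qed.

Lemma rsub_lin (a b : F) g : rsub (lin a b) g = a%:P%:F * g + b%:P%:F.
Proof. by rewrite /rsub /lin rmorphD /= map_polyZ map_polyX map_polyC hornerD hornerZ hornerX hornerC. Qed.

Lemma rcomp_mfrac M g : mdet M != 0 -> rcomp (mfrac M) g =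
  ((m11 M)%:P%:F * g + (m12 M)%:P%:F) / ((m21 M)%:P%:F * g + (m22 M)%:P%:F).
Proof. by move=> D0; rewrite rcomp_frac ?mden_neq0 ?coprimep_lin // !rsub_lin. Qed.

Lemma rdeg_mfrac M : mdet M != 0 -> rdeg (mfrac M) = 1%N.
Proof.
move=> D0; have cop : coprimep (lin (m11 M) (m12 M)) (lin (m21 M) (m22 M)) by exact: coprimep_lin.
have [c c0 [e1 e2]] := rnum_rden_uniq cop (mden_neq0 D0) (erefl (mfrac M)).
have sl (a b : F) : (size (lin a b) <= 2)%N.
  rewrite /lin (leq_trans (size_polyD _ _)) // geq_max.
  rewrite (leq_trans (size_scale_leq _ _)) ?size_polyX // size_polyC; by case: (b != 0).
have sl' (a b : F) : a != 0 -> size (lin a b) = 2.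
  move=> a0; rewrite /lin size_polyDl size_scale ?size_polyX // size_polyC.
  by case: (b != 0).
rewrite /rdeg /pdeg e1 e2 !size_scale //.
have [z1|z1] := eqVneq (m11 M) 0; last first.
  by rewrite (sl' _ _ z1); have := sl (m21 M) (m22 M); case: (size _) => [|[|[]]].
have z2 : m21 M != 0 by apply: contraNneq D0 => z2; rewrite /mdet z1 z2 !(mul0r, mulr0) subrr.
by rewrite (sl' _ _ z2); have := sl (m11 M) (m12 M); case: (size _) => [|[|[]]].
Qed.

Lemma act_polyC (a b : F) : a%:P%:F * (rX F) + b%:P%:F = (lin a b)%:F.
Proof. by rewrite /lin -mul_polyC tofracD tofracM. Qed.

Lemma rcomp_madj M : mdet M != 0 -> rcomp (mfrac (madj M)) (mfrac M) = rX F.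
Proof.
move=> D0; rewrite rcomp_mfrac ?mdet_madj // /mfrac.
have D0' : (mdet M)%:P%:F != 0 by rewrite tofrac_neq0 // polyC_eq0.
rewrite -!act_polyC; have := mden_neq0 D0; rewrite -tofrac_eq0 -act_polyC.
move: D0'; rewrite /mdet /madj /= polyCB !polyCM !polyCN tofracB !tofracM !tofracN.
exact: mob_adj.
Qed.

End Composition.

Lemma coprime_nondeg (F : fieldType) d (A B : {poly F}) : coprimep A B ->
  maxn (pdeg A) (pdeg B) = d -> (0 < d)%N ->
  [/\ (size A <= d.+1)%N, (size B <= d.+1)%N & forall v, fm d A B v = (0, 0) -> v = (0, 0)].
Proof.
move=> cop dE d0; have [sA sB] : (size A <= d.+1)%N /\ (size B <= d.+1)%N.
  by move: dE; rewrite /pdeg; move: (size A) (size B) => a b; clear; lia.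
split=> // -[x y]; rewrite /fm /=; have [->|y0] := eqVneq y 0; last first.
  rewrite !hev_horner // => -[/eqP + /eqP]; rewrite !mulf_eq0 expf_eq0 (negPf y0) andbF /=.
  by move=> /eqP rA rB; have := coprimep_root cop; move=> /(_ (x / y)); rewrite rootE rA eqxx rB => /(_ isT).
have [q1 ->] := hev_mod d A x 0; have [q2 ->] := hev_mod d B x 0.
rewrite !mul0r !addr0 => -[/eqP + /eqP]; rewrite !mulf_eq0 expf_eq0 d0 /=.
have [->//|x0] := eqVneq x 0; rewrite !orbF => /eqP Ad /eqP Bd; exfalso.
have hd (P : {poly F}) : pdeg P = d -> P`_d = 0 -> False.
  move=> pd P0; have : lead_coef P = 0 by rewrite lead_coefE -[(size P).-1]/(pdeg P) pd.
  by move/eqP; rewrite lead_coef_eq0 => /eqP e; move: pd d0; rewrite e /pdeg size_poly0 => <-.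
by case/orP: (leq_total (pdeg A) (pdeg B)) => h; [apply: (hd B)|apply: (hd A)];
  rewrite // -dE; apply/esym; [apply/maxn_idPr|apply/maxn_idPl].
Qed.

Lemma rnum_frac (F : fieldType) (C D : {poly F}) : D != 0 ->
  rnum (C%:F / D%:F) * D = C * rden (C%:F / D%:F).
Proof.
move=> D0; move eqx: (_ / _) => x.
by apply: frac_eq; rewrite -?ratfunE ?rden_neq0.
Qed.

Lemma rmap_frac (F E : fieldType) (i : {rmorphism F -> E}) (C D : {poly F}) : D != 0 ->
  rmap i (C%:F / D%:F) = (map_poly i C)%:F / (map_poly i D)%:F.
Proof.
move=> D0; have := rnum_frac C D0; rewrite /rmap; move: (C%:F / D%:F) => x e.
apply/eqP; rewrite eqr_div ?tofrac_neq0 ?map_poly_eq0 ?rden_neq0 //.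
by rewrite -!tofracM -!rmorphM e.
Qed.

Lemma frac_comb (F : fieldType) (D0 s q m11 m12 m21 m22 c e : F) :
  D0 = m11 * m22 - m12 * m21 -> D0 != 0 -> s != 0 -> q != 0 -> m21 * c + m22 * e != 0 ->
  (m22 * (s * (m11 * c + m12 * e) / q / (s * (m21 * c + m22 * e) / q)) + - m12) /
  (- m21 * (s * (m11 * c + m12 * e) / q / (s * (m21 * c + m22 * e) / q)) + m11) = c / e.
Proof.
move=> DE D00 s0 q0 b0.
have -> : s * (m11 * c + m12 * e) / q / (s * (m21 * c + m22 * e) / q) =
  (m11 * c + m12 * e) / (m21 * c + m22 * e) by field; rewrite q0 s0 b0.
have -> : m22 * ((m11 * c + m12 * e) / (m21 * c + m22 * e)) + - m12 =
  D0 / (m21 * c + m22 * e) * c by rewrite DE; field.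
have -> : - m21 * ((m11 * c + m12 * e) / (m21 * c + m22 * e)) + m11 =
  D0 / (m21 * c + m22 * e) * e by rewrite DE; field.
by apply: frac_scale; rewrite mulf_neq0 // invr_eq0.
Qed.

(** A passage from homogeneous lifts to identities in [L(z)]. The point to check is that no
    denominator vanishes identically, which again follows from the absence of common zeros. *)
Lemma iso_isotrivial (k L : closedFieldType) (j : {rmorphism {ratfun k} -> L})
    (phi : {ratfun {ratfun k}}) : (0 < rdeg phi)%N ->
  iso (constants j) (rdeg phi) (map_poly j (rnum phi)) (map_poly j (rden phi)) ->
  isotrivial j phi.
Proof.
set d := rdeg phi; set A := map_poly j _; set B := map_poly j _ => d0.
have B0 : B != 0 by rewrite map_poly_eq0 rden_neq0.
have cop : coprimep A B by rewrite coprimep_map coprimep_rnum_rden.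
have dE : maxn (pdeg A) (pdeg B) = d by rewrite /pdeg !size_map_poly.
have [sA sB nd] := coprime_nondeg cop dE d0.
move=> [M [C [D [s [M0 sC sD s0 h]]]]].
pose C' := map_poly (constants j) C; pose D' := map_poly (constants j) D.
have sC' : (size C' <= d.+1)%N by rewrite size_map_poly.
have sD' : (size D' <= d.+1)%N by rewrite size_map_poly.
pose P := lin (m11 M) (m12 M); pose Q := lin (m21 M) (m22 M).
have Q0 : Q != 0 by exact: mden_neq0.
have hz (z : L) : hev d A P.[z] Q.[z] = s * (m11 M * C'.[z] + m12 M * D'.[z]) /\
    hev d B P.[z] Q.[z] = s * (m21 M * C'.[z] + m22 M * D'.[z]).
  have := h (z, 1); rewrite /fm /act /vscale /= !mulr1 !(hev_x1 _ sC') !(hev_x1 _ sD').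
  by rewrite !horner_lin => -[].
have EA : hsub d A P Q = s *: (m11 M *: C' + m12 M *: D').
  apply: poly_fun_inj => z; rewrite horner_hsub (proj1 (hz z)).
  by rewrite hornerZ hornerD !hornerZ.
have EB : hsub d B P Q = s *: (m21 M *: C' + m22 M *: D').
  apply: poly_fun_inj => z; rewrite horner_hsub (proj2 (hz z)).
  by rewrite hornerZ hornerD !hornerZ.
have D0 : D != 0.
  apply/eqP => D0; have [v [v0 vC]] := form_root d0 sC'.
  apply: v0; apply: (act_eq0 M0); apply: nd; rewrite h /fm.
  by rewrite vC /D' D0 rmorph0 hev0 /act /vscale /= !mulr0 !addr0 !mulr0.
have EB0 : m21 M *: C' + m22 M *: D' != 0.
  apply: contraNneq B0 => E0.
  have : B * lin (- m21 M) (m11 M) = 0.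
    apply: poly_fun_inj => w; rewrite hornerM horner_lin horner0.
    pose u := act (madj M) (w, 1).
    have u2E : u.2 = - m21 M * w + m11 M by rewrite /u /= mulr1.
    have [u20|u20] := eqVneq u.2 0; first by rewrite -u2E u20 mulr0.
    have hB0 : hev d B (act M u).1 (act M u).2 = 0.
      have e : hev d B (act M u).1 (act M u).2 =
          s * (m21 M * hev d C' u.1 u.2 + m22 M * hev d D' u.1 u.2) := congr1 snd (h u).
      rewrite e (hev_horner _ sC' u20) (hev_horner _ sD' u20).
      have := congr1 (fun p : {poly L} => p.[u.1 / u.2]) E0.
      rewrite hornerD !hornerZ horner0; move: (u.2 ^+ d) C'.[_] D'.[_] => Y c' e' E.
      have -> : m21 M * (Y * c') + m22 M * (Y * e') = Y * (m21 M * c' + m22 M * e') by ring.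
      by rewrite E !mulr0.
    move: hB0; rewrite act_adjK /= hevZ hev_x1 // => /eqP.
    by rewrite mulf_eq0 expf_eq0 (negPf M0) andbF => /eqP ->; rewrite mul0r.
  move/eqP; rewrite mulf_eq0 => /orP[//|l0].
  have := @mden_neq0 _ (madj M); rewrite mdet_madj => /(_ M0).
  by rewrite (eqP l0) eqxx.
exists (mfrac (madj M)), (mfrac M), (C%:F / D%:F).
have adj0 : mdet (madj M) != 0 by rewrite mdet_madj.
split.
- exact: rdeg_mfrac.
- exact: rcomp_madj.
- have := rcomp_madj adj0; congr (rcomp (mfrac _) _ = _).
  by case: (M) => a b c e; rewrite /madj /= !opprK.
rewrite rmap_frac // rcomp_mfrac // /rmap rcomp_frac //.
have QF : Q%:F ^+ d != 0 by rewrite expf_neq0 // tofrac_neq0.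
have rA : rsub A (mfrac M) = s%:P%:F * ((m11 M)%:P%:F * C'%:F + (m12 M)%:P%:F * D'%:F) / Q%:F ^+ d.
  apply: (mulIf QF); rewrite rsub_frac // EA divfK //.
  by rewrite -!mul_polyC !tofracM tofracD !tofracM.
have rB : rsub B (mfrac M) = s%:P%:F * ((m21 M)%:P%:F * C'%:F + (m22 M)%:P%:F * D'%:F) / Q%:F ^+ d.
  apply: (mulIf QF); rewrite rsub_frac // EB divfK //.
  by rewrite -!mul_polyC !tofracM tofracD !tofracM.
rewrite rA rB /madj /=.
have D0' : (mdet M)%:P%:F != 0 by rewrite tofrac_neq0 // polyC_eq0.
have s0' : s%:P%:F != 0 by rewrite tofrac_neq0 // polyC_eq0.
rewrite !polyCN !tofracN; apply: (frac_comb _ D0' s0' QF).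
  by rewrite /mdet polyCB !polyCM tofracB !tofracM.
by rewrite -!tofracM -tofracD !mul_polyC tofrac_neq0.
Qed.

(** * Fibres of iterates *)

(* Homogeneous coordinates. *)
Definition pvec (F : fieldType) (P : option F) : F * F := if P is Some x then (x, 1) else (1, 0).

Section Values.
Variable F : fieldType.
Implicit Types (f : {ratfun F}) (P Q : option F).

Lemma ratfun_forms f : (0 < rdeg f)%N ->
  [/\ (size (rnum f) <= (rdeg f).+1)%N, (size (rden f) <= (rdeg f).+1)%N &
    forall v, fm (rdeg f) (rnum f) (rden f) v = (0, 0) -> v = (0, 0)].
Proof. by move=> d0; apply: coprime_nondeg => //; exact: coprimep_rnum_rden. Qed.

Lemma reval_fm f P : (0 < rdeg f)%N ->
  exists s, fm (rdeg f) (rnum f) (rden f) (pvec P) = vscale s (pvec (reval f P : option F)).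
Proof.
move=> d0; have [sA sB _] := ratfun_forms d0.
have e : fm (rdeg f) (rnum f) (rden f) (pvec P) = match P with
    | Some x => ((rnum f).[x], (rden f).[x])
    | None => ((rnum f)`_(rdeg f), (rden f)`_(rdeg f)) end.
  by case: P => [x|]; rewrite /fm /= ?hev_x1 // !hev_10.
rewrite e /reval; case: (match P with Some _ => _ | None => _ end) => u v.
have [->|v0] := eqVneq v 0; first by exists u; apply: vec_eq; rewrite /= ?mulr1 ?mulr0.
by exists v; apply: vec_eq; rewrite /= ?mulr1 // mulrC divfK.
Qed.

End Values.

Section Fibres.
Variable L : closedFieldType.
Implicit Types (f : {ratfun L}) (P Q : option L).

Lemma rfibre_neq0 f Q : (0 < rdeg f)%N -> rfibre f Q != 0.
Proof.
case: Q => [y|] d0 /=; last exact: rden_neq0.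
apply: contraTneq d0 => /eqP; rewrite subr_eq0 => /eqP e.
have := coprimep_rnum_rden f; rewrite e => cop.
have s1 : size (rden f) = 1%N.
  rewrite (eqp_size (q := 1)) ?size_poly1 //; move/coprimepP: cop; apply=> //.
  by rewrite -mul_polyC dvdp_mull.
rewrite /rdeg /pdeg e -leqNgt geq_max; apply/andP; split; last by rewrite s1.
by have := size_scale_leq y (rden f); rewrite s1; case: (size _) => [|[]].
Qed.

Lemma rfibre_root f Q x : root (rfibre f Q) x -> reval f (Some x) = Q.
Proof.
have cop := coprimep_rnum_rden f.
case: Q => [y|]; rewrite /rfibre rootE /reval; last by move=> ->.
rewrite hornerD hornerN hornerZ subr_eq0 => /eqP e.
have d0 : (rden f).[x] != 0.
  apply/eqP => z0; have := coprimep_root cop (x := x).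
  by rewrite rootE e z0 mulr0 eqxx => /(_ isT).
by rewrite (negPf d0) e mulfK.
Qed.

Lemma rfibre_infty f Q : (0 < rdeg f)%N -> (pdeg (rfibre f Q) < rdeg f)%N -> reval f None = Q.
Proof.
move=> d0; have [sA sB nd] := ratfun_forms d0 => h.
have : (rfibre f Q)`_(rdeg f) = 0.
  rewrite nth_default //; move: h; rewrite /pdeg; move: (size _) => s; clear; lia.
case: Q h => [y|] h; rewrite /rfibre /reval; last by move=> ->; rewrite eqxx.
rewrite coefB coefZ => /eqP; rewrite subr_eq0 => /eqP e; rewrite e.
have z0 : (rden f)`_(rdeg f) != 0.
  apply/eqP => z0; have := nd (1, 0).
  by rewrite /fm /= !hev_10 e z0 mulr0 => /(_ erefl)[/eqP]; rewrite oner_eq0.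
by rewrite (negPf z0) mulfK.
Qed.

(** Without critical points the affine roots are simple, and the degree falls short of [rdeg f] by
    at most 1; a missing root is the point at infinity. *)
Lemma fibre_points f Q : (0 < rdeg f)%N -> (forall P, reval f P = Q -> ~ critical f P) ->
  separable_poly (rfibre f Q) /\ exists s : seq (option L),
    [/\ uniq s, size s = rdeg f & forall P, P \in s -> reval f P = Q].
Proof.
move=> d0 nc; have [r rE] := closed_field_poly_normal (rfibre f Q).
have q0 := rfibre_neq0 Q d0; have l0 : lead_coef (rfibre f Q) != 0 by rewrite lead_coef_eq0.
have ur : uniq r.
  apply: count_mem_uniq => x; rewrite -mu_prod_XsubC.
  have -> : mup x (\prod_(z <- r) ('X - z%:P)) = mup x (rfibre f Q).
    by rewrite rE -mul_polyC mupMr // rootC.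
  have [rx|rx] := boolP (root (rfibre f Q) x).
    have -> : x \in r by move: rx; rewrite rE rootZ // root_prod_XsubC.
    have := nc (Some x) (rfibre_root rx); rewrite /critical /ramification_index (rfibre_root rx).
    move/negP; rewrite -leqNgt => m1; apply/eqP; rewrite eqn_leq m1 mup_geq //.
    by rewrite expr1 dvdp_XsubCl.
  have -> : (x \in r) = false by apply: contraNF rx; rewrite rE rootZ // root_prod_XsubC.
  exact: mupNroot.
have sE : size (rfibre f Q) = (size r).+1 by rewrite rE size_scale // size_prod_XsubC.
have hr x : x \in r -> reval f (Some x) = Q.
  by move=> xr; apply: rfibre_root; rewrite rE rootZ // root_prod_XsubC.
have [sA sB _] := ratfun_forms d0.
have ld : (size r <= rdeg f)%N.
  rewrite -ltnS -sE; case: Q {nc rE q0 l0 sE hr} => [y|] //=.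
  rewrite (leq_trans (size_polyD _ _)) // geq_max sA size_polyN.
  exact: leq_trans (size_scale_leq _ _) sB.
split.
  by rewrite rE (eqp_separable (eqp_scale _ l0)) separable_prod_XsubC.
have us : uniq (map Some r) by rewrite map_inj_uniq // => x y [].
have [lt|ge] := ltnP (size r) (rdeg f); last first.
  exists (map Some r); split=> //; first by apply/eqP; rewrite size_map eqn_leq ld.
  by move=> P /mapP[x xr ->]; apply: hr.
have pE : pdeg (rfibre f Q) = size r by rewrite /pdeg sE.
have hN : reval f None = Q by apply: rfibre_infty => //; rewrite pE.
exists (None :: map Some r); split.
- by rewrite /= us andbT; apply/negP => /mapP[].
- have := nc None hN; rewrite /critical /ramification_index hN pE /= size_map.
  by move/negP; move: lt; clear; lia.
move=> P; rewrite inE => /orP[/eqP->//|/mapP[x xr ->]]; exact: hr.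
Qed.

(** A critical point mapped into the fibre of level [m] would make [Q] post-critical, so each step
    multiplies the number of points by the degree. *)
Lemma iterated_fibre f Q m : (0 < rdeg f)%N -> ~ post_critical f Q ->
  exists s : seq (option L), [/\ uniq s, size s = (rdeg f ^ m)%N &
    forall P, P \in s -> iter m (reval f) P = Q].
Proof.
move=> d0 npc; elim: m => [|m [s [us ss hs]]].
  by exists [:: Q]; split=> // P; rewrite inE => /eqP.
have step : forall s' : seq (option L), uniq s' -> {subset s' <= s} ->
    exists T : seq (option L), [/\ uniq T, size T = (size s' * rdeg f)%N &
      forall P, P \in T -> (reval f P : option L) \in s'].
  elim=> [|P s' IH]; first by exists [::].
  move=> /= /andP[Ps' us'] sub.
  have [|T [uT sT hT]] := IH us'; first by move=> x xs; apply: sub; rewrite inE xs orbT.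
  have nc P' : reval f P' = P -> ~ critical f P'.
    move=> e c; apply: npc; exists P', m.+1; split=> //.
    by rewrite iterSr e hs // sub // inE eqxx.
  have [_ [T1 [uT1 sT1 hT1]]] := fibre_points d0 nc.
  exists (T1 ++ T); split.
  - rewrite cat_uniq uT1 uT andbT; apply/hasPn => x /hT xs; apply/negP => /hT1 e.
    by move: Ps'; rewrite -e xs.
  - by rewrite size_cat sT1 sT mulSn.
  by move=> x; rewrite mem_cat inE => /orP[/hT1 ->|/hT ->]; rewrite ?eqxx ?orbT.
have [//|T [uT sT hT]] := step s us.
exists T; split=> //; first by rewrite sT ss expnS mulnC.
by move=> P /hT h; rewrite iterSr hs.
Qed.

End Fibres.

(** At a simple root of [A] the Wronskian is the product of the derivative of [A] and the value of
    [B], both nonzero. *)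
Lemma pwronsk_separable (F : fieldType) (A B : {poly F}) : coprimep A B -> separable_poly A ->
  (exists x, root A x) -> pwronsk A B != 0.
Proof.
move=> cop sep [x rx]; apply/eqP => W0; have := congr1 (fun q : {poly F} => q.[x]) W0.
rewrite /pwronsk hornerD hornerN !hornerM (eqP rx) mul0r subr0 horner0 => /eqP.
rewrite mulf_eq0 -!rootE => /orP[r1|r2].
  move: sep; rewrite unlock => /coprimep_root - /(_ x rx); by rewrite (eqP r1) eqxx.
by have := coprimep_root cop rx; rewrite (eqP r2) eqxx.
Qed.

(** * Heights in an orbit *)

Definition pht (k : fieldType) (P : option {ratfun k}) : nat :=
  maxn (pdeg (pt_num P)) (pdeg (pt_den P)).

Lemma coprimep_pt (k : fieldType) (P : option {ratfun k}) : coprimep (pt_num P) (pt_den P).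
Proof. by case: P => [x|] /=; [exact: coprimep_rnum_rden | exact: coprime1p]. Qed.

Lemma pt_inj (k : fieldType) (P Q : option {ratfun k}) (a b : k) : a != 0 -> b != 0 ->
  a *: pt_num P = b *: pt_num Q -> a *: pt_den P = b *: pt_den Q -> P = Q.
Proof.
case: P Q => [x|] [y|] //= a0 b0 e1 e2.
- congr Some; rewrite [x]ratfunE [y]ratfunE.
  apply/eqP; rewrite eqr_div ?tofrac_neq0 ?rden_neq0 //; apply/eqP.
  rewrite -!tofracM; congr tofrac.
  have ab0 : a * b != 0 by rewrite mulf_neq0.
  apply: (scalerI ab0); rewrite -!scalerA.
  have -> : b *: (rnum x * rden y) = rnum x * (b *: rden y) by rewrite scalerAr.
  have -> : b *: (rnum y * rden x) = (b *: rnum y) * rden x by rewrite scalerAl.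
  by rewrite -e1 -e2 -scalerAr -scalerAl.
- by move/eqP: e2; rewrite scaler0 scaler_eq0 (negPf a0) (negPf (rden_neq0 x)).
by move/eqP: e2; rewrite scaler0 eq_sym scaler_eq0 (negPf b0) (negPf (rden_neq0 y)).
Qed.

Fixpoint small_polys (k : fieldType) (r : seq k) (B : nat) : seq {poly k} :=
  if B is B'.+1 then [seq u * 'X + c%:P | u <- small_polys r B', c <- r] else [:: 0].

Lemma mem_small_polys (k : fieldType) (r : seq k) B (u : {poly k}) :
  (size u <= B)%N -> (forall i, u`_i \in r) -> u \in small_polys r B.
Proof.
elim: B u => [|B IH] u su ur.
  by rewrite inE -size_poly_leq0.
have uE : u = (\poly_(i < B) u`_i.+1) * 'X + (u`_0)%:P.
  apply/polyP => -[|i]; rewrite coefD coefMX coefC /= ?add0r // addr0 coef_poly.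
  by case: ltnP => // h; rewrite nth_default // (leq_trans su).
rewrite uE /=; apply: allpairs_f; last exact: ur.
apply: IH; first exact: size_poly.
move=> i; rewrite coef_poly; case: ltnP => // _.
by rewrite -(nth_default 0 (leqnn (size u))) ur.
Qed.

Lemma unbounded_seq (Z : nat -> Prop) : (forall n0, exists n, (n0 <= n)%N /\ Z n) ->
  forall N, exists s : seq nat, [/\ uniq s, size s = N & forall n, n \in s -> Z n].
Proof.
move=> h; elim=> [|N [s [us ss hs]]]; first by exists [::].
have [n [nb Zn]] := h (\max_(i <- s) i).+1; exists (n :: s); split=> /=.
- rewrite us andbT; apply/negP => ns.
  by have := leq_bigmax_seq (P := xpredT) (F := fun i : nat => i) n ns isT; rewrite leqNgt nb.
- by rewrite ss.
by move=> i; rewrite inE => /orP[/eqP->|/hs].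
Qed.

Section Northcott.
Variables (p : nat) (p_prime : prime p) (k : closedFieldType) (e : {rmorphism 'F_p -> k}).
Hypothesis k_alg : algebraic_extension e.

Lemma pchar_alg : p \in [pchar k].
Proof. exact: (rmorph_pchar e (pchar_Fp p_prime)). Qed.

(** All [x ^ (p ^ i)] are roots of one polynomial over the prime field, so two coincide, and
    injectivity of Frobenius cancels the smaller exponent. *)
Lemma alg_frobenius (x : k) : exists2 r, (0 < r)%N & x ^+ (p ^ r) = x.
Proof.
have pk := pchar_alg; have [P P0 rP] := k_alg x.
have PE : map_poly (pFrobenius_aut pk) (map_poly e P) = map_poly e P.
  apply/polyP => i; rewrite !coef_map /= pFrobenius_autE -rmorphXn; congr (e _).
  by have := expf_card P`_i; rewrite card_Fp.
have hx i : root (map_poly e P) (x ^+ (p ^ i)).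
  elim: i => [|i IH]; first by rewrite expn0 expr1.
  by rewrite expnSr exprM rootE -{1}PE horner_frob (eqP IH) expr0n gtn_eqF // prime_gt0.
have eP0 : map_poly e P != 0 by rewrite map_poly_eq0.
have : ~~ uniq [seq x ^+ (p ^ i) | i <- seq.iota 0 (size (map_poly e P))].
  apply/negP => u; have := max_poly_roots eP0 _ u.
  rewrite size_map size_iota ltnn => h; have : false; last by [].
  by apply: h; apply/allP => y /mapP[i _ ->].
move=> /(uniqPn 0)[i [l [il]]]; rewrite size_map size_iota => ls.
rewrite !(nth_map 0%N) ?size_iota // ?(ltn_trans il) // !nth_iota ?(ltn_trans il) // !add0n.
move=> E; exists (l - i)%N; first by rewrite subn_gt0.
have inj : injective (fun y : k => y ^+ (p ^ i)).
  elim: (i) => [|i' IH] y z /=; first by rewrite !expr1.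
  rewrite expnSr !exprM => h; apply: IH; apply: (fmorph_inj (pFrobenius_aut pk)).
  exact: h.
by apply: inj => /=; rewrite -exprM -expnD subnK // ltnW.
Qed.

Lemma frobenius_period (x : k) r s : x ^+ (p ^ r) = x -> x ^+ (p ^ (r * s)) = x.
Proof.
move=> h; elim: s => [|s IH]; first by rewrite muln0 expn0 expr1.
by rewrite mulnS expnD exprM h.
Qed.

Lemma common_frobenius (s : seq k) : exists2 r, (0 < r)%N & forall x, x \in s -> x ^+ (p ^ r) = x.
Proof.
elim: s => [|x s [r r0 IH]]; first by exists 1%N.
have [r' r'0 hx] := alg_frobenius x; exists (r * r')%N; first by rewrite muln_gt0 r0.
move=> y; rewrite inE => /orP[/eqP->|/IH h]; last exact: frobenius_period.
by rewrite mulnC frobenius_period.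
Qed.

Lemma frobenius_morphism r : exists s : {rmorphism k -> k}, forall x, s x = x ^+ (p ^ r).
Proof.
have pk := pchar_alg; elim: r => [|r [s hs]].
  by exists idfun => x; rewrite expn0 expr1.
exists (pFrobenius_aut pk \o s) => x.
by rewrite /= hs pFrobenius_autE expnSr exprM.
Qed.

Lemma poly_frobenius (S : seq {poly k}) : exists r (s : {rmorphism k -> k}),
  [/\ (0 < r)%N, forall x, s x = x ^+ (p ^ r) & forall u, u \in S -> map_poly s u = u].
Proof.
have [r r0 hr] := common_frobenius (flatten [seq polyseq u | u <- S]).
have [s hs] := frobenius_morphism r; exists r, s; split=> // u uS.
apply/polyP => i; rewrite coef_map /= hs.
have [iu|ui] := ltnP i (size u); last by rewrite nth_default // expr0n expn_eq0 -leqn0 leqNgt prime_gt0.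
apply: hr; apply/flattenP; exists (polyseq u); last exact: mem_nth.
by apply/mapP; exists u.
Qed.

(** Hilbert 90: a point fixed projectively has [s X = l X] and [s Y = l Y] with the same [l].
    Scaling by [c] with [c ^ (q - 1) = 1 / l], [q = p ^ r], makes both coordinates fixed. *)
Lemma fixed_scale (s : {rmorphism k -> k}) r (X Y : {poly k}) : (0 < r)%N ->
  (forall x, s x = x ^+ (p ^ r)) -> coprimep X Y ->
  map_poly s X * Y = X * map_poly s Y ->
  exists c, [/\ c != 0, map_poly s (c *: X) = c *: X & map_poly s (c *: Y) = c *: Y].
Proof.
move=> r0 hs cop E.
have step (U V : {poly k}) : U != 0 -> coprimep U V -> map_poly s U * V = U * map_poly s V ->
    exists l, [/\ l != 0, map_poly s U = l *: U & map_poly s V = l *: V].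
  move=> U0 cUV EUV.
  have dU : U %| map_poly s U.
    by rewrite -(Gauss_dvdpl _ cUV) EUV dvdp_mulIl.
  have : U %= map_poly s U by rewrite -dvdp_size_eqp // size_map_poly.
  move=> /eqpP[[c1 c2] /= /andP[c10 c20] ce].
  have UE : map_poly s U = (c1 / c2) *: U.
    by rewrite mulrC -scalerA ce scalerA mulVf // scale1r.
  exists (c1 / c2); split=> //; first by rewrite mulf_neq0 // invr_eq0.
  by apply: (mulfI U0); rewrite -EUV UE -scalerAl scalerAr.
have [l [l0 eX eY]] : exists l, [/\ l != 0, map_poly s X = l *: X & map_poly s Y = l *: Y].
  have [X0|X0] := eqVneq X 0; last exact: step.
  have Y0 : Y != 0 by apply: contraTneq cop => Y0; rewrite X0 Y0 /coprimep gcd0p size_poly0.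
  have [||l [l0 eY eX]] := @step Y X Y0; last by exists l.
    by rewrite coprimep_sym.
  by rewrite mulrC -E mulrC.
have q1 : (1 < p ^ r)%N by rewrite -(expn0 p) ltn_exp2l // prime_gt1.
have q0 : (0 < (p ^ r).-1)%N by move: q1; case: (p ^ r)%N => [|[]].
have [c cE] := ex_proot l^-1 q0.
have c0 : c != 0.
  by apply/eqP => c0; move/eqP: cE; rewrite c0 expr0n (gtn_eqF q0) eq_sym invr_eq0 (negPf l0).
have sc : s c * l = c.
  by rewrite hs -(prednK (ltnW q1)) exprS cE -mulrA mulVf // mulr1.
by exists c; split=> //; rewrite map_polyZ /= ?eX ?eY scalerA sc.
Qed.

(* A power of Frobenius fixes [A], [B] and [P 0], hence the whole orbit, so that points
   of bounded height have coordinates in a finite field. *)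
Lemma northcott d (A B : {poly {poly k}}) (P : nat -> option {ratfun k}) : injective P ->
  (forall n, exists g, [/\ g != 0, hev d A (pt_num (P n)) (pt_den (P n)) = g * pt_num (P n.+1) &
     hev d B (pt_num (P n)) (pt_den (P n)) = g * pt_den (P n.+1)]) ->
  forall H, exists n0, forall n, (n0 <= n)%N -> (H <= pht (P n))%N.
Proof.
move=> injP hP H.
have [r [s [r0 hs fix_]]] := poly_frobenius ([:: pt_num (P 0%N); pt_den (P 0%N)] ++ A ++ B).
have fixp (C : {poly {poly k}}) : {subset (C : seq _) <= A ++ B} ->
    map_poly (map_poly s) C = C.
  move=> sub; apply/polyP => i; rewrite coef_map /=.
  have [iC|Ci] := ltnP i (size C); last by rewrite nth_default // rmorph0.
  by apply: fix_; rewrite mem_cat sub ?orbT // mem_nth.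
have fA : map_poly (map_poly s) A = A by apply: fixp => u uA; rewrite mem_cat uA.
have fB : map_poly (map_poly s) B = B by apply: fixp => u uB; rewrite mem_cat uB orbT.
have stab n : exists c, [/\ c != 0, map_poly s (c *: pt_num (P n)) = c *: pt_num (P n) &
    map_poly s (c *: pt_den (P n)) = c *: pt_den (P n)].
  elim: n => [|n [c [c0 eX eY]]].
    by exists 1; rewrite oner_neq0 !scale1r !fix_ // !inE eqxx ?orbT.
  apply: fixed_scale hs (coprimep_pt _) _ => //.
  have [g [g0 hA hB]] := hP n.
  have sg0 : map_poly s g != 0 by rewrite map_poly_eq0.
  have hev_fix (C : {poly {poly k}}) : map_poly (map_poly s) C = C ->
      map_poly s (c%:P ^+ d * hev d C (pt_num (P n)) (pt_den (P n))) =
      c%:P ^+ d * hev d C (pt_num (P n)) (pt_den (P n)).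
    by move=> fC; rewrite -hevZ !mul_polyC (hev_rmorph (map_poly s)) fC /= eX eY.
  have := hev_fix A fA; have := hev_fix B fB; rewrite hA hB !rmorphM /=.
  have sc0 : map_poly s (c%:P ^+ d) != 0 by rewrite map_poly_eq0 expf_neq0 // polyC_eq0.
  move: (c%:P ^+ d) (map_poly s (c%:P ^+ d)) sc0 => w' w w0.
  move: (map_poly s g) sg0 => g' g'0.
  move: (pt_num _) (pt_den _) (map_poly s (pt_num _)) (map_poly s (pt_den _)) => x y x' y' ey ex.
  apply: (mulfI (mulf_neq0 w0 (mulf_neq0 g'0 (mulf_neq0 w0 g'0)))).
  have -> : w * (g' * (w * g')) * (x' * y) = (w * (g' * x')) * (w * g' * y) by ring.
  have -> : w * (g' * (w * g')) * (x * y') = (w * (g' * y')) * (w * g' * x) by ring.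
  by rewrite ex ey; ring.
have [//|nn] := pselect (exists n0, forall n, (n0 <= n)%N -> (H <= pht (P n))%N).
have unb n0 : exists n, (n0 <= n)%N /\ ~~ (H <= pht (P n))%N.
  apply: contrapT => hn; apply: nn; exists n0 => n ln; apply/negPn/negP => h.
  by apply: hn; exists n.
have [R hR] : exists R : seq k, forall x, s x = x -> x \in R.
  have q1 : (1 < p ^ r)%N by rewrite -(expn0 p) ltn_exp2l // prime_gt1.
  have sX : size ('X^(p ^ r) - 'X : {poly k}) = (p ^ r).+1.
    by rewrite size_polyDl size_polyXn // size_polyN size_polyX.
  have [R RE] := closed_field_poly_normal ('X^(p ^ r) - 'X : {poly k}).
  have l0 : lead_coef ('X^(p ^ r) - 'X : {poly k}) != 0.
    by rewrite lead_coef_eq0 -size_poly_gt0 sX.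
  exists R => x sx; rewrite -root_prod_XsubC -(rootZ _ _ l0) -RE rootE.
  by rewrite hornerD hornerN hornerXn hornerX -hs sx subrr.
have /choice[c hc] := stab.
pose key n := (c n *: pt_num (P n), c n *: pt_den (P n)).
pose keys := [seq (u, v) | u <- small_polys R H, v <- small_polys R H].
have key_in n : ~~ (H <= pht (P n))%N -> key n \in keys.
  have [c0 eX eY] := hc n; rewrite -ltnNge => hn.
  have sm (u : {poly k}) : (pdeg u < H)%N -> map_poly s (c n *: u) = c n *: u ->
      c n *: u \in small_polys R H.
    move=> du fu; apply: mem_small_polys.
      rewrite size_scale //; move: du; rewrite /pdeg; case: (size u) => //.
    by move=> i; apply: hR; rewrite -coef_map fu.
  have [h1 h2] : (pdeg (pt_num (P n)) < H)%N /\ (pdeg (pt_den (P n)) < H)%N.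
    by move: hn; rewrite /pht gtn_max => /andP[].
  by apply: allpairs_f; apply: sm.
have [S [uS sS hS]] := unbounded_seq unb (size keys).+1.
have : uniq (map key S).
  rewrite map_inj_uniq // => m n [h1 h2]; apply: injP.
  by have [cm _ _] := hc m; have [cn _ _] := hc n; apply: pt_inj cm cn h1 h2.
move/uniq_leq_size => /(_ keys); rewrite size_map sS ltnn => h; have : false; last by [].
by apply: h => y /mapP[n nS ->]; apply/key_in/hS.
Qed.

End Northcott.

(** * Iterated forms *)

Section IteratedForms.

(* [x] and a new indeterminate in place of [y]: this reduces the claim to [y != 0]. *)
Lemma hev_generic (F : fieldType) n (A : {poly F}) (x y : F) :
  hev n A x y = (hev n (map_poly polyC A) x%:P 'X).[y].
Proof.
rewrite -/(horner_eval y _) hev_rmorph; congr (hev _ _ _ _).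
- by apply/polyP => i; rewrite !coef_map /= /horner_eval hornerC.
- by rewrite /= /horner_eval hornerC.
by rewrite /= /horner_eval hornerX.
Qed.

Lemma hev_hsub (F : fieldType) n d (P A B : {poly F}) x y :
  (size A <= d.+1)%N -> (size B <= d.+1)%N ->
  hev (n * d) (hsub n P A B) x y = hev n P (hev d A x y) (hev d B x y).
Proof.
have aff (E : fieldType) (P' A' B' : {poly E}) u v : v != 0 ->
    (size A' <= d.+1)%N -> (size B' <= d.+1)%N ->
    hev (n * d) (hsub n P' A' B') u v = hev n P' (hev d A' u v) (hev d B' u v).
  move=> v0 sA sB; rewrite (hev_horner _ (size_hsub n P' sA sB) v0) horner_hsub.
  by rewrite (hev_horner _ sA v0) (hev_horner _ sB v0) hevZ mulnC exprM.
move=> sA sB; pose c : {rmorphism F -> {poly F}} := polyC.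
pose i : {rmorphism F -> {ratfun F}} := @tofrac {poly F} \o c.
have X0 : ('X)%:F != 0 :> {ratfun F} by rewrite tofrac_neq0 // polyX_eq0.
have := @aff _ (map_poly i P) (map_poly i A) (map_poly i B) (i x) _ X0.
rewrite !size_map_poly -map_hsub => /(_ sA sB).
have ev m (Q : {poly F}) : hev m (map_poly i Q) (i x) ('X)%:F =
    (hev m (map_poly c Q) (c x) 'X)%:F.
  by rewrite (hev_rmorph (@tofrac {poly F})) -map_poly_comp.
have ev2 m (Q : {poly F}) (u v : {poly F}) : hev m (map_poly i Q) u%:F v%:F =
    (hev m (map_poly c Q) u v)%:F.
  by rewrite (hev_rmorph (@tofrac {poly F})) -map_poly_comp.
rewrite !ev ev2 => /eqP; rewrite tofrac_eq => /eqP h.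
have := congr1 (fun q : {poly F} => q.[y]) h; rewrite -hev_generic => ->.
rewrite -/(horner_eval y _) hev_rmorph; congr (hev _ _ _ _).
- by apply/polyP => m; rewrite !coef_map /= /horner_eval hornerC.
- by rewrite /= /horner_eval -hev_generic.
by rewrite /= /horner_eval -hev_generic.
Qed.

(* The pullback of the form [T] of degree 1 by the [m]-th iterate of [(A : B)]. *)
Fixpoint iform (R : comNzRingType) d (A B T : {poly R}) m : {poly R} :=
  if m is m'.+1 then hsub (d ^ m') (iform d A B T m') A B else T.

Lemma map_iform (R S : comNzRingType) (f : {rmorphism R -> S}) d (A B T : {poly R}) m :
  map_poly f (iform d A B T m) = iform d (map_poly f A) (map_poly f B) (map_poly f T) m.
Proof. by elim: m => //= m IH; rewrite map_hsub IH. Qed.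

Variables (F : fieldType) (d : nat) (A B T : {poly F}).
Hypotheses (sA : (size A <= d.+1)%N) (sB : (size B <= d.+1)%N) (sT : (size T <= 2)%N).

Lemma size_iform m : (size (iform d A B T m) <= (d ^ m).+1)%N.
Proof. by case: m => [//|m] /=; rewrite expnSr size_hsub. Qed.

Lemma hev_iform m x y : hev (d ^ m.+1) (iform d A B T m.+1) x y =
  hev (d ^ m) (iform d A B T m) (hev d A x y) (hev d B x y).
Proof. by rewrite /= expnSr hev_hsub. Qed.

End IteratedForms.

(** The map is surjective on [P^1(L)]: a point where the form does not vanish has a preimage, and
    the pullback does not vanish there. *)
Lemma iform_neq0 (L : closedFieldType) d (A B T : {poly L}) m : (0 < d)%N ->
  (size A <= d.+1)%N -> (size B <= d.+1)%N -> (size T <= 2)%N ->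
  (forall v, fm d A B v = (0, 0) -> v = (0, 0)) -> T != 0 ->
  iform d A B T m != 0.
Proof.
move=> d0 sA sB sT nd T0.
suff [v vm] : exists v, hev (d ^ m) (iform d A B T m) v.1 v.2 != 0.
  by apply: contraNneq vm => ->; rewrite hev0.
elim: m => [|m [w hw]].
  apply: contrapT => h; case/eqP: T0; apply: poly_fun_inj => z; rewrite horner0.
  apply: contrapT => /eqP hz; apply: h; exists (z, 1); by rewrite /= expn0 hev_x1.
have w0 : w <> (0, 0).
  move=> w0; move: hw; rewrite w0 /=.
  have := hevZ (d ^ m) (iform d A B T m) 0 1 1.
  by rewrite !mul0r expr0n expn_eq0 (gtn_eqF d0) /= mul0r => ->; rewrite eqxx.
have sC : (size (w.2 *: A - w.1 *: B)%R <= d.+1)%N.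
  by rewrite (leq_trans (size_polyD _ _)) // size_polyN geq_max !(leq_trans (size_scale_leq _ _)).
have [v [v0 hv]] := form_root d0 sC.
have hv' : wedge w (fm d A B v) = 0.
  rewrite -[RHS]oppr0 -hv -scaleNr hevD !hevZl /wedge /fm /=; ring.
have [s sE] := wedge_eq0 w0 hv'.
have s0 : s != 0.
  by apply/eqP => s0; apply: v0; apply: nd; rewrite sE s0; apply: vec_eq; rewrite /= mul0r.
exists v; rewrite hev_iform //.
have -> : hev d A v.1 v.2 = s * w.1 by have := congr1 fst sE.
have -> : hev d B v.1 v.2 = s * w.2 by have := congr1 snd sE.
by rewrite hevZ mulf_neq0 // expf_neq0.
Qed.

Lemma rmap_forms (F E : fieldType) (j : {rmorphism F -> E}) (f : {ratfun F}) :
  exists2 c, c != 0 & rnum (rmap j f) = c *: map_poly j (rnum f) /\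
    rden (rmap j f) = c *: map_poly j (rden f).
Proof.
apply: rnum_rden_uniq (erefl _); last by rewrite map_poly_eq0 rden_neq0.
by rewrite coprimep_map coprimep_rnum_rden.
Qed.

Lemma rdeg_rmap (F E : fieldType) (j : {rmorphism F -> E}) (f : {ratfun F}) :
  rdeg (rmap j f) = rdeg f.
Proof.
have [c c0 [e1 e2]] := rmap_forms j f.
by rewrite /rdeg /pdeg e1 e2 !size_scale // !size_map_poly.
Qed.

Lemma iform_fibre (F : fieldType) (f : {ratfun F}) c (A B T : {poly F}) (Q : option F) :
  (0 < rdeg f)%N -> A = c *: rnum f -> B = c *: rden f -> (size T <= 2)%N ->
  hev 1 T (pvec Q).1 (pvec Q).2 = 0 ->
  forall m P, iter m (reval f) P = Q ->
  hev (rdeg f ^ m) (iform (rdeg f) A B T m) (pvec P).1 (pvec P).2 = 0.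
Proof.
move=> d0 AE BE sT hT; have [sA sB _] := ratfun_forms d0.
have sA' : (size A <= (rdeg f).+1)%N by rewrite AE (leq_trans (size_scale_leq _ _)).
have sB' : (size B <= (rdeg f).+1)%N by rewrite BE (leq_trans (size_scale_leq _ _)).
elim=> [|m IH] P; first by move=> /= ->.
rewrite iterSr => /IH h; rewrite hev_iform //.
have [s sE] := reval_fm P d0.
have [e1 e2] : hev (rdeg f) A (pvec P).1 (pvec P).2 = c * s * (pvec (reval f P : option F)).1 /\
    hev (rdeg f) B (pvec P).1 (pvec P).2 = c * s * (pvec (reval f P : option F)).2.
  rewrite AE BE !hevZl; have := congr1 fst sE; have := congr1 snd sE; rewrite /fm /vscale /=.
  by move=> -> ->; rewrite !mulrA.
by rewrite e1 e2 hevZ h mulr0.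
Qed.

(** The coordinate [1 / (x - c)] sends infinity to 0 and, as [c] is not a root, no point of [S] to
    infinity. The [D] points become [D] distinct affine roots. *)
Lemma form_separable (F : fieldType) D (P : {poly F}) c (S : seq (option F)) :
  (size P <= D.+1)%N -> P.[c] != 0 -> uniq S -> size S = D ->
  (forall Q, Q \in S -> hev D P (pvec Q).1 (pvec Q).2 = 0) ->
  separable_poly (hsub D P (lin c 1) (lin 1 0)) /\ size (hsub D P (lin c 1) (lin 1 0)) = D.+1.
Proof.
move=> sP Pc uS sS hS; have [sH cH] := hsub_lin D P c 1 1 0.
pose g (Q : option F) := if Q is Some x then (x - c)^-1 else 0.
have nc x : Some x \in S -> x - c != 0.
  move=> /hS /=; rewrite hev_x1 // => h; rewrite subr_eq0.
  by apply: contraNneq Pc => <-; rewrite h.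
have sg : size (map g S) = D by rewrite size_map.
rewrite -{3}sg; apply: separable_of_roots; rewrite ?sg //.
- by apply: contraNneq Pc => H0; move: cH; rewrite H0 coef0 hev_x1 // => <-.
- apply/allP => z /mapP[[x|] QS ->] /=; rewrite rootE horner_hsub !horner_lin; last first.
    by have := hS _ QS; rewrite /= !mulr0 !add0r => ->.
  have x0 := nc _ QS; have := hS _ QS; rewrite /= => h.
  have -> : c * (x - c)^-1 + 1 = (x - c)^-1 * x by field.
  by rewrite mul1r addr0 -[X in hev _ _ _ X]mulr1 hevZ h mulr0.
rewrite map_inj_in_uniq // => -[x|] [y|] xS yS //= e.
- by have := invr_inj e => /(addIr _) ->.
- by have := nc _ xS; rewrite -invr_eq0 e eqxx.
by have := nc _ yS; rewrite -invr_eq0 -e eqxx.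
Qed.

Lemma closed_infinite (k : closedFieldType) N : exists s : seq k, uniq s /\ size s = N.
Proof.
elim: N => [|N [s [us ss]]]; first by exists [::].
have [s0|s0] := posnP (size s).
  by exists [:: 0]; rewrite -ss s0.
have sE : size (\prod_(x <- s) ('X - x%:P) + 1) = (size s).+1.
  by rewrite size_polyDl size_prod_XsubC // size_poly1.
have /closed_rootP[y ry] : size (\prod_(x <- s) ('X - x%:P) + 1) != 1%N.
  by rewrite sE eqSS -lt0n.
exists (y :: s); rewrite /= us ss andbT; split=> //; apply/negP => ys.
move: ry; rewrite rootE hornerD hornerC.
have /eqP-> : root (\prod_(x <- s) ('X - x%:P)) y by rewrite root_prod_XsubC.
by rewrite add0r oner_eq0.
Qed.

Lemma constant_nonroot (k : closedFieldType) (K : fieldType) (i : {rmorphism k -> K})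
  (P : {poly K}) : P != 0 -> exists c, P.[i c] != 0.
Proof.
move=> P0; have [s [us ss]] := closed_infinite k (size P).
apply: contrapT => h; have := max_poly_roots (rs := map i s) P0.
rewrite size_map ss ltnn map_inj_uniq; last exact: fmorph_inj.
move=> h'; have : false; last by [].
apply: h' => //; apply/allP => x /mapP[y _ ->]; apply/negPn/negP => r.
by apply: h; exists y; rewrite -rootE.
Qed.

Lemma bezout_scale (F : fieldType) (r : F) (U V A B : {poly F}) : U * A + V * B = 1 ->
  r *: U * A + r *: V * B = r%:P.
Proof. by move=> h; rewrite -!scalerAl -scalerDr h -mul_polyC mulr1. Qed.

(** * Heights and cancellation along an orbit *)

Section Orbit.
Variable k : fieldType.
Implicit Types (X Y g : {poly k}) (P Q : option {ratfun k}).

Lemma hev_pdeg n (A : {poly {poly k}}) : exists C, forall X Y,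
  (pdeg (hev n A X Y) <= n * maxn (pdeg X) (pdeg Y) + C)%N.
Proof.
exists (\max_(i < n.+1) size (A`_i)%R)%N => X Y; set h := maxn _ _.
suff : (size (hev n A X Y) <= (n * h + \max_(i < n.+1) size (A`_i)%R).+1)%N.
  by rewrite /pdeg; move: (size _) => s; clear; lia.
rewrite /hev; apply: leq_trans (size_sum _ _ _) _; apply/bigmax_leqP => i _.
have s1 (U : {poly k}) m : (pdeg U <= h)%N -> (size (U ^+ m)%R <= (m * h).+1)%N.
  move=> Uh; apply: leq_trans (size_poly_exp_leq _ _) _; rewrite ltnS mulnC leq_mul2l.
  by rewrite -/(pdeg U) Uh orbT.
have sA : (size (A`_i)%R <= \max_(i < n.+1) size (A`_i)%R)%N by exact: (leq_bigmax i).
have sX := s1 X i (leq_maxl _ _); have sY := s1 Y (n - i)%N (leq_maxr _ _).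
have nE : (n * h = i * h + (n - i) * h)%N by rewrite -mulnDl subnKC // -ltnS.
apply: leq_trans (size_polyMleq _ _) _.
have := size_polyMleq A`_i (X ^+ i); move: sA sX sY; rewrite nE.
move: (i * h)%N ((n - i) * h)%N (size (A`_i * X ^+ i)%R) (size (X ^+ i)) (size (Y ^+ (n - i))).
move: (size A`_i) (\max_(i0 < n.+1) _)%N; clear; lia.
Qed.

Lemma pt_vec P : exists2 s : {ratfun k}, s != 0 &
  ((pt_num P)%:F, (pt_den P)%:F) = vscale s (pvec P).
Proof.
case: P => [x|]; last by exists 1; [exact: oner_neq0 | apply: vec_eq; rewrite /= mul1r].
exists (rden x)%:F; first by rewrite tofrac_neq0 // rden_neq0.
apply: vec_eq; rewrite /= ?mulr1 // mulrC {2}[x]ratfunE divfK //.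
by rewrite tofrac_neq0 // rden_neq0.
Qed.

Lemma coprime_parallel (u v X Y : {poly k}) : coprimep X Y -> u * Y = v * X ->
  exists g, u = g * X /\ v = g * Y.
Proof.
move=> cop e; have [X0|X0] := eqVneq X 0; last first.
  have /dvdpP[g uE] : X %| u by rewrite -(Gauss_dvdpl _ cop) e dvdp_mull.
  exists g; split=> //; apply: (mulIf X0); rewrite -e uE; ring.
have Y0 : Y != 0 by apply: contraTneq cop => Y0; rewrite X0 Y0 /coprimep gcd0p size_poly0.
have /dvdpP[g vE] : Y %| v.
  by rewrite coprimep_sym in cop; rewrite -(Gauss_dvdpl v cop) -e dvdp_mull.
exists g; split=> //; apply: (mulIf Y0); rewrite e vE; ring.
Qed.

(* A resultant: it bounds the common factors of two forms at coprime arguments. *)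
Lemma common_factor_bound d (A B : {poly {poly k}}) : (0 < d)%N ->
  (size A <= d.+1)%N -> (size B <= d.+1)%N -> coprimep (fmap A) (fmap B) ->
  (A`_d != 0) || (B`_d != 0) ->
  exists2 r, r != 0 & forall X Y g, coprimep X Y -> Y != 0 ->
    g %| hev d A X Y -> g %| hev d B X Y -> g %| r.
Proof.
move=> d0 sA sB cop AB.
have [[U V] /= UV] := Bezout_eq1_coprimepP _ _ cop.
have [r1 [U0 [V0 [r10 eU eV]]]] := clear_denom2 U V.
have UV0 : U0 * A + V0 * B = r1%:P.
  apply: fmap_inj; rewrite /fmap rmorphD !rmorphM /= map_polyC -/(fmap _) /=.
  rewrite -/(fmap U0) -/(fmap V0) -/(fmap A) -/(fmap B) -eU -eV.
  exact: bezout_scale UV.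
pose N := maxn (size U0) (size V0).
have sU : (size U0 <= N.+1)%N by rewrite leqW // leq_maxl.
have sV : (size V0 <= N.+1)%N by rewrite leqW // leq_maxr.
have key X Y : Y != 0 -> hev N U0 X Y * hev d A X Y + hev N V0 X Y * hev d B X Y =
    r1 * Y ^+ (N + d).
  move=> Y0; have Y0' : Y%:F != 0 :> {ratfun k} by rewrite tofrac_neq0.
  apply/eqP; rewrite -(tofrac_eq (R := {poly k})) tofracD !tofracM tofracXn; apply/eqP.
  have hE n (C : {poly {poly k}}) : (size C <= n.+1)%N ->
      (hev n C X Y)%:F = Y%:F ^+ n * (fmap C).[X%:F / Y%:F].
    by move=> sC; rewrite (hev_rmorph (@tofrac {poly k})) hev_horner ?size_fmap.
  rewrite !hE //; have := congr1 (fun q => (fmap q).[X%:F / Y%:F]) UV0.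
  rewrite /fmap rmorphD !rmorphM /= map_polyC hornerD !hornerM hornerC /= => <-.
  rewrite exprD; move: (_ ^+ N) (_ ^+ d) (_.[_]) => y1 y2 u.
  move: (_.[_]) (_.[_]) (_.[_]) => a v b; ring.
(* The form that does not vanish at infinity is the one with which [dvdp_reduce] replaces the power
   of [Y] by a fixed polynomial. *)
have [C [CAB Cd]] : exists C, (C = A \/ C = B) /\ C`_d != 0.
  by case/orP: AB => h; [exists A | exists B]; split=> //; [left | right].
exists (r1 * C`_d ^+ (N + d)); first by rewrite mulf_neq0 // expf_neq0.
move=> X Y g cXY Y0 gA gB.
have [q qE] := hev_mod d C X Y.
apply: (dvdp_reduce (X := X) (Y := Y) (s := d) (q := q)) => //.
  by rewrite -(key X Y Y0) dvdp_add // dvdp_mull.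
by rewrite -qE; case: CAB => ->.
Qed.

End Orbit.

Lemma mulf_eq0_left (F : fieldType) (a b : F) : a != 0 -> a * b = 0 -> b = 0.
Proof. by move=> a0 /eqP; rewrite mulf_eq0 (negPf a0) => /eqP. Qed.

Lemma pvec_neq0 (F : fieldType) (P : option F) : pvec P <> (0, 0).
Proof. by case: P => [x|] [] => [_|] /eqP; rewrite oner_eq0. Qed.

Lemma vscale0 (F : fieldType) (v : F * F) : vscale 0 v = (0, 0).
Proof. by rewrite /vscale !mul0r. Qed.

Lemma shuffle_vec (R : comNzRingType) (s t x y : R) : s * x * (t * y) = s * y * (t * x).
Proof. by ring. Qed.

Lemma coprimep_scaled (F : fieldType) (c : F) (A B : {poly F}) : c != 0 -> coprimep A B ->
  coprimep (c *: A) (c *: B).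
Proof. by move=> c0 h; rewrite coprimepZl // coprimepZr. Qed.

Section OrbitEstimates.
Variables (k : fieldType) (phi : {ratfun {ratfun k}}) (e : {poly k}) (A B : {poly {poly k}}).
Let d := rdeg phi.
Hypotheses (d0 : (0 < d)%N) (e0 : e != 0) (eA : e%:F *: rnum phi = fmap A)
  (eB : e%:F *: rden phi = fmap B).
Implicit Types (P Q : option {ratfun k}) (T : {poly {poly k}}).

Let eF0 : e%:F != 0 :> {ratfun k} := tofrac_neq0 e0.

Lemma size_forms : (size A <= d.+1)%N /\ (size B <= d.+1)%N.
Proof.
have [sA sB _] := ratfun_forms d0.
by rewrite -(size_fmap A) -(size_fmap B) -eA -eB !(leq_trans (size_scale_leq _ _)).
Qed.

Lemma fm_forms P : exists2 s : {ratfun k}, s != 0 &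
  ((hev d A (pt_num P) (pt_den P))%:F, (hev d B (pt_num P) (pt_den P))%:F) =
  vscale s (pvec (reval phi P : option _)).
Proof.
have [sA sB nd] := ratfun_forms d0.
have [s sE] := reval_fm P d0; have [s' s'0 s'E] := pt_vec P.
have ->: ((hev d A (pt_num P) (pt_den P))%:F, (hev d B (pt_num P) (pt_den P))%:F) =
    vscale (e%:F * s' ^+ d * s) (pvec (reval phi P : option _)).
  rewrite -vscaleA -sE -vscaleA -fm_scale -s'E !(hev_rmorph (@tofrac {poly k})).
  by rewrite -/(fmap A) -/(fmap B) -eA -eB !hevZl.
exists (e%:F * s' ^+ d * s); last exact: erefl.
have s0 : s != 0.
  apply/eqP => s0; apply: (@pvec_neq0 _ P); apply: nd; rewrite sE s0; exact: vscale0.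
exact: (mulf_neq0 (mulf_neq0 eF0 (expf_neq0 d s'0)) s0).
Qed.

(** [g] is the factor that cancels when the image is put in lowest terms. *)
Lemma orbit_step P : exists g, [/\ g != 0,
  hev d A (pt_num P) (pt_den P) = g * pt_num (reval phi P) &
  hev d B (pt_num P) (pt_den P) = g * pt_den (reval phi P)].
Proof.
have [s s0 sE] := fm_forms P; have [t t0 tE] := pt_vec (reval phi P).
have [g [gA gB]] : exists g,
    hev d A (pt_num P) (pt_den P) = g * pt_num (reval phi P) /\
    hev d B (pt_num P) (pt_den P) = g * pt_den (reval phi P).
  apply: coprime_parallel; first exact: coprimep_pt.
  apply/eqP; rewrite -(tofrac_eq (R := {poly k})) !tofracM; apply/eqP.
  move: sE tE => [-> ->] [-> ->] /=; exact: shuffle_vec.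
exists g; split=> //; apply/eqP => g0; move: sE; rewrite gA gB g0 !mul0r => /esym.
rewrite tofrac0 => /(vscale_eq0 s0); exact: pvec_neq0.
Qed.

Lemma orbit_factor_bound : exists C, forall P g, pt_den P != 0 ->
  hev d A (pt_num P) (pt_den P) = g * pt_num (reval phi P) ->
  hev d B (pt_num P) (pt_den P) = g * pt_den (reval phi P) -> (pdeg g <= C)%N.
Proof.
have [sA sB] := size_forms; have [_ _ nd] := ratfun_forms d0.
have cop : coprimep (fmap A) (fmap B).
  rewrite -eA -eB; apply: coprimep_scaled => //; exact: coprimep_rnum_rden.
have AB : (A`_d != 0) || (B`_d != 0).
  rewrite -negb_and; apply/negP => /andP[/eqP Ad /eqP Bd].
  have h (C : {poly {poly k}}) (q : {poly {ratfun k}}) : e%:F *: q = fmap C -> C`_d = 0 -> q`_d = 0.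
    move=> E C0; have := congr1 (fun q : {poly {ratfun k}} => q`_d) E.
    rewrite coefZ coef_map C0 => E2; apply: (mulf_eq0_left eF0); rewrite E2; exact: tofrac0.
  have := nd (1, 0); rewrite /fm /= !hev_10 (h _ _ eA Ad) (h _ _ eB Bd).
  by move=> /(_ erefl)[/eqP]; rewrite oner_eq0.
have [r r0 hr] := common_factor_bound d0 sA sB cop AB.
exists (pdeg r) => P g Y0 hA hB; apply: (dvdp_pdeg r0).
apply: (hr (pt_num P) (pt_den P)) => //; first exact: coprimep_pt.
- by rewrite hA dvdp_mulIl.
by rewrite hB dvdp_mulIl.
Qed.

Lemma pdeg_mul_le (u v : {poly k}) : (pdeg (u * v) <= pdeg u + pdeg v)%N.
Proof. by have := size_polyMleq u v; rewrite /pdeg; move: (size _) (size _) (size _); lia. Qed.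

Lemma height_step : exists C, forall P, (pht (reval phi P) <= d * pht P + C)%N.
Proof.
have [C1 h1] := hev_pdeg d A; have [C2 h2] := hev_pdeg d B.
exists (maxn C1 C2) => P; have [g [g0 gA gB]] := orbit_step P.
have le (u : {poly k}) : (pdeg u <= pdeg (g * u))%N.
  have [->|u0] := eqVneq u 0; first by rewrite mulr0.
  by rewrite pdegM // leq_addl.
rewrite {1}/pht geq_max; apply/andP; split; apply: leq_trans (le _) _.
  rewrite -gA; apply: leq_trans (h1 _ _) _; by rewrite leq_add2l leq_maxl.
rewrite -gB; apply: leq_trans (h2 _ _) _; by rewrite leq_add2l leq_maxr.
Qed.

Lemma height_iter m : exists C, forall P, (pht (iter m (reval phi) P) <= d ^ m * pht P + C)%N.
Proof.
have [C1 h1] := height_step; elim: m => [|m [C h]].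
  by exists 0%N => P; rewrite expn0 mul1n addn0.
exists (d * C + C1)%N => P; apply: leq_trans (h1 _) _.
by rewrite addnA leq_add2r expnS -mulnA -mulnDr leq_mul2l h orbT.
Qed.

Lemma hev_iform_step T m (X Y : {poly k}) : (size T <= 2)%N ->
  hev (d ^ m.+1) (iform d A B T m.+1) X Y = hev (d ^ m) (iform d A B T m) (hev d A X Y) (hev d B X Y).
Proof.
move=> sT; have [sA sB] := size_forms.
apply/eqP; rewrite -(tofrac_eq (R := {poly k})); apply/eqP.
rewrite !(hev_rmorph (@tofrac {poly k})) !map_iform -/(fmap A) -/(fmap B) -/(fmap T).
by rewrite hev_iform // size_fmap.
Qed.

(** The factors cancelled at each of the [m] steps have bounded degree, so smallness of [T] at the
    [m]-th iterate passes to the pulled-back form at [P]. *)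
Lemma form_iter T m : (size T <= 2)%N -> exists C, forall P,
  (forall i, (i < m)%N -> pt_den (iter i (reval phi) P) != 0) ->
  (pdeg (hev (d ^ m) (iform d A B T m) (pt_num P) (pt_den P)) <=
   C + pdeg (hev 1 T (pt_num (iter m (reval phi) P)) (pt_den (iter m (reval phi) P))))%N.
Proof.
move=> sT; have [Cg hg] := orbit_factor_bound.
elim: m => [|m [C hC]]; first by exists 0%N.
exists (d ^ m * Cg + C)%N => P hP; rewrite hev_iform_step //.
have [g [g0 gA gB]] := orbit_step P.
have gC := hg P g (hP 0%N isT) gA gB.
rewrite gA gB hevZ; apply: leq_trans (pdeg_mul_le _ _) _.
rewrite iterSr -addnA; apply: leq_add; last first.
  by apply: hC => i im; have := hP i.+1 im; rewrite iterSr.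
by rewrite pdegX mulnC leq_mul2l gC orbT.
Qed.

End OrbitEstimates.

(** [y] and [w] are the degrees of numerator and denominator of the new coordinate, [r] is the old
    height and [s] the size of the value of the form. *)
Lemma approach_arith (s c D C M y w r : nat) : (c <= D)%N -> (r <= maxn y w)%N ->
  (y <= w + M)%N -> (s.-1 + c * r <= C + D * r)%N ->
  (s%:Z - (w * D).+1%:Z <= (C + D * M + 1)%N%:Z - (c * maxn y w)%N%:Z)%R.
Proof.
move=> cD hr hy hs; set h := maxn y w in hr *.
have hh : (h <= w + M)%N by rewrite geq_max hy leq_addr.
have e1 : ((D - c) * r <= (D - c) * h)%N by rewrite leq_mul2l hr orbT.
have e2 : (D * h <= D * w + D * M)%N by rewrite -mulnDr leq_mul2l hh orbT.
have e3 : (D * r = (D - c) * r + c * r)%N by rewrite -mulnDl subnK.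
have e4 : (D * h = (D - c) * h + c * h)%N by rewrite -mulnDl subnK.
rewrite e3 in hs; rewrite e4 in e2; rewrite [(w * D)%N]mulnC.
move: hs e1 e2; move: (D * w)%N (D * M)%N ((D - c) * r)%N ((D - c) * h)%N (c * h)%N (c * r)%N.
by clear; lia.
Qed.

Lemma hsub_shift_inv (F : fieldType) D (P : {poly F}) c a : (size P <= D.+1)%N -> a - c != 0 ->
  (hsub D P (lin c 1) (lin 1 0)).[(a - c)^-1] = (a - c)^-1 ^+ D * P.[a].
Proof.
move=> sP a0; rewrite horner_hsub !horner_lin mul1r addr0.
have -> : c * (a - c)^-1 + 1 = (a - c)^-1 * a by field.
by rewrite -[X in hev _ _ _ X]mulr1 hevZ hev_x1.
Qed.

Lemma shift_inv_pow (F : fieldType) D (y w p : F) : y != 0 ->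
  (y / w) ^+ D * p = y ^+ D * p / w ^+ D.
Proof. by move=> y0; rewrite exprMn exprVn mulrAC. Qed.

(** * Approximation of fibres at infinity *)

Section Approach.
Variable k : fieldType.
Implicit Types (x : nat -> {ratfun k}) (a : {ratfun k}).

Definition shift_inv (c : k) a : {ratfun k} := (a - c%:P%:F)^-1.

Lemma subr_const (c : k) a :
  a - c%:P%:F = (rnum a - c *: rden a)%:F / (rden a)%:F.
Proof.
have Y0 : (rden a)%:F != 0 :> {ratfun k} by exact/tofrac_neq0/rden_neq0.
apply: (mulIf Y0); rewrite divfK // mulrBl {1}[a]ratfunE divfK // -mul_polyC.
by rewrite tofracB tofracM.
Qed.

Lemma rdeg_shift_inv c a : rnum a - c *: rden a != 0 ->
  rdeg (shift_inv c a) = maxn (pdeg (rden a)) (pdeg (rnum a - c *: rden a)).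
Proof.
move=> W0; have cop : coprimep (rden a) (rnum a - c *: rden a).
  rewrite -scaleNr addrC -mul_polyC coprimep_addl_mul.
  by rewrite coprimep_sym coprimep_rnum_rden.
have zE : shift_inv c a = (rden a)%:F / (rnum a - c *: rden a)%:F.
  by rewrite /shift_inv subr_const invf_div.
have [s s0 [e1 e2]] := rnum_rden_uniq cop W0 zE.
by rewrite /rdeg e1 e2 /pdeg !size_scale.
Qed.

Lemma pht_le_shift c a : rnum a - c *: rden a != 0 ->
  (rdeg a <= rdeg (shift_inv c a))%N.
Proof.
move=> W0; rewrite rdeg_shift_inv // /rdeg geq_max leq_maxl andbT.
have := size_polyD (rnum a - c *: rden a) (c *: rden a); rewrite subrK.
have := size_scale_leq c (rden a); rewrite /pdeg.
by move: (size _) (size _) (size _) (size _); clear; lia.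
Qed.

Lemma shift_inv_form (c : k) D (P : {poly {poly k}}) a : (size P <= D.+1)%N ->
  rnum a - c *: rden a != 0 ->
  (hsub D (fmap P) (lin (c%:P%:F) 1) (lin 1 0)).[shift_inv c a] =
  (hev D P (rnum a) (rden a))%:F / ((rnum a - c *: rden a) ^+ D)%:F.
Proof.
move=> sP W0.
have WF : (rnum a - c *: rden a)%:F != 0 :> {ratfun k} by exact: tofrac_neq0.
have YF : (rden a)%:F != 0 :> {ratfun k} by exact/tofrac_neq0/rden_neq0.
have a0 : a - c%:P%:F != 0.
  rewrite subr_const; exact: mulf_neq0 WF (invr_neq0 YF).
have sP' : (size (fmap P) <= D.+1)%N by rewrite size_fmap.
rewrite /shift_inv (hsub_shift_inv sP' a0) (hev_frac _ sP) subr_const invf_div tofracXn.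
exact: shift_inv_pow YF.
Qed.

(** If [x n] were close to [c0], the value [P(x n)], of degree about [- c h] or less, would be close
    to the fixed nonzero value [P(c0)]. So [1 / (x - c0)] is bounded, and it approaches the
    transformed roots with the same exponent. *)
Lemma approx_of_points D c (P : {poly {poly k}}) (c0 : k) x :
  (size P <= D.+1)%N -> (0 < c)%N -> (c <= D)%N -> (fmap P).[c0%:P%:F] != 0 -> tends x ->
  separable_poly (hsub D (fmap P) (lin (c0%:P%:F) 1) (lin 1 0)) ->
  (exists C, forall n, (pdeg (hev D P (rnum (x n)) (rden (x n))) + c * rdeg (x n) <=
     C + D * rdeg (x n))%N) ->
  exists n0, approx c (hsub D (fmap P) (lin (c0%:P%:F) 1) (lin 1 0))
     (fun n => shift_inv c0 (x (n0 + n)%N)).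
Proof.
move=> sP c_gt0 cD P0 tx sep [C hC].
have [m hm] := ndle_ex P0.
have [Q QE] := horner_sub_factor (fmap P) c0%:P%:F.
have [C1 hC1] := dle_horner Q 0.
have [n0 hn0] := tx (C + m)%N.
pose M := (C1 + m)%N.
have away n : (n0 <= n)%N -> ~~ dle (x n - c0%:P%:F) (- M%:Z).
  move=> /hn0 hn; apply: contraNN hm => h.
  have -> : (fmap P).[c0%:P%:F] = (fmap P).[x n] - Q.[x n] * (x n - c0%:P%:F).
    by rewrite -QE subKr.
  have x0 : dle (x n) 0.
    have -> : x n = (x n - c0%:P%:F) + c0%:P%:F by rewrite subrK.
    apply: dleD; first by apply: dleW h; rewrite /M; lia.
    by rewrite dle_frac polyC_eq0 size_polyC; case: eqP.
  apply: dleB; last first.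
    by apply: dleW (dleM (hC1 _ x0) h); rewrite /M; lia.
  have Y0 := rden_neq0 (x n).
  have YD0 : rden (x n) ^+ D != 0 by rewrite expf_neq0.
  have -> : (fmap P).[x n] = (hev D P (rnum (x n)) (rden (x n)))%:F / (rden (x n) ^+ D)%:F.
    have YF : (rden (x n) ^+ D)%:F != 0 :> {ratfun k} by rewrite tofrac_neq0.
    apply: (mulIf YF); rewrite divfK // hev_frac // tofracXn mulrC //.
  rewrite dleE //; apply/orP; right.
  have hx : (rdeg (x n) <= pdeg (rden (x n)))%N by rewrite (leq_trans (rdeg_rden x0)) ?addn0.
  have := hC n; have sY : size (rden (x n) ^+ D) = (pdeg (rden (x n)) * D).+1.
    by rewrite -(prednK (size_gt0Z YD0)) -/(pdeg _) pdegX.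
  rewrite sY; have hx' : (pdeg (rden (x n)) <= rdeg (x n))%N by exact: pdeg_rden_le.
  have -> : pdeg (rden (x n)) = rdeg (x n) by apply/eqP; rewrite eqn_leq hx hx'.
  rewrite /pdeg; move: (size _) hn => s hn h2.
  have : (rdeg (x n) <= c * rdeg (x n))%N by rewrite leq_pmull.
  move: h2 hn; rewrite [(rdeg (x n) * D)%N]mulnC; move: (rdeg _) (c * _)%N (D * _)%N => r u v.
  by clear; lia.
have good n : (n0 <= n)%N -> rnum (x n) - c0 *: rden (x n) != 0 /\
    dle (shift_inv c0 (x n)) M%:Z.
  move=> /away/dle_inv[h1 h2]; split=> //; apply: contraNneq h1 => W0.
  by rewrite subr_const W0 tofrac0 mul0r.
exists n0; split=> //.
- move=> H; have [n1 h1] := tx H; exists n1 => n ln.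
  have [W0 _] := good (n0 + n)%N (leq_addr _ _).
  by apply: leq_trans (pht_le_shift W0); apply: h1; rewrite (leq_trans ln) ?leq_addl.
- by exists M => n; case: (good (n0 + n)%N (leq_addr _ _)).
exists (C + D * M + 1)%N => n; have [W0 zM] := good (n0 + n)%N (leq_addr _ _).
rewrite shift_inv_form // dleE ?expf_neq0 //; apply/orP; right.
have hz := rdeg_rden zM; move: (hC (n0 + n)%N) (pht_le_shift W0).
have h3 : (pdeg (rden (x (n0 + n)%N)) <= pdeg (rnum (x (n0 + n)%N) - c0 *: rden (x (n0 + n)%N)) + M)%N.
  move: zM; rewrite /shift_inv subr_const invf_div dleE // (negPf (rden_neq0 _)) /=.
  have := size_gt0Z W0; have := size_gt0Z (rden_neq0 (x (n0 + n)%N)); rewrite /pdeg.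
  by move: (size _) (size _) => s1 s2; clear; lia.
rewrite rdeg_shift_inv //.
have WD0 : (rnum (x (n0 + n)%N) - c0 *: rden (x (n0 + n)%N)) ^+ D != 0 by rewrite expf_neq0.
have sW : size ((rnum (x (n0 + n)%N) - c0 *: rden (x (n0 + n)%N)) ^+ D) =
   (pdeg (rnum (x (n0 + n)%N) - c0 *: rden (x (n0 + n)%N)) * D).+1.
  by rewrite -(prednK (size_gt0Z WD0)) -/(pdeg _) pdegX.
rewrite sW; move: h3.
move: (pdeg (rden _)) (pdeg (rnum _ - _)) (rdeg _) => y w r h3 hs hr.
exact: approach_arith cD hr h3 hs.
Qed.

End Approach.

(** [c] is [(1/2 + 1/(2u)) D] rounded down. With [D >= 6 u] the surplus [D / (2u)] is at least 3,
    which pays for the rounding and for the constants in [size H + 2 <= c + c], where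
    [size H = D + 1]. *)
Lemma threshold_arith (u D c : nat) : (0 < u)%N -> (6 * u <= D)%N ->
  c = ((u + 1) * D %/ (2 * u))%N ->
  [/\ (5 <= c)%N, (D + 1 + 2 <= c + c)%N, (c <= D)%N, (2 * u * c <= (u + 1) * D)%N &
      ((u + 1) * D < 2 * u * c + 2 * u)%N].
Proof.
move=> u0 hD cE; have u20 : (0 < 2 * u)%N by rewrite muln_gt0.
have h1 : (2 * u * c <= (u + 1) * D)%N by rewrite cE mulnC leq_trunc_div.
have h2 : ((u + 1) * D < 2 * u * c + 2 * u)%N.
  have := ltn_ceil ((u + 1) * D) u20; rewrite -cE mulSn [(c * _)%N]mulnC.
  by rewrite [(2 * u + _)%N]addnC.
have h3 : (6 * (u * u) <= u * D)%N by rewrite mulnCA leq_mul2l hD orbT.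
split=> //.
- rewrite leqNgt; apply/negP => c4; have : (2 * u * c <= 2 * u * 4)%N by rewrite leq_mul2l; apply/orP; right; rewrite -ltnS.
  have u1 : (u <= u * u)%N by rewrite leq_pmull.
  by move: h2 h3 hD u1; rewrite mulnDl mul1n; move: (u * D)%N (2 * u * c)%N (u * u)%N; clear; lia.
- rewrite leqNgt; apply/negP => cl.
  have : (u * (c + c) <= u * (D + 2))%N by rewrite leq_mul2l; apply/orP; right; move: cl; clear; lia.
  move: h2 hD; rewrite mulnDl mul1n mulnDr [(u * (D + 2))%N]mulnDr -[(2 * u * c)%N]mulnA.
  by move: (u * D)%N (u * c)%N; clear; lia.
rewrite -(leq_pmul2l u20); apply: leq_trans h1 _; rewrite leq_mul2r; apply/orP; right.
by move: u0; clear; lia.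
Qed.

(** [s] and [s'] count the points kept at two consecutive levels. The surplus [d D / u >= 6 d]
    covers the [2 d] to be exceeded and a total loss of [2 d + 2], from rounding and from one lost
    point per level. *)
Lemma chain_arith (u d D s c c' s' : nat) : (0 < u)%N -> (0 < d)%N -> (6 * u <= D)%N ->
  (c <= s + 1)%N -> (c' <= s' + 1)%N -> (c <= D)%N ->
  ((u + 1) * D < 2 * u * c + 2 * u)%N -> ((u + 1) * (d * D) < 2 * u * c' + 2 * u)%N ->
  (d + d + d * (D - s) < s')%N.
Proof.
move=> u0 d0 hD hs hs' cD h1 h2.
have e1 : (d * (D - s) <= d * (D - c) + d)%N.
  by rewrite -[X in (_ <= _ + X)%N]muln1 -mulnDr leq_mul2l; apply/orP; right; move: hs; clear; lia.
have e2 : (d * ((u + 1) * D) <= d * (2 * u * c + 2 * u))%N by rewrite leq_mul2l ltnW ?orbT.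
rewrite ltnNge; apply/negP => h.
have e3 : (2 * u * s' <= 2 * u * (d + d + (d * (D - c) + d)))%N.
  by rewrite leq_mul2l (leq_trans h) ?orbT // leq_add2l.
have e4 : (2 * u * c' <= 2 * u * (s' + 1))%N by rewrite leq_mul2l hs' orbT.
have e5 : (d * (6 * u) <= d * D)%N by rewrite leq_mul2l hD orbT.
have e6 : (u <= d * u)%N by rewrite leq_pmull.
have e7 : (d * D = d * c + d * (D - c))%N by rewrite -mulnDr subnKC.
have e8 : (u * (d * D) = u * (d * c) + u * (d * (D - c)))%N by rewrite e7 mulnDr.
have E1 : (d * ((u + 1) * D) = u * (d * D) + d * D)%N by ring.
have E2 : (d * (2 * u * c + 2 * u) = 2 * (u * (d * c)) + 2 * (d * u))%N by ring.
have E3 : ((u + 1) * (d * D) = u * (d * D) + d * D)%N by ring.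
have E4 : (2 * u * c' = 2 * (u * c'))%N by ring.
have E5 : (2 * u * s' = 2 * (u * s'))%N by ring.
have E6 : (2 * u * (d + d + (d * (D - c) + d)) = 6 * (d * u) + 2 * (u * (d * (D - c))))%N by ring.
have E7 : (2 * u * (s' + 1) = 2 * (u * s') + 2 * u)%N by ring.
have E8 : (d * (6 * u) = 6 * (d * u))%N by ring.
rewrite E1 E2 in e2; rewrite E3 E4 in h2; rewrite E5 E6 in e3; rewrite E4 E7 in e4.
rewrite E8 in e5; rewrite e8 in e2 h2.
move: e2 h2 e3 e4 e5 e6.
move: (u * (d * c))%N (u * (d * (D - c)))%N (d * D)%N (u * c')%N (u * s')%N (d * u)%N.
by clear; lia.
Qed.

(** The last hypothesis reads [t <= (1/2 - 1/(2u)) hN]. As [hN] is at most [D h] and [c] at most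
    [(1/2 + 1/(2u)) D], the pulled-back form has degree at most [(D - c) h], up to constants. *)
Lemma smallness_arith (u c D C C' t h hN pv : nat) : (0 < u)%N -> (2 * u * c <= (u + 1) * D)%N ->
  (pv <= C + t)%N -> (hN <= D * h + C')%N -> (2 * u * t + hN <= u * hN)%N ->
  (pv + c * h <= C + C' + D * h)%N.
Proof.
move=> u0 hc h1 h2 h3; have u20 : (0 < 2 * u)%N by rewrite muln_gt0.
rewrite -(leq_pmul2l u20).
case: u u0 u20 hc h3 => // u _ u20 hc h3.
have e1 : (u * hN <= u * (D * h + C'))%N by rewrite leq_mul2l h2 orbT.
have e2 : (2 * u.+1 * c * h <= (u.+1 + 1) * D * h)%N by rewrite leq_mul2r hc orbT.
have e3 : (2 * u.+1 * pv <= 2 * u.+1 * (C + t))%N by rewrite leq_mul2l h1 orbT.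
have E0 : (u.+1 * hN = hN + u * hN)%N by rewrite mulSn.
rewrite E0 addnC leq_add2l in h3.
have E1 : (2 * u.+1 * (pv + c * h) = 2 * u.+1 * pv + 2 * u.+1 * c * h)%N by ring.
have E2 : (2 * u.+1 * (C + C' + D * h) =
  2 * u.+1 * C + u * C' + (u + 2) * C' + (u.+1 + 1) * D * h + u * (D * h))%N by ring.
rewrite mulnDr in e3; rewrite mulnDr in e1; rewrite E1 E2.
have := leq_add e3 e2; have := leq_trans h3 e1.
move: (2 * u.+1 * pv)%N (2 * u.+1 * c * h)%N (2 * u.+1 * C)%N (2 * u.+1 * t)%N ((u.+1 + 1) * D * h)%N.
by move: (u * (D * h))%N (u * C')%N ((u + 2) * C')%N; clear; lia.
Qed.

Lemma size_rem0 (F : fieldType) (s : seq F) : uniq s ->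
  (size s <= size [seq z <- s | z != 0%R] + 1)%N.
Proof.
move=> us; rewrite -(rem_filter 0 us); have [s0|s0] := boolP (0 \in s).
  by rewrite size_rem // addn1; case: (size s).
by rewrite rem_id // leq_addr.
Qed.

Lemma separable_preimage (F E : fieldType) (f : {rmorphism F -> E}) (P : {poly F}) Q n :
  map_poly f P = Q -> separable_poly Q -> size Q = n -> separable_poly P /\ size P = n.
Proof. by move=> <-; rewrite separable_map size_map_poly. Qed.

Lemma map_hsub_shift (F E : fieldType) (f : {rmorphism F -> E}) D (P : {poly F}) c :
  map_poly f (hsub D P (lin c 1) (lin 1 0)) = hsub D (map_poly f P) (lin (f c) 1) (lin 1 0).
Proof. by rewrite map_hsub !map_lin rmorph1 rmorph0. Qed.

(** * Constant points in one level of the fibre tower *)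

Section Level.
Variables (p : nat) (k : closedFieldType) (pk : p \in [pchar k]) (L : closedFieldType).
Variables (j : {rmorphism {ratfun k} -> L}) (phi : {ratfun {ratfun k}}).
Variables (e : {poly k}) (A B T : {poly {poly k}}).
Let d := rdeg phi.
Hypotheses (d2 : (2 <= d)%N) (e0 : e != 0) (eA : e%:F *: rnum phi = fmap A)
  (eB : e%:F *: rden phi = fmap B) (sT : (size T <= 2)%N) (T0 : T != 0).
Variable Q : option L.
Hypotheses (npc : ~ post_critical (rmap j phi) Q)
  (QT : hev 1 (map_poly j (fmap T)) (pvec Q).1 (pvec Q).2 = 0).

Let d0 : (0 < d)%N := ltnW d2.
Let AL := map_poly j (fmap A).
Let BL := map_poly j (fmap B).
Let TL := map_poly j (fmap T).
Let PL m := map_poly j (fmap (iform d A B T m)).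

Lemma PLE m : PL m = iform d AL BL TL m.
Proof. by rewrite /PL /fmap !map_iform. Qed.

Lemma rmap_scaled : exists2 c, c != 0 & AL = c *: rnum (rmap j phi) /\ BL = c *: rden (rmap j phi).
Proof.
have [c c0 [e1 e2]] := rmap_forms j phi.
exists (j e%:F / c); first by rewrite mulf_neq0 ?invr_eq0 // fmorph_eq0 tofrac_neq0.
by rewrite e1 e2 !scalerA divfK // /AL /BL -eA -eB !map_polyZ.
Qed.

(** Separability of the map comes from [Q]: its fibre is unramified, so the Wronskian is nonzero at
    an affine point of it. *)
Lemma good_forms : good d AL BL.
Proof.
have [c c0 [aE bE]] := rmap_scaled.
have dE : rdeg (rmap j phi) = d by rewrite rdeg_rmap.
have dr : (0 < rdeg (rmap j phi))%N by rewrite dE.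
have [sA sB nd] := ratfun_forms dr; rewrite dE in sA sB nd.
split.
- by rewrite aE (leq_trans (size_scale_leq _ _)).
- by rewrite bE (leq_trans (size_scale_leq _ _)).
- move=> v h; apply: nd; apply: (vscale_eq0 c0); rewrite -h aE bE.
  by apply: vec_eq; rewrite /= hevZl.
have nc P : reval (rmap j phi) P = Q -> ~ critical (rmap j phi) P.
  by move=> h cr; apply: npc; exists P, 1%N.
have [sep _] := fibre_points dr nc.
(* Without an affine point in the fibre, infinity would carry the multiplicity [d >= 2] and be
   critical. *)
have rt : exists x, root (rfibre (rmap j phi) Q) x.
  apply/closed_rootP; apply/eqP => s1.
  have pd : pdeg (rfibre (rmap j phi) Q) = 0%N by rewrite /pdeg s1.
  have hN : reval (rmap j phi) None = Q by apply: rfibre_infty; rewrite // pd.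
  apply: (nc None hN); rewrite /critical /ramification_index hN pd subn0 dE; exact: d2.
have W0 : pwronsk (rnum (rmap j phi)) (rden (rmap j phi)) != 0.
  have cop := coprimep_rnum_rden (rmap j phi).
  case: (Q) sep rt (QT) => [y|] /= sep rt hT.
    rewrite -[rnum _](subrK (y *: rden (rmap j phi))).
    have -> : pwronsk (rnum (rmap j phi) - y *: rden (rmap j phi) + y *: rden (rmap j phi))
        (rden (rmap j phi)) = pwronsk (rnum (rmap j phi) - y *: rden (rmap j phi)) (rden (rmap j phi)).
      rewrite /pwronsk !derivD derivN !derivZ -!mul_polyC; ring.
    apply: pwronsk_separable => //.
    by rewrite -scaleNr addrC -mul_polyC coprimep_sym coprimep_addl_mul coprimep_sym.
  have : pwronsk (rden (rmap j phi)) (rnum (rmap j phi)) != 0.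
    by apply: pwronsk_separable => //; rewrite coprimep_sym.
  rewrite -oppr_eq0; congr (_ != 0); rewrite /pwronsk; ring.
rewrite aE bE.
have -> : pwronsk (c *: rnum (rmap j phi)) (c *: rden (rmap j phi)) =
    (c * c) *: pwronsk (rnum (rmap j phi)) (rden (rmap j phi)).
  by rewrite /pwronsk !derivZ -!mul_polyC polyCM; ring.
by rewrite scaler_eq0 negb_or W0 mulf_neq0.
Qed.

Lemma size_PL m : (size (PL m) <= (d ^ m).+1)%N.
Proof.
have [sA sB _ _] := good_forms.
by rewrite PLE size_iform // size_map_poly size_fmap.
Qed.

Lemma PL_neq0 m : PL m != 0.
Proof.
have [sA sB nd _] := good_forms.
rewrite PLE iform_neq0 //; first by rewrite size_map_poly size_fmap.
by rewrite map_poly_eq0 -size_poly_gt0 size_fmap size_poly_gt0.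
Qed.

Lemma PL_fibre m : exists s : seq (option L), [/\ uniq s, size s = (d ^ m)%N &
  forall P, P \in s -> hev (d ^ m) (PL m) (pvec P).1 (pvec P).2 = 0].
Proof.
have dE : rdeg (rmap j phi) = d by rewrite rdeg_rmap.
have dr : (0 < rdeg (rmap j phi))%N by rewrite dE.
have [s [us ss hs]] := iterated_fibre m dr npc; exists s; rewrite -dE; split=> // P Ps.
have [c c0 [aE bE]] := rmap_scaled.
rewrite PLE -dE; apply: (iform_fibre dr aE bE _ QT) => //; last exact: hs.
by rewrite size_map_poly size_fmap.
Qed.

(* The change of variable [z = 1 / (x - c0)] makes the approximating sequence bounded
   at [t = oo]; it loses at most the point [z = 0]. *)
Lemma level_points m u (x : nat -> {ratfun k}) : (0 < u)%N -> (6 * u <= d ^ m)%N -> tends x ->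
  (exists C, forall n, (pdeg (hev (d ^ m) (iform d A B T m) (rnum (x n)) (rden (x n))) +
     ((u + 1) * d ^ m %/ (2 * u)) * rdeg (x n) <= C + d ^ m * rdeg (x n))%N) ->
  exists S M, [/\ uniq S, all (root (PL m)) S, mdet M != 0,
    forall z, z \in S -> cst (constants j) (act M (z, 1)) &
    ((u + 1) * d ^ m %/ (2 * u) <= size S + 1)%N].
Proof.
move=> u0 hD tx hx; set D := (d ^ m)%N in hD hx *.
have [] := threshold_arith u0 hD erefl; set c := ((u + 1) * D %/ (2 * u))%N in hx *.
move=> c5 cD2 cD _ _.
have c_gt0 : (0 < c)%N by apply: leq_trans c5.
have [c0 hc0] := constant_nonroot (constants j) (PL_neq0 m).
have Pc0 : (fmap (iform d A B T m)).[c0%:P%:F] != 0.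
  by rewrite -(fmorph_eq0 j) -horner_map.
have sP : (size (iform d A B T m) <= D.+1)%N.
  by rewrite -(size_fmap (iform d A B T m)) -(size_map_poly j) size_PL.
pose H := hsub D (fmap (iform d A B T m)) (lin (c0%:P%:F) 1) (lin 1 0).
have HE : map_poly j H = hsub D (PL m) (lin (constants j c0) 1) (lin 1 0).
  exact: map_hsub_shift.
have [s [us ss hs]] := PL_fibre m.
have [sepL sHL] := form_separable (size_PL m) hc0 us ss hs.
have [sepH sH] := separable_preimage HE sepL sHL.
have [n0 aH] := approx_of_points sP c_gt0 cD Pc0 tx sepH hx.
have [||S [uS sS rS crS]] := constant_roots pk j _ _ aH.
- exact: leq_trans c5.
- by rewrite sH -addn1.
have [|M [M0 hM]] := frame_matrix uS _ crS; first by apply: leq_trans sS; apply: leq_trans c5.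
exists [seq constants j c0 + z^-1 | z <- S & z != 0], (mmul M (Mat 0 1 1 (- constants j c0))).
split.
- by rewrite map_inj_uniq ?filter_uniq // => x1 x2 /addrI/invr_inj.
- apply/allP => y /mapP[z]; rewrite mem_filter => /andP[z0 zS] ->.
  have := allP rS z zS; rewrite HE rootE horner_hsub !horner_lin mul1r addr0.
  rewrite (hev_horner _ (size_PL m) z0) mulf_eq0 expf_eq0 (negPf z0) andbF /=.
  by rewrite mulrDl mulfK // div1r.
- by rewrite mdet_mmul mulf_neq0 // /mdet /= mul0r sub0r mulr1 oppr_eq0 oner_neq0.
- move=> y /mapP[z]; rewrite mem_filter => /andP[z0 zS] ->.
  rewrite act_mmul.
  have -> : act (Mat 0 1 1 (- constants j c0)) (constants j c0 + z^-1, 1) = vscale z^-1 (z, 1).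
    by apply: vec_eq => /=; field.
  by rewrite act_scale; apply/scale_cst/hM.
by rewrite size_map (leq_trans sS) // size_rem0.
Qed.

End Level.

Lemma iso_scale (k L : closedFieldType) (iota : {rmorphism k -> L}) d c (A B : {poly L}) :
  c != 0 -> iso iota d (c *: A) (c *: B) -> iso iota d A B.
Proof.
move=> c0 [M [C [D [s [M0 sC sD s0 h]]]]]; exists M, C, D, (s / c); split=> //.
  by rewrite mulf_neq0 // invr_eq0.
move=> v; have e : vscale c (fm d A B (act M v)) =
    vscale s (act M (fm d (map_poly iota C) (map_poly iota D) v)).
  by rewrite -h; apply: vec_eq; rewrite /= hevZl.
have -> : fm d A B (act M v) = vscale c^-1 (vscale c (fm d A B (act M v))).
  by rewrite vscaleA mulVf // vscale1.
by rewrite e vscaleA mulrC.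
Qed.

(** [T] is a linear form with zero [Q], so the degree of its value measures how close the orbit
    comes to [Q] at [t = oo]. If the conclusion fails for one [u], every level [m >= 6 u] yields
    constant points; the levels form a chain, and the map is isotrivial. *)
Lemma eventually_balanced (p : nat) (k : closedFieldType) (L : closedFieldType)
  (j : {rmorphism {ratfun k} -> L}) (phi : {ratfun {ratfun k}}) (e : {poly k})
  (A B T : {poly {poly k}}) (Q : option L) (P : nat -> option {ratfun k}) n1 :
  p \in [pchar k] -> (2 <= rdeg phi)%N -> e != 0 -> e%:F *: rnum phi = fmap A ->
  e%:F *: rden phi = fmap B -> (size T <= 2)%N -> T != 0 ->
  ~ post_critical (rmap j phi) Q ->
  hev 1 (map_poly j (fmap T)) (pvec Q).1 (pvec Q).2 = 0 ->
  ~ isotrivial j phi ->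
  (forall n m, P (n + m)%N = iter n (reval phi) (P m)) ->
  (forall n, (n1 <= n)%N -> P n <> None) ->
  (forall H, exists n0, forall n, (n0 <= n)%N -> (H <= pht (P n))%N) ->
  forall u, (0 < u)%N -> exists n0, forall n, (n0 <= n)%N ->
    (u * pht (P n) < 2 * u * pdeg (hev 1 T (pt_num (P n)) (pt_den (P n))) + pht (P n))%N.
Proof.
move=> pk d2 e0 eA eB sT T0 npc QT niso PS PN tP u u0.
have d0 : (0 < rdeg phi)%N := ltnW d2.
set tv := fun n => pdeg (hev 1 T (pt_num (P n)) (pt_den (P n))).
apply: contrapT => nb; apply: niso; apply: (iso_isotrivial d0).
have bad n0 : exists n, (n0 <= n)%N /\ (2 * u * tv n + pht (P n) <= u * pht (P n))%N.
  apply: contrapT => h; apply: nb; exists n0 => n ln; rewrite ltnNge; apply/negP => h'.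
  by apply: h; exists n.
have level m : (6 * u <= m)%N -> exists SM : seq L * mat L,
    [/\ uniq SM.1, all (root (map_poly j (fmap (iform (rdeg phi) A B T m)))) SM.1, mdet SM.2 != 0,
      forall z, z \in SM.1 -> cst (constants j) (act SM.2 (z, 1)) &
      ((u + 1) * rdeg phi ^ m %/ (2 * u) <= size SM.1 + 1)%N].
  move=> hm; have hD : (6 * u <= rdeg phi ^ m)%N.
    by apply: leq_trans hm _; exact: ltnW (ltn_expl m d2).
  (* Indices at which the bound fails. Being at least [i + m + n1], they leave room for [m] steps
     back in the part of the orbit that avoids infinity. *)
  have /choice[N hN] : forall i, exists n, (i + m + n1 <= n)%N /\
      (2 * u * tv n + pht (P n) <= u * pht (P n))%N by move=> i; exact: bad.
  have Nm i : (N i = m + (N i - m))%N.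
    by rewrite subnKC //; have [h _] := hN i; apply: leq_trans h; rewrite addnAC leq_addl.
  have lN i l : (n1 <= l + (N i - m))%N.
    by have [h _] := hN i; move: h; clear; lia.
  have /choice[x hx] : forall i, exists y, P (N i - m)%N = Some y.
    move=> i; have := PN _ (lN i 0%N); rewrite add0n.
    by case: (P (N i - m)%N) => [y|//] _; exists y.
  have tx : tends x.
    move=> H; have [n0 h0] := tP H; exists n0 => i li.
    have : (n0 <= N i - m)%N.
      by have [h _] := hN i; move: h li; clear; lia.
    by move/h0; rewrite hx.
  have [C hC] := form_iter d0 e0 eA eB m sT.
  have [C' hC'] := height_iter d0 e0 eA eB m.
  have [_ _ _ hc _] := threshold_arith u0 hD erefl.
  have [|S [M [h1 h2 h3 h4 h5]]] := level_points pk d2 e0 eA eB sT T0 npc QT u0 hD tx.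
    exists (C + C')%N => i; have [_ hb] := hN i.
    have PE : iter m (reval phi) (Some (x i)) = P (N i) by rewrite -hx -PS -Nm.
    have := hC (Some (x i)); have := hC' (Some (x i)); rewrite PE => q2 q1.
    apply: (smallness_arith u0 hc (q1 _) q2 hb).
    move=> l lm; rewrite -hx -PS.
    by case E: (P _) (PN _ (lN i l)) => [y|//] _; exact: rden_neq0.
  by exists (S, M).
(* Dummy data below level [6 u] make the choice total; a chain concerns large levels only. *)
have /choice[SM hSM] : forall m, exists SM : seq L * mat L, (6 * u <= m)%N ->
    [/\ uniq SM.1, all (root (map_poly j (fmap (iform (rdeg phi) A B T m)))) SM.1, mdet SM.2 != 0,
      forall z, z \in SM.1 -> cst (constants j) (act SM.2 (z, 1)) &
      ((u + 1) * rdeg phi ^ m %/ (2 * u) <= size SM.1 + 1)%N].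
  move=> m; have [h|h] := leqP (6 * u) m; first by have [SM hSM] := level m h; exists SM.
  by exists ([::], Mat 0 0 0 0).
have g := good_forms d2 e0 eA eB npc QT.
have [sA sB nd _] := g.
have ch : chain (constants j) (rdeg phi) (map_poly j (fmap A)) (map_poly j (fmap B))
    (fun m => (SM m).2).
  apply: (@chain_of_roots _ _ _ _ _ _
    (fun m => map_poly j (fmap (iform (rdeg phi) A B T m))) (fun m => (SM m).1) _ (6 * u)) => //.
  - by move=> m; rewrite !PLE.
  - move=> m; exact (PL_neq0 d2 e0 eA eB sT T0 npc QT m).
  - move=> m; exact (size_PL d2 e0 eA eB sT npc QT m).
  - by move=> m /hSM[].
  move=> m hm; have [_ _ _ _ s1] := hSM m hm; have [_ _ _ _ s2] := hSM m.+1 (leqW hm).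
  have hD : (6 * u <= rdeg phi ^ m)%N.
    by apply: leq_trans hm _; exact: ltnW (ltn_expl m d2).
  have hD' : (6 * u <= rdeg phi ^ m.+1)%N.
    by apply: leq_trans (leqW hm) _; exact: ltnW (ltn_expl m.+1 d2).
  have [_ _ cD _ t1] := threshold_arith u0 hD erefl.
  have [_ _ _ _ t2] := threshold_arith u0 hD' erefl.
  apply: (chain_arith u0 d0 hD s1 s2 cD t1).
  by rewrite -expnS.
have := chain_iso d2 g ch; rewrite -eA -eB !map_polyZ; apply: iso_scale.
by rewrite fmorph_eq0 tofrac_neq0.
Qed.

(** * Limits *)

Lemma limn_esup_le_eventually (R : realType) (s : nat -> \bar R) (b : \bar R) :
  (exists n0, forall n, (n0 <= n)%N -> (s n <= b)%E) -> (limn_esup s <= b)%E.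
Proof.
move=> [n0 h]; rewrite limn_esup_lim; apply: lime_le; first exact: is_cvg_esups.
exists n0 => //= m lm; apply: ge_ereal_sup => _ [n /= mn <-].
by apply: h; apply: leq_trans mn.
Qed.

Lemma limn_einf_ge_eventually (R : realType) (s : nat -> \bar R) (b : \bar R) :
  (exists n0, forall n, (n0 <= n)%N -> (b <= s n)%E) -> (b <= limn_einf s)%E.
Proof.
move=> [n0 h]; rewrite limn_einf_lim; apply: lime_ge; first exact: is_cvg_einfs.
exists n0 => //= m lm; apply: le_ereal_inf_tmp => _ [n /= mn <-].
by apply: h; apply: leq_trans mn.
Qed.

(* The asymptotic statement, for [x] and [y] the two coordinates and [h] the height. *)
Lemma balanced_limits (R : realType) (x y h : nat -> nat) :
  (forall n, (x n <= h n)%N /\ (y n <= h n)%N) ->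
  (exists n0, forall n, (n0 <= n)%N -> (0 < h n)%N) ->
  (forall u, (0 < u)%N -> exists n0, forall n, (n0 <= n)%N -> (u * h n < 2 * u * x n + h n)%N) ->
  (forall u, (0 < u)%N -> exists n0, forall n, (n0 <= n)%N -> (u * h n < 2 * u * y n + h n)%N) ->
  let s n := ((x n)%:R%:E / (y n)%:R%:E)%E : \bar R in
  ((1 / 2)%:E <= limn_einf s)%E /\ (limn_esup s <= 2%:E)%E.
Proof.
move=> xyh [m0 h0] hx hy s.
(* The case [u = 2] reads [h < 4 x] and [h < 4 y], so both degrees are eventually positive. *)
have [m1 y0] := hy 2 isT; have [m2 x0] := hx 2 isT.
have [n0 pos] : exists n0, forall n, (n0 <= n)%N -> (0 < x n)%N /\ (0 < y n)%N.
  exists (m0 + m1 + m2)%N => n ln.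
  have := h0 n; have := y0 n; have := x0 n.
  have [-> [-> ->]] : (m2 <= n)%N /\ (m1 <= n)%N /\ (m0 <= n)%N by move: ln; clear; lia.
  by move=> /(_ isT) q1 /(_ isT) q2 /(_ isT) q3; move: q1 q2 q3; clear; lia.
have sE n : (n0 <= n)%N -> s n = ((x n)%:R / (y n)%:R)%:E.
  move=> /pos[_ yn]; rewrite /s EFinM inver pnatr_eq0.
  by case: eqP yn => // ->.
have yR n : (n0 <= n)%N -> (0 : R) < (y n)%:R by move=> /pos[_ yn]; rewrite ltr0n.
(* For [u > 1] the ratio eventually lies between [1/2 - 1/(2u)] and [2 + 2/(u - 1)]; this choice of
   [u] makes both errors at most [eps]. *)
have arch (eps : R) : 0 < eps -> exists2 u : nat, (1 < u)%N & 4 <= eps * (u%:R - 1).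
  move=> e0; exists (Num.bound (4 / eps)).+2 => //.
  have := archi_boundP (divr_ge0 (ler0n R 4) (ltW e0)); rewrite -[_.+2]addn2 natrD.
  move: ((Num.bound (4 / eps))%:R : R) => b; rewrite ltr_pdivrMr // => h1; nra.
split.
  apply/lee_addgt0Pr => eps e0; have [u u1 hu] := arch eps e0.
  rewrite -leeBlDr //; apply: limn_einf_ge_eventually.
  have [n1 hn1] := hx u (ltnW u1); exists (n0 + n1)%N => n ln.
  have l0 : (n0 <= n)%N by apply: leq_trans ln; exact: leq_addr.
  have /hn1 : (n1 <= n)%N by apply: leq_trans ln; exact: leq_addl.
  rewrite sE // -EFinB lee_fin ler_pdivlMr ?yR //.
  have [_ yh] := xyh n; rewrite -(ltr_nat R) natrD !natrM.
  have u1' : (1 : R) < u%:R by rewrite ltr1n.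
  move: yh hu (yR _ l0) u1'; rewrite -(ler_nat R).
  move: (x n)%:R (y n)%:R (h n)%:R u%:R => X Y H U.
  move=> h1 h2 h3 h4 h5.
  have k1 : (U - 1) * Y <= (U - 1) * H by rewrite ler_pM2l // subr_gt0.
  have k2 : (U - 1) * Y < 2 * U * X by nra.
  have U0 : 0 < U by lra.
  have k3 : (1 / 2 - eps) * Y * (2 * U) <= X * (2 * U) by nra.
  by move: k3; rewrite ler_pM2r //; nra.
apply/lee_addgt0Pr => eps e0; have [u u1 hu] := arch eps e0.
apply: limn_esup_le_eventually.
have [n1 hn1] := hy u (ltnW u1); exists (n0 + n1)%N => n ln.
have l0 : (n0 <= n)%N by apply: leq_trans ln; exact: leq_addr.
have /hn1 : (n1 <= n)%N by apply: leq_trans ln; exact: leq_addl.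
rewrite sE // -EFinD lee_fin ler_pdivrMr ?yR //.
have [xh _] := xyh n; rewrite -(ltr_nat R) natrD !natrM.
have u1' : (1 : R) < u%:R by rewrite ltr1n.
move: xh hu (yR _ l0) u1'; rewrite -(ler_nat R).
move: (x n)%:R (y n)%:R (h n)%:R u%:R => X Y H U.
move=> h1 h2 h3 h4 h5.
have k1 : (U - 1) * X <= (U - 1) * H by rewrite ler_pM2l // subr_gt0.
have k2 : (U - 1) * X < 2 * U * Y by nra.
have U0 : 0 < U - 1 by lra.
have k3 : X * (U - 1) <= (2 + eps) * Y * (U - 1) by nra.
by move: k3; rewrite ler_pM2r.
Qed.

(** A repetition at [i < l] folds every index back to one below [l], and the orbit would be
    finite. *)
Lemma wandering_injective (F : fieldType) (f : {ratfun F}) (a : P1 F) : wandering f a ->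
  injective (fun n => iter n (reval f) a).
Proof.
move=> wa i l; wlog il : i l / (i <= l)%N => [hw|].
  by case/orP: (leq_total i l) => h e; [|apply/esym]; apply: hw.
move=> e; apply/eqP; rewrite eqn_leq il leqNgt; apply/negP => lt; apply: wa.
have red n : exists2 n', (n' < l)%N & iter n (reval f) a = iter n' (reval f) a.
  have [N] := ubnP n; elim: N n => // N IH n; rewrite ltnS => nN.
  have [nl|ln] := ltnP n l; first by exists n.
  have [|n' n'l E] := IH (n - l + i)%N; first by move: nN ln lt; clear; lia.
  exists n' => //; rewrite -E -{1}(subnK ln) !iterD; congr iter; exact: esym e.
apply: (@sub_finite_set _ _ [set iter n (reval f) a | n in `I_l]%classic).
  by move=> _ [n _ <-]; have [n' n'l ->] := red n; exists n'.
exact: finite_image (finite_II l).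
Qed.

(* k is an algebraic closure of F_p, and L one of k(t). *)
Theorem theorem1p4 (R : realType) (p : nat) (p_prime : prime p)
    (k : closedFieldType) (iota : {rmorphism 'F_p -> k})
    (k_alg : algebraic_extension iota)
    (L : closedFieldType) (j : {rmorphism {ratfun k} -> L})
    (L_alg : algebraic_extension j)
    (phi : {ratfun {ratfun k}})
    (phi_nonisotrivial : ~ isotrivial j phi)
    (phi_deg : (2 <= rdeg phi)%N)
    (a : P1 {ratfun k}) (a_wandering : wandering phi a)
    (zero_not_pc : ~ post_critical (rmap j phi) (Some 0))
    (infty_not_pc : ~ post_critical (rmap j phi) None) :
  [/\ ((1 / 2)%:E <= limn_einf (degree_ratio R phi a))%E,
      (limn_einf (degree_ratio R phi a) <= limn_esup (degree_ratio R phi a))%E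
    & (limn_esup (degree_ratio R phi a) <= 2%:E)%E].
Proof.
have pk := pchar_alg p_prime iota.
have d0 : (0 < rdeg phi)%N := ltnW phi_deg.
have [e [A [B [e0 eA eB]]]] := clear_denom2 (rnum phi) (rden phi).
pose P n : option {ratfun k} := iter n (reval phi) a.
have injP : injective P := wandering_injective a_wandering.
have stepP n : exists g, [/\ g != 0,
    hev (rdeg phi) A (pt_num (P n)) (pt_den (P n)) = g * pt_num (P n.+1) &
    hev (rdeg phi) B (pt_num (P n)) (pt_den (P n)) = g * pt_den (P n.+1)].
  exact (orbit_step d0 e0 eA eB (P n)).
have tP := northcott p_prime k_alg injP stepP.
have PS n m : P (n + m)%N = iter n (reval phi) (P m) by rewrite /P iterD.
have [n1 PN] : exists n1, forall n, (n1 <= n)%N -> P n <> None.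
  have [[n0 h0]|h] := pselect (exists n0, P n0 = None); last first.
    by exists 0%N => n _ hn; apply: h; exists n.
  by exists n0.+1 => n ln hn; move: ln; rewrite (injP n n0) ?ltnn // h0.
(* The two linear forms are ['X], with zero 0, and [1], which as a form of degree 1 has its zero at
   infinity; their values at [P n] are numerator and denominator. *)
have sX : (size ('X : {poly {poly k}}) <= 2)%N by rewrite size_polyX.
have s1 : (size (1%R : {poly {poly k}}) <= 2)%N by rewrite size_poly1.
have X0 : ('X : {poly {poly k}}) != 0 by rewrite polyX_eq0.
have o0 : (1 : {poly {poly k}}) != 0 by exact: oner_neq0.
have hX (S : comNzRingType) (u v : S) : hev 1 'X u v = u.
  by rewrite -['X]expr1 hevXn // subnn mulr1 expr1.
have QX : hev 1 (map_poly j (fmap 'X)) (pvec (Some 0 : option L)).1 (pvec (Some 0 : option L)).2 = 0.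
  by rewrite /fmap !map_polyX hX.
have Q1 : hev 1 (map_poly j (fmap 1)) (pvec (None : option L)).1 (pvec (None : option L)).2 = 0.
  by rewrite /fmap !rmorph1 hev_1 expr1.
have bX := eventually_balanced pk phi_deg e0 eA eB sX X0 zero_not_pc QX phi_nonisotrivial PS PN tP.
have b1 := eventually_balanced pk phi_deg e0 eA eB s1 o0 infty_not_pc Q1 phi_nonisotrivial PS PN tP.
have [] := @balanced_limits R (fun n => pdeg (pt_num (P n))) (fun n => pdeg (pt_den (P n)))
  (fun n => pht (P n)).
- by move=> n; rewrite /pht leq_maxl leq_maxr.
- exact: (tP 1%N).
- by move=> u /bX[n0 h]; exists n0 => n /h; rewrite hX.
- by move=> u /b1[n0 h]; exists n0 => n /h; rewrite hev_1 expr1.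
by move=> h1 h2; split=> //; exact: limn_einf_sup.
Qed.
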